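(* Suppose that $f$ and $F$ are $\mathcal{C}^{1,1}$ on the whole space $\mathbb{X}$ and that the sequence $\{x^k\}_{k\in\mathbb{N}}$ generated by Algorithm RiVMPL (described in the context) is bounded. Let Algorithm RiVMPL be run with $\mu_k\ge\mu_{\min}>0$ for all $k$ and $\mathcal{Q}_{k,j}=\alpha_{k,j}\mathcal{I}+\beta_k\nabla F(x^k)F'(x^k)$ for a bounded sequence $\{\beta_k\}_{k\in\mathbb{N}}$ of positive numbers, with the termination condition $\|v^{k,j}\|=0$ replaced by $\|v^{k,j}\|\le\chi\epsilon$. Suppose that for each $k\in\mathbb{N}$ and $j\in\{0,\ldots,j_k\}$ the subproblem $\min_{v\in T_{x^k}\mathcal{M}}\Theta_{k,j}(v)$ is solved by Algorithm DFG (described in the context), started from a point of a fixed bounded set $Z\subset\mathbb{Z}$, with $v^{k,j}$ the last primal iterate (resp. the average primal iterate) and $\Theta^{\rm LB}_{k,j}$ the dual objective value returned by Algorithm DFG. Then Algorithm RiVMPL returns an $\epsilon$-stationary point of $\min_{x\in\mathcal{M}}\Theta(x)$ by calling the oracles at most $O(\epsilon^{-4})$ times (resp. at most $O(\epsilon^{-3})$ times). Here the oracles are those computing $f(x),\nabla f(x),F(x),F'(x)v,\nabla F(x)w$, the projection $\Pi_{T_x\mathcal{M}}(\xi)$, and the proximal mapping $\mathcal{P}_{\gamma\vartheta}(z)$ for $x,v,\xi\in\mathbb{X}$ and $z,w\in\mathbb{Z}$.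
   Context: Setting. $\mathbb{X},\mathbb{Z}$ are finite-dimensional real inner product spaces with induced norms $\|\cdot\|$; $\mathcal{M}\subset\mathbb{X}$ is a $\mathcal{C}^2$-smooth embedded closed submanifold with tangent spaces $T_x\mathcal{M}$. The problem is $\min_{x\in\mathcal{M}}\Theta(x):=f(x)+\vartheta(F(x))$ under the standing assumptions: (i) $f:\mathbb{X}\to(-\infty,\infty]$ is proper, lower semicontinuous, and $\mathcal{C}^{1,1}$ (differentiable with locally Lipschitz gradient) on an open convex set $\mathcal{O}\supset\mathcal{M}$; (ii) $\vartheta:\mathbb{Z}\to\mathbb{R}$ is convex with a closed-form proximal mapping; (iii) $F:\mathbb{X}\to\mathbb{Z}$ is $\mathcal{C}^{1,1}$ on $\mathcal{O}$ (differentiable with locally Lipschitz derivative); (iv) $\inf_{x\in\mathcal{M}}\Theta(x)>-\infty$. $F'(x)$ is the differential, $\nabla F(x)$ its adjoint, and $\ell_F(x;z):=F(z)+F'(z)(x-z)$. $\Pi_C$ is the projection onto $C$, $\mathcal{I}$ the identity, $\|v\|_{\mathcal{Q}}^2:=\langle v,\mathcal{Q}v\rangle$, and $\mathcal{P}_{\gamma\vartheta}(z):=\arg\min_{z'}\{\vartheta(z')+\frac{1}{2\gamma}\|z'-z\|^2\}$. A retraction is a smooth map $R:T\mathcal{M}\to\mathcal{M}$ ($T\mathcal{M}$ the tangent bundle) such that $R_x:=R(x,\cdot):T_x\mathcal{M}\to\mathcal{M}$ satisfies $R_x(0)=x$ and $R_x'(0)=\mathcal{I}$ for every $x\in\mathcal{M}$.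 Algorithm RiVMPL. Input: a retraction $R$, parameters $0<\alpha_{\min}\le\alpha_{\max}$, $\mu_{\max}>0$, $\overline{\alpha}>0$, $\overline{\gamma}>0$, $\sigma>1$, and $x^0\in\mathcal{M}$. For $k=0,1,2,\ldots$: choose $\alpha_{k,0}\in[\alpha_{\min},\alpha_{\max}]$ and $\mu_k\in(0,\mu_{\max}]$. Inner loop, $j=0,1,2,\ldots$: choose a self-adjoint linear operator $\mathcal{Q}_{k,j}:\mathbb{X}\to\mathbb{X}$ with $\alpha_{k,j}\mathcal{I}\preceq\mathcal{Q}_{k,j}\preceq(\overline{\alpha}+\alpha_{k,j})\mathcal{I}$; let $$\Theta_{k,j}(v):=\langle\nabla f(x^k),v\rangle+\tfrac12\|v\|^2_{\mathcal{Q}_{k,j}}+\vartheta(\ell_F(x^k+v;x^k))+f(x^k)$$ and let $\overline{v}^{k,j}$ be its unique minimizer over $v\in T_{x^k}\mathcal{M}$; find $(v^{k,j},\Theta^{\rm LB}_{k,j})\in T_{x^k}\mathcal{M}\times(-\infty,\Theta_{k,j}(\overline{v}^{k,j})]$ with $$\Theta_{k,j}(v^{k,j})\le\Theta_{k,j}(0)\quad\text{and}\quad\Theta_{k,j}(v^{k,j})-\Theta^{\rm LB}_{k,j}\le\tfrac{\mu_k}{2}\|v^{k,j}\|^2.\qquad(\ast)$$ If $\Theta(R_{x^k}(v^{k,j}))\le\Theta_{k,j}(v^{k,j})-\frac{\overline{\gamma}}{2}\|v^{k,j}\|^2$ or $\|v^{k,j}\|=0$, leave the inner loop; else set $\alpha_{k,j+1}:=\sigma\alpha_{k,j}$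 and continue it. After the inner loop: if $\|v^{k,j}\|=0$, stop; else set $j_k:=j$, $v^k:=v^{k,j_k}$, $\overline{v}^k:=\overline{v}^{k,j_k}$, $\mathcal{Q}_k:=\mathcal{Q}_{k,j_k}$, $\Theta_k:=\Theta_{k,j_k}$, $x^{k+1}:=R_{x^k}(v^k)$. Constants. When $\{x^k\}$ is bounded there is $b_\alpha>0$ with $\alpha_{k,j}\le b_\alpha$ for all $k\in\mathbb{N}$ and $j\in\{0,\ldots,j_k\}$; fix one and put $\alpha^*:=b_\alpha+\overline{\alpha}$, $c_{\nabla F}:=\sup_k\|F'(x^k)\|$, $\chi:=\frac{[\max\{\alpha^*,c_{\nabla F}\}]^{-1}}{(\alpha_{\min}^{-1}\mu_{\max})^{1/2}+1}$. The constants hidden in $O(\cdot)$ are independent of $\epsilon$. Dual problem. With $\mathcal{Q}_{k,j}=\alpha_{k,j}\mathcal{I}+\beta_k\nabla F(x^k)F'(x^k)$, let $$\mathcal{L}_{k,j}(v,z,\zeta):=\langle\nabla f(x^k),v\rangle+\tfrac{\alpha_{k,j}}{2}\|v\|^2+\tfrac{\beta_k}{2}\|z-F(x^k)\|^2+\vartheta(z)+\langle\zeta,\ell_F(x^k+v;x^k)-z\rangle+f(x^k),$$ $\Psi_{k,j}(\zeta):=\min_{v\in T_{x^k}\mathcal{M},z\in\mathbb{Z}}\mathcal{L}_{k,j}(v,z,\zeta)$; the dual problem is $\max_{\zeta\in\mathbb{Z}}\Psi_{k,j}(\zeta)$, a smooth concave problem whose value is $\Theta_{k,j}(\overline{v}^{k,j})$.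 The minimizer $(v(\zeta),z(\zeta))$ in the definition of $\Psi_{k,j}(\zeta)$ is $v(\zeta)=-\alpha_{k,j}^{-1}\Pi_{T_{x^k}\mathcal{M}}(\nabla F(x^k)\zeta+\nabla f(x^k))$, $z(\zeta)=\mathcal{P}_{\beta_k^{-1}\vartheta}(F(x^k)+\beta_k^{-1}\zeta)$. Algorithm DFG (dual fast gradient method of Necoara and Patrascu, equivalently FISTA applied to the dual). With $L_{\rm d}$ the Lipschitz constant of $\nabla\Psi_{k,j}$, start from $\zeta^0=y^1\in Z$, $\theta_1=1$; for $l=1,2,\ldots$ set $\zeta^l=y^l+L_{\rm d}^{-1}\nabla\Psi_{k,j}(y^l)$, $\theta_{l+1}=\frac{1+\sqrt{1+4\theta_l^2}}{2}$, $y^{l+1}=\zeta^l+\frac{\theta_l-1}{\theta_{l+1}}(\zeta^l-\zeta^{l-1})$. The last primal iterate at step $l$ is $v(\zeta^l)$; the average primal iterate is $\big(\sum_{i=1}^l\theta_i\big)^{-1}\sum_{i=1}^l\theta_i v(y^i)$; the dual objective value is $\Psi_{k,j}(\zeta^l)$. The method is stopped as soon as the pair (primal iterate, dual value) satisfies $(\ast)$. A point $\overline{x}\in\mathcal{M}$ is an $\epsilon$-stationary point if there exist $\overline{z}\in\mathbb{Z}$ and $\overline{\xi}\in\partial\vartheta(\overline{z})$ such that $\max\{\|\Pi_{T_{\overline{x}}\mathcal{M}}(\nabla f(\overline{x})+\nabla F(\overline{x})\overline{\xi})\|,\|F(\overline{x})-\overline{z}\|\}\le\epsilon$.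
   Formalization: β_k is also assumed bounded below by a positive constant; the O(ε⁻⁴) (resp. O(ε⁻³)) bound covers oracle calls before the terminating subproblem, and the total including it has an extra O(‖v‖⁻²) (resp. O(‖v‖⁻¹)) for its nonzero final v. The literal claim fails without these changes. *)

(* Defs.v *)
From HB Require Import structures.
From mathcomp Require Import all_boot all_order all_algebra.
From mathcomp Require Import boolp classical_sets functions reals.
From mathcomp Require Import topology normedtype derive convex.

Set Implicit Arguments.
Unset Strict Implicit.
Unset Printing Implicit Defensive.

Import Order.TTheory GRing.Theory Num.Theory.
Import numFieldNormedType.Exports.

Local Open Scope classical_set_scope.
Local Open Scope ring_scope.

(* Finite-dimensional real inner product spaces, with the induced norm. *)
HB.mixin Record isEuclidean (R : realType) V & NormedModule R V := {
  dotp : {dot V for idfun} ;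
  dotp_norm : forall x : V, dotp x x = `|x| ^+ 2 ;
  finite_dim : exists n (e : 'I_n -> V),
    forall x, exists c : 'I_n -> R, x = \sum_(i < n) c i *: e i
}.

#[short(type="euclideanType")]
HB.structure Definition Euclidean (R : realType) :=
  {V of NormedModule R V & isEuclidean R V}.

Notation "''[' x , y ]" := (dotp x y) : ring_scope.

Section Calculus.
Context {R : realType}.

(* There is no topology on spaces of linear maps in the library: continuity of
   a derivative is required direction by direction, which in finite dimension
   is the same as continuity in operator norm. *)
Definition C1_on (V W : normedModType R) (U : set V) (g : V -> W) :=
  forall x, U x -> differentiable g x /\
    forall v, {for x, continuous (fun y => 'd g y v)}.

Definition C2_on (V W : normedModType R) (U : set V) (g : V -> W) :=
  C1_on U g /\ forall v, C1_on U (fun y => 'd g y v).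

Definition opnorm (V W : normedModType R) (L : V -> W) : R :=
  sup [set `|L v| | v in [set v : V | `|v| <= 1]].

Definition argmin (V : normedModType R) (D : set V) (h : V -> R) : V :=
  xget 0 [set p | D p /\ forall y, D y -> h p <= h y].

Definition grad (X : euclideanType R) (f : X -> R) (x : X) : X :=
  xget 0 [set g | forall v, 'd f x v = '[g, v]].

Definition adjoint (X Z : euclideanType R) (L : X -> Z) (w : Z) : X :=
  xget 0 [set u | forall v, '[u, v] = '[w, L v]].

Definition C11_fun (X : euclideanType R) (f : X -> R) :=
  (forall x, differentiable f x) /\
  [locally [lipschitz grad f x | x in [set: X]]].

Definition C11_map (X Z : euclideanType R) (F : X -> Z) :=
  (forall x, differentiable F x) /\
  forall x : X, exists L : R, \forall y & y' \near x,
    opnorm (fun v => 'd F y v - 'd F y' v) <= L * `|y - y'|.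

Definition proj (X : euclideanType R) (C : set X) (x : X) : X :=
  argmin C (fun y => `|x - y|).

Definition prox (Z : euclideanType R) (gamma : R) (theta : Z -> R) (z : Z) : Z :=
  argmin setT (fun y => theta y + (2 * gamma)^-1 * `|y - z| ^+ 2).

Definition subdiff (Z : euclideanType R) (theta : Z -> R) (z : Z) : set Z :=
  [set xi | forall y, theta z + '[xi, y - z] <= theta y].

(* [M] is a C^2 embedded submanifold of codimension [m] and, for [x] in [M],
   [T x] is its tangent space at [x]: near each point, [M] is the zero set of a
   C^2 submersion [h], and [T x] is the kernel of the differential of [h]. On
   [M], the family [T] is determined by [M]. *)
Definition C2_submanifold (X : euclideanType R) (M : set X) (T : X -> set X) :=
  exists m, forall x, M x -> exists (U : set X) (h : X -> 'rV[R]_m),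
    [/\ open U, U x, C2_on U h, M `&` U = [set y | U y /\ h y = 0] &
        forall y, (M `&` U) y ->
          range ('d h y) = setT /\ T y = [set v | 'd h y v = 0]].

(* The map [(x, v) |-> Rt x v] on the tangent bundle is smooth when it is
   locally the restriction of a smooth map defined on an open subset of the
   ambient space X * X; since M is of class C^2, smooth means C^2. *)
Definition retraction (X : euclideanType R) (M : set X) (T : X -> set X)
    (Rt : X -> X -> X) :=
  [/\ forall x v, M x -> T x v -> M (Rt x v),
      forall x v, M x -> T x v ->
        exists (W : set (X * X)) (G : X * X -> X),
          [/\ open W, W (x, v), C2_on W G &
              forall y u, M y -> T y u -> W (y, u) -> Rt y u = G (y, u)],
      forall x, M x -> Rt x 0 = x &
      forall x, M x -> forall e : R, 0 < e ->
        \forall v \near (0 : X), T x v -> `|Rt x v - Rt x 0 - v| <= e * `|v|].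

End Calculus.

(* Minimization of [pb_f + vartheta \o pb_F] over the submanifold [feas], whose
   tangent space at [x] is [tangent x]. *)
Record problem (R : realType) (X Z : euclideanType R) := Problem {
  feas : set X ;
  tangent : X -> set X ;
  pb_f : X -> R ;
  vartheta : Z -> R ;
  pb_F : X -> Z
}.

Record algo_input (R : realType) (X : euclideanType R) := AlgoInput {
  retr : X -> X -> X ;
  alpha_min : R ;
  alpha_max : R ;
  mu_max : R ;
  alpha_bar : R ;
  gamma_bar : R ;
  sigma : R ;
  x_init : X
}.

(* The quantities produced by the algorithm; [iter_lb k j] is
   Theta^LB_{k,j} and [j_last k] is j_k. Values at indices which are not visited
   are irrelevant. *)
Record trace (R : realType) (X : euclideanType R) := Trace {
  iter_x : nat -> X ;
  iter_mu : nat -> R ;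
  iter_alpha : nat -> nat -> R ;
  iter_Q : nat -> nat -> {linear X -> X} ;
  iter_v : nat -> nat -> X ;
  iter_lb : nat -> nat -> R ;
  j_last : nat -> nat
}.

(* [dfg_steps k j] is the number of steps of the dual fast gradient method on
   the subproblem (k, j), and [dfg_start k j] its starting point. *)
Record dfg_data (R : realType) (Z : euclideanType R) := DfgData {
  beta : nat -> R ;
  dfg_start : nat -> nat -> Z ;
  dfg_steps : nat -> nat -> nat
}.

Inductive primal_output := Last | Average.

Inductive query (R : realType) (X Z : euclideanType R) :=
| Query_f of X
| Query_grad_f of X
| Query_F of X
| Query_dF of X & X
| Query_adj_dF of X & Z
| Query_proj of X & X
| Query_prox of R & Z.

Arguments Query_f {R X Z}.
Arguments Query_grad_f {R X Z}.
Arguments Query_F {R X Z}.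
Arguments Query_dF {R X Z}.
Arguments Query_adj_dF {R X Z}.
Arguments Query_proj {R X Z}.
Arguments Query_prox {R X Z}.

Section RiVMPL.
Context {R : realType} {X Z : euclideanType R}.
Variables (P : problem X Z) (p : algo_input X).
Implicit Types (x u : X) (z zeta : Z) (a b tol : R) (t : trace X).

Definition standing_assumptions :=
  [/\ closed (feas P) /\ C2_submanifold (feas P) (tangent P),
      C11_fun (pb_f P),
      convex_function setT (vartheta P),
      C11_map (pb_F P) &
      has_lbound [set pb_f P x + vartheta P (pb_F P x) | x in feas P]].

Definition valid_input :=
  [/\ retraction (feas P) (tangent P) (retr p),
      0 < alpha_min p <= alpha_max p,
      [/\ 0 < mu_max p, 0 < alpha_bar p & 0 < gamma_bar p],
      1 < sigma p & feas P (x_init p)].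

Definition Theta x : R := pb_f P x + vartheta P (pb_F P x).

Definition linF x x0 : Z := pb_F P x0 + 'd (pb_F P) x0 (x - x0).

Definition dF x : X -> Z := 'd (pb_F P) x.

Definition adj_dF x : Z -> X := adjoint (dF x).

Definition eps_stationary (eps : R) x :=
  feas P x /\ exists z xi, subdiff (vartheta P) z xi /\
    Num.max `|proj (tangent P x) (grad (pb_f P) x + adj_dF x xi)|
            `|pb_F P x - z| <= eps.

Definition model x (q : X -> X) u : R :=
  '[grad (pb_f P) x, u] + 2^-1 * '[u, q u] + vartheta P (linF (x + u) x)
    + pb_f P x.

Definition model_min x (q : X -> X) : R :=
  model x q (argmin (tangent P x) (model x q)).

Definition inexact_solution x (q : X -> X) (mu_k : R) u (l : R) :=
  [/\ tangent P x u, l <= model_min x q, model x q u <= model x q 0 &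
      model x q u - l <= mu_k / 2 * `|u| ^+ 2].

Definition sufficient_decrease t k j :=
  Theta (retr p (iter_x t k) (iter_v t k j)) <=
    model (iter_x t k) (iter_Q t k j) (iter_v t k j)
      - gamma_bar p / 2 * `|iter_v t k j| ^+ 2.

(* [visited tol t k j]: the subproblem (k, j) is set up and solved when the
   algorithm stops as soon as the norm of v^{k,j} is at most [tol]. The
   original stopping test is [tol = 0]. *)
Inductive visited tol t : nat -> nat -> Prop :=
| visited_init : visited tol t 0 0
| visited_inner k j : visited tol t k j -> tol < `|iter_v t k j| ->
    ~ sufficient_decrease t k j -> visited tol t k j.+1
| visited_outer k j : visited tol t k j -> tol < `|iter_v t k j| ->
    sufficient_decrease t k j -> visited tol t k.+1 0.

Definition stops_at tol t k j := visited tol t k j /\ `|iter_v t k j| <= tol.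

Definition RiVMPL_run tol t :=
  [/\ iter_x t 0 = x_init p,
      forall k, visited tol t k 0 ->
        alpha_min p <= iter_alpha t k 0 <= alpha_max p /\
        0 < iter_mu t k <= mu_max p,
      forall k j, visited tol t k j ->
        [/\ forall u u', '[iter_Q t k j u, u'] = '[u, iter_Q t k j u'],
            forall u, iter_alpha t k j * `|u| ^+ 2 <= '[u, iter_Q t k j u]
                      <= (alpha_bar p + iter_alpha t k j) * `|u| ^+ 2 &
            inexact_solution (iter_x t k) (iter_Q t k j) (iter_mu t k)
              (iter_v t k j) (iter_lb t k j)],
      forall k j, visited tol t k j -> tol < `|iter_v t k j| ->
        ~ sufficient_decrease t k j ->
        iter_alpha t k j.+1 = sigma p * iter_alpha t k j &
      forall k j, visited tol t k j -> tol < `|iter_v t k j| ->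
        sufficient_decrease t k j ->
        j_last t k = j /\ iter_x t k.+1 = retr p (iter_x t k) (iter_v t k j)].

Definition iterates_bounded rho tol t :=
  forall k j, visited tol t k j -> `|iter_x t k| <= rho.

Definition stepsizes_bounded b_alpha tol t :=
  forall k j, visited tol t k j -> iter_alpha t k j <= b_alpha.

Definition c_dF tol t : R :=
  sup [set opnorm (dF (iter_x t k))
      | k in [set k | exists j, visited tol t k j]].

Definition chi b_alpha tol t : R :=
  (Num.max (b_alpha + alpha_bar p) (c_dF tol t))^-1
    / (Num.sqrt ((alpha_min p)^-1 * mu_max p) + 1).

(* The dual of the subproblem at x with quadratic term a I + b F'(x)^* F'(x). *)
Definition lagrangian x a b u z zeta : R :=
  '[grad (pb_f P) x, u] + a / 2 * `|u| ^+ 2 + b / 2 * `|z - pb_F P x| ^+ 2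
    + vartheta P z + '[zeta, linF (x + u) x - z] + pb_f P x.

Definition dual x a b zeta : R :=
  inf [set r | exists u z, tangent P x u /\ r = lagrangian x a b u z zeta].

Definition primal_v x a zeta : X :=
  - (a^-1 *: proj (tangent P x) (adj_dF x zeta + grad (pb_f P) x)).

Definition dual_lipschitz x a b : R :=
  inf [set L | 0 <= L /\ L.-lipschitz (grad (dual x a b))].

(* [dfg x a b zeta0 n] is (zeta^n, y^{n+1}, theta_{n+1}). *)
Fixpoint dfg x a b (zeta0 : Z) n : Z * Z * R :=
  if n is n'.+1 then
    let: (zeta, y, th) := dfg x a b zeta0 n' in
    let zeta' := y + (dual_lipschitz x a b)^-1 *: grad (dual x a b) y in
    let th' := (1 + Num.sqrt (1 + 4 * th ^+ 2)) / 2 in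
    (zeta', zeta' + ((th - 1) / th') *: (zeta' - zeta), th')
  else (zeta0, zeta0, 1).

Definition dfg_zeta x a b zeta0 l : Z := (dfg x a b zeta0 l).1.1.
Definition dfg_y x a b zeta0 l : Z := (dfg x a b zeta0 l.-1).1.2.
Definition dfg_theta x a b zeta0 l : R := (dfg x a b zeta0 l.-1).2.

Definition average_v x a b zeta0 l : X :=
  (\sum_(1 <= i < l.+1) dfg_theta x a b zeta0 i)^-1 *:
    \sum_(1 <= i < l.+1)
      dfg_theta x a b zeta0 i *: primal_v x a (dfg_y x a b zeta0 i).

Definition dfg_primal out x a b zeta0 l : X :=
  match out with
  | Last => primal_v x a (dfg_zeta x a b zeta0 l)
  | Average => average_v x a b zeta0 l
  end.

Definition solved_by_DFG out (Z0 : set Z) (d : dfg_data Z) tol t :=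
  forall k j, visited tol t k j ->
    let x := iter_x t k in
    let a := iter_alpha t k j in
    let b := beta d k in
    let zeta0 := dfg_start d k j in
    let N := dfg_steps d k j in
    [/\ forall u, iter_Q t k j u = a *: u + b *: adj_dF x (dF x u),
        Z0 zeta0 /\ (0 < N)%N,
        iter_v t k j = dfg_primal out x a b zeta0 N,
        iter_lb t k j = dual x a b (dfg_zeta x a b zeta0 N) &
        forall l, (0 < l < N)%N ->
          ~ inexact_solution x (iter_Q t k j) (iter_mu t k)
              (dfg_primal out x a b zeta0 l)
              (dual x a b (dfg_zeta x a b zeta0 l))].

(* The oracle calls which yield v(zeta), F'(x) v(zeta) and z(zeta), hence the
   value and the gradient of the dual function at zeta. *)
Definition dual_queries x a b zeta : seq (query X Z) :=
  [:: Query_adj_dF x zeta;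
      Query_proj x (adj_dF x zeta + grad (pb_f P) x);
      Query_dF x (primal_v x a zeta);
      Query_prox b^-1 (pb_F P x + b^-1 *: zeta)].

Definition dfg_step_queries out x a b zeta0 l : seq (query X Z) :=
  dual_queries x a b (dfg_y x a b zeta0 l)
  ++ dual_queries x a b (dfg_zeta x a b zeta0 l)
  ++ (if out is Average then [:: Query_dF x (average_v x a b zeta0 l)]
      else [::]).

Definition dfg_queries out (d : dfg_data Z) t k j : seq (query X Z) :=
  flatten [seq dfg_step_queries out (iter_x t k) (iter_alpha t k j) (beta d k)
             (dfg_start d k j) l | l <- iota 1 (dfg_steps d k j)].

Definition subproblem_queries out d t k j : seq (query X Z) :=
  dfg_queries out d t k j
  ++ (let y := retr p (iter_x t k) (iter_v t k j) in [:: Query_f y; Query_F y]).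

Definition outer_queries t k : seq (query X Z) :=
  let x := iter_x t k in [:: Query_f x; Query_grad_f x; Query_F x].

(* The oracle calls made before the solution of subproblem (k, j) starts. *)
Definition queries_before out d t k j : seq (query X Z) :=
  flatten [seq outer_queries t k' ++
             flatten [seq subproblem_queries out d t k' j'
                     | j' <- iota 0 (j_last t k').+1] | k' <- iota 0 k]
  ++ outer_queries t k
  ++ flatten [seq subproblem_queries out d t k j' | j' <- iota 0 j].

Definition queries_upto out d t k j : seq (query X Z) :=
  queries_before out d t k j ++ subproblem_queries out d t k j.

End RiVMPL.

(* Main.v *)
Require Import Defs.
From HB Require Import structures.
From mathcomp Require Import all_boot all_order all_algebra.
From mathcomp Require Import ring lra.
From mathcomp Require Import boolp classical_sets functions reals interval_inference.
From mathcomp Require Import topology normedtype landau derive convex.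

Set Implicit Arguments.
Unset Strict Implicit.
Unset Printing Implicit Defensive.

Import Order.TTheory GRing.Theory Num.Theory.
Import numFieldNormedType.Exports.

Local Open Scope classical_set_scope.
Local Open Scope ring_scope.

(* On the compact set of feasible points of norm at most rho, the first-order
   expansions of f, F and of the retraction have uniform quadratic remainders,
   and vartheta is Lipschitz on bounded sets. Hence Theta(R_x(v)) exceeds the
   model by at most a multiple of |v|^2, the sufficient decrease test succeeds
   once alpha is large, and the stepsizes, hence the inner loops, are bounded.
   Each outer iteration with |v| > chi eps decreases Theta by a multiple of
   eps^2, so there are O(eps^-2) of them.

   The dual function of a subproblem is concave and coercive, and its gradient
   is the residual F(x) + F'(x) v(zeta) - z(zeta). A dual maximizer therefore
   gives strong duality, the exact minimizer of the model and a subgradient of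
   vartheta; the latter two give the stationarity of x when |v| <= chi eps.

   For the fast gradient method, sum_i theta_i l_i(zeta) is at most
   theta_l^2 Psi(zeta^l) + L/2 |zeta - zeta^0|^2 for every zeta, where l_i is
   the linearization of Psi at y^i, that is, the Lagrangian at
   (v(y^i), z(y^i), zeta). By convexity of the Lagrangian in (v, z) this bounds
   its value at the averaged iterates. Taking zeta to be a maximizer yields the
   dual rate O(1/l^2), whence a distance O(1/l) of the primal iterates to the
   exact solution and a gap O(1/l) for the last iterate; taking zeta along the
   violation of the constraint z = F(x) + F'(x) v yields a gap O(1/l^2) for the
   average. So the test stops after O(|v|^-2), resp. O(|v|^-1), steps. *)

(** * Inner products, Parseval frames and Riesz representation *)

Section InnerProduct.
Context {R : realType} {X : euclideanType R}.
Implicit Types (x y z : X) (a b : R).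

Lemma dotC x y : '[x, y] = '[y, x].
Proof. by rewrite hermC expr0 mul1r. Qed.

Lemma dotDl x y z : '[x + y, z] = '[x, z] + '[y, z].
Proof. by rewrite linearDl. Qed.

Lemma dotDr x y z : '[z, x + y] = '[z, x] + '[z, y].
Proof. by rewrite linearD. Qed.

Lemma dotNl x z : '[- x, z] = - '[x, z].
Proof. by rewrite linearNl. Qed.

Lemma dotNr x z : '[z, - x] = - '[z, x].
Proof. by rewrite linearN. Qed.

Lemma dotBl x y z : '[x - y, z] = '[x, z] - '[y, z].
Proof. by rewrite dotDl dotNl. Qed.

Lemma dotBr x y z : '[z, x - y] = '[z, x] - '[z, y].
Proof. by rewrite dotDr dotNr. Qed.

Lemma dotZl a x z : '[a *: x, z] = a * '[x, z].
Proof. by rewrite linearZl_LR. Qed.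

Lemma dotZr a x z : '[z, a *: x] = a * '[z, x].
Proof. by rewrite linearZ. Qed.

Lemma dot0l x : '[0, x] = 0. Proof. by rewrite linear0l. Qed.

Lemma dot0r x : '[x, 0] = 0. Proof. by rewrite linear0. Qed.

Definition dotE := (dotDl, dotDr, dotNl, dotNr, dotZl, dotZr).

Lemma dot_suml (I : Type) (r : seq I) (F : I -> X) y :
  '[\sum_(i <- r) F i, y] = \sum_(i <- r) '[F i, y].
Proof. by apply: (big_morph (fun x => '[x, y])) => [u v|]; rewrite ?dotDl ?dot0l. Qed.

Lemma dot_sumr (I : Type) (r : seq I) (F : I -> X) y :
  '[y, \sum_(i <- r) F i] = \sum_(i <- r) '[y, F i].
Proof. by rewrite linear_sum. Qed.

Lemma normD2 x y : `|x + y| ^+ 2 = `|x| ^+ 2 + 2 * '[x, y] + `|y| ^+ 2.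
Proof. by rewrite -!dotp_norm !dotE (dotC y x); ring. Qed.

Lemma normB2 x y : `|x - y| ^+ 2 = `|x| ^+ 2 - 2 * '[x, y] + `|y| ^+ 2.
Proof. by rewrite normD2 dotNr normrN; ring. Qed.

Lemma normZ2 a x : `|a *: x| ^+ 2 = a ^+ 2 * `|x| ^+ 2.
Proof. by rewrite -!dotp_norm !dotE; ring. Qed.

Lemma cauchy_schwarz x y : '[x, y] <= `|x| * `|y|.
Proof.
have [->|y0] := eqVneq y 0; first by rewrite dot0r normr0 mulr0.
have [->|x0] := eqVneq x 0; first by rewrite dot0l normr0 mul0r.
have := sqr_ge0 `| `|y| *: x - `|x| *: y |.
rewrite normB2 !normZ2 !dotE.
have := normr_gt0 x; have := normr_gt0 y; rewrite x0 y0 => py px.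
have pp : 0 < `|x| * `|y| by rewrite mulr_gt0.
by move=> h; rewrite -(ler_pM2l pp); lra.
Qed.

Lemma cauchy_schwarz_abs x y : `|'[x, y]| <= `|x| * `|y|.
Proof.
rewrite ler_norml cauchy_schwarz andbT lerNl -dotNl.
by rewrite (le_trans (cauchy_schwarz _ _)) // normrN.
Qed.

Lemma dot_inj x y : (forall z, '[x, z] = '[y, z]) -> x = y.
Proof.
move=> h; apply/eqP; rewrite -subr_eq0 -normr_eq0 -sqrf_eq0 -dotp_norm.
by rewrite dotBl h subrr.
Qed.


Lemma dot_norm_le x (c : R) : 0 <= c -> '[x, x] <= c * `|x| -> `|x| <= c.
Proof.
move=> c0; rewrite dotp_norm expr2.
have [->|x0] := eqVneq x 0; first by rewrite normr0.
by rewrite ler_pM2r // normr_gt0.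
Qed.

(* A Parseval frame: it satisfies the reconstruction formula of an orthonormal
   basis, which is all that is used of a basis below. *)
Lemma parseval_frame : exists b : seq X, forall x, x = \sum_(e <- b) '[x, e] *: e.
Proof.
(* Gram-Schmidt along [s]. The invariant on [b]: expanding any [e'] along [b] preserves its products
   with the members of [b]. This makes the new residual [r] orthogonal to [b]. *)
have frame_of (s : seq X) : exists b : seq X,
    [/\ forall e e', e \in b -> '[e, \sum_(u <- b) '[e', u] *: u] = '[e, e'] &
       forall x, x \in s -> x = \sum_(e <- b) '[x, e] *: e].
  elim: s => [|x s [b [bo bs]]]; first by exists [::]; split => // e e'; rewrite in_nil.
  pose r := x - \sum_(e <- b) '[x, e] *: e.
  have rb e : e \in b -> '[e, r] = 0.
    by move=> eb; rewrite /r dotBr bo // subrr.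
  have [r0|r0] := eqVneq r 0.
    exists b; split => // y; rewrite inE => /orP[/eqP ->|/bs //].
    by apply/eqP; rewrite -subr_eq0 -/r r0.
  have nr0 : `|r| != 0 by rewrite normr_eq0.
  pose u := `|r|^-1 *: r.
  have uu : '[u, u] = 1 by rewrite dotp_norm normZ2 exprVn mulVf // expf_neq0.
  have bu e : e \in b -> '[e, u] = 0 by move=> /rb h; rewrite dotZr h mulr0.
  have su c : '[u, \sum_(e <- b) c e *: e] = 0.
    rewrite dot_sumr big_seq big1 // => e eb.
    by rewrite dotZr dotC bu // mulr0.
  exists (u :: b); split=> [e e'|y]; rewrite !inE.
    case/orP=> [/eqP ->|eb].
      by rewrite big_cons dotDr su addr0 dotZr uu mulr1 dotC.
    by rewrite big_cons dotDr bo // dotZr (bu e eb) mulr0 add0r.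
  rewrite big_cons.
  have xE : x = `|r| *: u + \sum_(e <- b) '[x, e] *: e.
    by rewrite /u scalerA divff // scale1r /r subrK.
  case/orP=> [/eqP ->|/bs ys].
    suff -> : '[x, u] = `|r| by rewrite -xE.
    by rewrite {1}xE dotDl dotZl uu mulr1 dotC su addr0.
  suff -> : '[y, u] = 0 by rewrite scale0r add0r.
  by rewrite ys dotC su.
have [n [e eP]] := finite_dim (s := X).
have [b [_ bP]] := frame_of (map e (enum 'I_n)).
exists b => x; have [c ->] := eP x.
under [RHS]eq_bigr do rewrite dot_suml scaler_suml.
rewrite exchange_big /=; apply: eq_bigr => i _.
under eq_bigr do rewrite dotZl -scalerA.
by rewrite -scaler_sumr -bP // map_f // mem_enum.
Qed.

Lemma linear_bound (W : normedModType R) (L : {linear X -> W}) :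
  exists2 c, 0 <= c & forall x, `|L x| <= c * `|x|.
Proof.
have [b bP] := parseval_frame.
exists (\sum_(e <- b) `|e| * `|L e|); first by rewrite sumr_ge0 // => e _; rewrite mulr_ge0.
move=> x; rewrite {1}(bP x) linear_sum mulr_suml (le_trans (ler_norm_sum _ _ _)) //.
apply: ler_sum => e _; rewrite linearZ normrZ.
rewrite mulrAC ler_wpM2r // mulrC; exact: cauchy_schwarz_abs.
Qed.

Lemma riesz (L : {linear X -> R^o}) : exists g, forall v, L v = '[g, v].
Proof.
have [b bP] := parseval_frame.
exists (\sum_(e <- b) L e *: e) => v.
rewrite [in LHS](bP v) linear_sum dot_suml; apply: eq_bigr => e _.
by rewrite linearZ /= dotZl (dotC v) mulrC.
Qed.

End InnerProduct.

(** * Adjoints, continuity and operator norms in finite dimension *)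

Section LinearMaps.
Context {R : realType}.

Lemma adjointP (X Z : euclideanType R) (L : {linear X -> Z}) w v :
  '[adjoint L w, v] = '[w, L v].
Proof.
suff [u uP] : exists u, forall v, '[u, v] = '[w, L v].
  by rewrite /adjoint; case: xgetP => [_ -> //|/(_ u)].
have [b bP] := parseval_frame (X := X).
exists (\sum_(e <- b) '[w, L e] *: e) => {}v.
rewrite [in RHS](bP v) linear_sum dot_suml dot_sumr; apply: eq_bigr => e _.
by rewrite linearZ dotZl dotZr (dotC v) mulrC.
Qed.

Lemma linear_bound_continuous (V W : normedModType R) (L : {linear V -> W}) (c : R) :
  (forall x, `|L x| <= c * `|x|) -> continuous L.
Proof.
move=> h; apply/linear_bounded_continuous/linear_boundedP.
near=> r => x; rewrite (le_trans (h x)) // ler_wpM2r //.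
Unshelve. all: by end_near.
Qed.

Lemma linear_continuous (X : euclideanType R) (W : normedModType R)
  (L : {linear X -> W}) : continuous L.
Proof. by have [c _ /linear_bound_continuous] := linear_bound L. Qed.

Lemma opnorm_le (X : euclideanType R) (W : normedModType R) (L : {linear X -> W}) x :
  `|L x| <= opnorm L * `|x|.
Proof.
have [->|x0] := eqVneq x 0; first by rewrite linear0 !normr0 mulr0.
have px : 0 < `|x| by rewrite normr_gt0.
rewrite -ler_pdivrMr //.
have [c c0 cP] := linear_bound L.
apply: ub_le_sup; first by exists c => _ [v v1 <-]; rewrite (le_trans (cP v)) // ler_piMr.
exists (`|x|^-1 *: x) => /=; first by rewrite normrZ normfV normr_id mulVf // normr_eq0.
by rewrite linearZ normrZ normfV normr_id mulrC.
Qed.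

Lemma opnorm_ge0 (X : euclideanType R) (W : normedModType R) (L : {linear X -> W}) :
  0 <= opnorm L.
Proof.
have [c c0 cP] := linear_bound L.
apply: ub_le_sup; first by exists c => _ [v v1 <-]; rewrite (le_trans (cP v)) // ler_piMr.
by exists 0 => /=; rewrite ?linear0 normr0.
Qed.

Lemma opnorm_ub (X : euclideanType R) (W : normedModType R) (L : {linear X -> W}) c :
  0 <= c -> (forall x, `|L x| <= c * `|x|) -> opnorm L <= c.
Proof.
move=> c0 cP; apply: ge_sup => [|_ [v v1 <-]]; first by exists `|L 0|, 0; rewrite /= ?normr0.
by rewrite (le_trans (cP v)) // ler_piMr.
Qed.

End LinearMaps.

(** * Compact balls, coercive minimization, uniform constants *)

Section Compactness.
Context {R : realType}.

Lemma closed_sublevel (T : topologicalType) (h : T -> R) (c : R) :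
  continuous h -> closed [set x | h x <= c].
Proof.
by move=> hc; apply: (@preimage_closed _ _ h [set r | r <= c]) => [x _|]; [exact: hc|exact: closed_le].
Qed.

(** By Cauchy-Schwarz the frame coefficients of a point of the ball lie in a fixed box, so the ball
    is a closed subset of the continuous image of that box. *)
Lemma euclidean_ball_compact (X : euclideanType R) (r : R) :
  compact [set x : X | `|x| <= r].
Proof.
have [b bP] := parseval_frame (X := X).
pose phi (c : 'rV[R]_(size b)) : X := \sum_(i < size b) c ord0 i *: b`_i.
have phiE x : phi (\row_i '[x, b`_i]) = x.
  rewrite [RHS](bP x) (big_nth 0) big_mkord.
  by apply: eq_bigr => i _; rewrite mxE.
pose s := \sum_(i < size b) r * `|b`_i|.
pose D := [set c : 'rV[R]_(size b) | forall i, c ord0 i \in `[- (r * `|b`_i|), r * `|b`_i| ] ].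
have cD : compact D.
  apply: (@rV_compact _ _ (fun i : 'I_(size b) => `[- (r * `|b`_i|), r * `|b`_i| ]%classic)).
  by move=> i; apply: segment_compact.
have phic : continuous phi.
  move=> c; apply: differentiable_continuous.
  have -> : phi = \sum_(i < size b) (fun c : 'rV[R]_(size b) => c ord0 i *: b`_i).
    by apply/funext => c'; rewrite fct_sumE.
  by apply: differentiable_sum => i; apply: differentiableZl; apply: differentiable_coord.
apply: (@subclosed_compact _ _ (phi @` D)).
- by apply: closed_sublevel => x; apply: norm_continuous.
- by apply: continuous_compact => //; apply: continuous_subspaceT.
- move=> x /= xr; exists (\row_i '[x, b`_i]); last exact: phiE.
  move=> i; rewrite mxE in_itv /= -ler_norml (le_trans (cauchy_schwarz_abs _ _)) //.
  by rewrite ler_wpM2r.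
Qed.

(** The part of [D] where [h] is at most [h x0] is compact, and a minimizer there minimizes over
    [D]. *)
Lemma coercive_min (X : euclideanType R) (D : set X) (h : X -> R) (x0 : X) (r : R) :
  closed D -> continuous h -> D x0 ->
  (forall x, D x -> h x <= h x0 -> `|x| <= r) ->
  exists2 p, D p & forall y, D y -> h p <= h y.
Proof.
move=> Dc hc Dx0 hr.
pose K := [set x : X | `|x| <= r] `&` (D `&` [set x | h x <= h x0]).
have Kc : compact K.
  apply: compact_closedI; first exact: euclidean_ball_compact.
  by apply: closedI => //; apply: closed_sublevel.
have K0 : K x0 by split => /=; [exact: hr|].
have [||p] := compact_EVT_min (f := h) _ Kc; first by exists x0.
  by apply: continuous_subspaceT.
rewrite inE => -[_ [Dp hp]] pmin; exists p => // y Dy.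
have [hy|/ltW hy] := leP (h y) (h x0); last exact: le_trans hp hy.
by apply: pmin; rewrite inE; split => /=; [exact: hr|].
Qed.

(** The near-covering form of compactness for the filter at infinity: by monotonicity in [c], each
    local constant remains valid for all larger ones. *)
Lemma compact_uniform (T : topologicalType) (K : set T) (P : R -> T -> Prop) :
  compact K -> (forall c c' x, c <= c' -> P c x -> P c' x) ->
  (forall x, K x -> exists c, \forall y \near x, P c y) ->
  exists c, forall x, K x -> P c x.
Proof.
move=> /compact_near_coveringP Kc Pmon Ploc.
have : \forall c \near +oo, K `<=` P c.
  apply: (Kc R (pinfty_nbhs R) P) => x /Ploc [c Pc].
  exists (P c, [set d | c <= d]) => /=; last by move=> [y d] /= [yc cd]; apply: Pmon yc.
  by split => //; exact: nbhs_pinfty_ge (num_real _).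
move=> /(@filter_ex _ (pinfty_nbhs R)) [c cP].
by exists c.
Qed.

End Compactness.

(** * Finite convex functions: local bounds, Lipschitz constants, continuity *)

Section Convex.
Context {R : realType} {Z : euclideanType R} (h : Z -> R).
Hypothesis h_convex : forall (t : R) x y, 0 <= t -> t <= 1 ->
  h (t *: x + (1 - t) *: y) <= t * h x + (1 - t) * h y.

(** Induction on the frame: a combination is the midpoint of its doubled first term and of the
    remaining terms with doubled coefficients, and the first term stays on a segment with fixed
    endpoints. *)
Lemma convex_ball_ub (r : R) : exists B, forall x, `|x| <= r -> h x <= B.
Proof.
have [b bP] := parseval_frame (X := Z).
have comb (s : seq Z) (A : R) : exists B, forall c : Z -> R,
    (forall e, `|c e| <= A) -> h (\sum_(e <- s) c e *: e) <= B.
  elim: s A => [|e s IH] A.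
    by exists (h 0) => c _; rewrite big_nil.
  have [B BP] := IH (2 * A).
  exists (2^-1 * Num.max (h ((2 * A) *: e)) (h ((- (2 * A)) *: e)) + 2^-1 * B) => c cA.
  have -> : \sum_(j <- e :: s) c j *: j =
      2^-1 *: ((2 * c e) *: e) + (1 - 2^-1) *: (\sum_(j <- s) (2 * c j) *: j).
    rewrite big_cons scalerA mulKf ?pnatr_eq0 //; congr (_ + _).
    rewrite scaler_sumr; apply: eq_bigr => j _; rewrite scalerA; congr (_ *: _).
    by field.
  have half0 : 0 <= 2^-1 :> R by lra.
  have half1 : 2^-1 <= 1 :> R by lra.
  apply: (le_trans (h_convex _ _ half0 half1)).
  have -> : 1 - 2^-1 = 2^-1 :> R by lra.
  apply: lerD; last first.
    rewrite ler_pM2l ?invr_gt0 //; apply: BP => j; rewrite normrM ger0_norm //.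
    by rewrite ler_pM2l.
  rewrite ler_pM2l ?invr_gt0 //.
  have A0 : 0 <= A by apply: le_trans (cA e); exact: normr_ge0.
  have [A00|An0] := eqVneq A 0.
    have := cA e; rewrite A00 normr_le0 => /eqP ->.
    by rewrite mulr0 scale0r oppr0 scale0r maxxx.
  have Ap : 0 < A by rewrite lt_neqAle eq_sym An0.
  have := cA e; rewrite ler_norml => /andP[cl cr].
  pose t := (c e + A) / (2 * A).
  have t0 : 0 <= t by apply: divr_ge0; lra.
  have t1 : t <= 1 by rewrite ler_pdivrMr ?mulr_gt0 //; lra.
  have -> : (2 * c e) *: e = t *: ((2 * A) *: e) + (1 - t) *: ((- (2 * A)) *: e).
    rewrite !scalerA -scalerDl; congr (_ *: _); rewrite /t; field; lra.
  rewrite (le_trans (h_convex _ _ t0 t1)) //.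
  set m := Num.max _ _.
  have m1 : h ((2 * A) *: e) <= m by rewrite le_max lexx.
  have m2 : h ((- (2 * A)) *: e) <= m by rewrite le_max lexx orbT.
  have := ler_wpM2l t0 m1; have : 0 <= 1 - t by lra.
  move=> /ler_wpM2l /(_ _ _ m2); lra.
have [B BP] := comb b (`|r| * \sum_(e <- b) `|e|).
exists B => x xr; rewrite (bP x).
(* [comb] asks for a bound on all coefficients, hence the value 0 outside the frame. *)
pose c e := if e \in b then '[x, e] else 0.
have -> : \sum_(e <- b) '[x, e] *: e = \sum_(e <- b) c e *: e.
  by rewrite !big_seq; apply: eq_bigr => e eb; rewrite /c eb.
apply: BP => e; rewrite /c; case: ifP => [eb|_]; last first.
  by rewrite normr0 mulr_ge0 // sumr_ge0.
rewrite (le_trans (cauchy_schwarz_abs _ _)) //; apply: ler_pM => //.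
  by rewrite (le_trans xr) // ler_norm.
by rewrite (big_rem e) //= lerDl sumr_ge0.
Qed.

(** The lower bound comes from the upper one by reflection, 0 being the midpoint of [x] and
    [- x]. *)
Lemma convex_ball_bound (r : R) : exists B, forall x, `|x| <= r -> `|h x| <= B.
Proof.
have [B BP] := convex_ball_ub r.
exists (Num.max B (B - 2 * h 0)) => x xr; rewrite ler_norml.
have h1 := BP x xr; have h2 : h (- x) <= B by apply: BP; rewrite normrN.
have := h_convex (t := 2^-1) x (- x).
have -> : 2^-1 *: x + (1 - 2^-1) *: - x = 0.
  have -> : 1 - 2^-1 = 2^-1 :> R by lra.
  by rewrite scalerN subrr.
move=> /(_ ltac:(lra) ltac:(lra)) h3.
rewrite lerNl !le_max h1 /= andbT; apply/orP; right; lra.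
Qed.

(** The segment from [x] to [y] is prolonged by a unit length to [z], still in the ball of radius
    [r + 1]; convexity on it bounds the slope by the oscillation of [h]. *)
Lemma convex_ball_lipschitz (r : R) : exists2 L, 0 <= L &
  forall x y, `|x| <= r -> `|y| <= r -> h y - h x <= L * `|y - x|.
Proof.
have [B BP] := convex_ball_bound (r + 1).
have [r0|r0] := ltP r 0.
  by exists 0 => // x y xr; have := le_trans (normr_ge0 _) xr; rewrite leNgt r0.
have B0 : 0 <= B by apply: le_trans (BP 0 _); rewrite ?normr0 //; lra.
exists (2 * B) => [|x y xr yr]; first by rewrite mulr_ge0.
have [->|nxy] := eqVneq x y; first by rewrite !subrr normr0 mulr0.
set d := `|y - x|; have d0 : 0 < d by rewrite normr_gt0 subr_eq0 eq_sym.
pose z := y + d^-1 *: (y - x).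
have zr : `|z| <= r + 1.
  rewrite (le_trans (ler_normD _ _)) // lerD // normrZ normfV normr_id mulVf //.
  by rewrite normr_eq0 subr_eq0 eq_sym.
have d1 : 1 + d != 0 by lra.
have yE : y = (1 + d)^-1 *: x + (1 - (1 + d)^-1) *: z.
  have -> : 1 - (1 + d)^-1 = (1 + d)^-1 * d by field.
  have dz : d *: z = d *: y + (y - x).
    by rewrite /z [in LHS]scalerDr scalerA divff ?scale1r // gt_eqF.
  rewrite -scalerA -scalerDr dz addrCA addrC [x + _]addrC subrK.
  by rewrite -[X in _ *: (X + _)]scale1r -scalerDl scalerA mulVf // scale1r.
have t0 : 0 <= (1 + d)^-1 by rewrite invr_ge0; lra.
have t1 : (1 + d)^-1 <= 1 by rewrite invf_le1; lra.
have := h_convex x z t0 t1; rewrite -yE => hy.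
have xr1 : `|x| <= r + 1 by lra.
have := BP _ xr1; have := BP _ zr; rewrite !ler_norml => /andP[z1 z2] /andP[x1 x2].
have e : (1 - (1 + d)^-1) * (h z - h x) <= (1 - (1 + d)^-1) * (2 * B).
  by apply: ler_wpM2l; lra.
have e' : 1 - (1 + d)^-1 <= d.
  have -> : 1 - (1 + d)^-1 = d / (1 + d) by field.
  by rewrite ler_pdivrMr; nra.
have e'' : (1 - (1 + d)^-1) * (2 * B) <= d * (2 * B) by rewrite ler_wpM2r // mulr_ge0.
by lra.
Qed.

(* Slopes of a convex function increase along rays, so a Lipschitz constant near
   [z] bounds the decrease from [z] to every other point. *)
Lemma convex_slope (r L : R) z w :
  (forall x y, `|x| <= r + 1 -> `|y| <= r + 1 -> h y - h x <= L * `|y - x|) ->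
  0 <= L -> `|z| <= r -> h z - h w <= L * `|w - z|.
Proof.
move=> hL L0 zr.
have [w1|w1] := leP (`|w - z|) 1.
  have h1 : `|z| <= r + 1 by lra.
  have h2 : `|w| <= r + 1.
    by rewrite -(subrK z w) (le_trans (ler_normD _ _)) // addrC lerD.
  by rewrite -normrN opprB; exact: hL.
set d := `|w - z| in w1 *.
have d0 : 0 < d by lra.
pose y := d^-1 *: w + (1 - d^-1) *: z.
have yz : y - z = d^-1 *: (w - z).
  by rewrite /y scalerBl scale1r scalerBr addrA addrAC addrK addrC.
have nyz : `|y - z| = 1 by rewrite yz normrZ normfV normr_id mulVf // gt_eqF.
have yr : `|y| <= r + 1.
  by rewrite -(subrK z y) (le_trans (ler_normD _ _)) // nyz addrC lerD.
have t0 : 0 <= d^-1 by rewrite invr_ge0 ltW.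
have t1 : d^-1 <= 1 by rewrite invf_le1 // ltW.
have hz : `|z| <= r + 1 by lra.
have := h_convex w z t0 t1; rewrite -/y => hy.
have := hL y z yr hz; rewrite -normrN opprB nyz mulr1 => hzy.
have : d^-1 * (h z - h w) <= L by lra.
by rewrite mulrC ler_pdivrMr.
Qed.

Lemma convex_continuous : continuous h.
Proof.
move=> z; have [L L0 LP] := convex_ball_lipschitz (`|z| + 1).
apply/cvgrPdist_lt => e e0.
near=> w.
have wz : `|z - w| < 1 by near: w; apply: cvgr_dist_lt => //; exact: ltr01.
have w1 : `|w| <= `|z| + 1.
  by rewrite -(subrK z w) (le_trans (ler_normD _ _)) // addrC lerD // -normrN opprB ltW.
have z1 : `|z| <= `|z| + 1 by lra.
have : `|z - w| < e / (L + 1).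
  by near: w; apply: cvgr_dist_lt => //; rewrite divr_gt0 //; lra.
rewrite ltr_pdivlMr; last by lra.
move=> we; rewrite ltr_norml.
have h1 := LP _ _ w1 z1; have := LP _ _ z1 w1; rewrite -normrN opprB => h2.
have := normr_ge0 (z - w); nra.
Unshelve. all: by end_near.
Qed.

End Convex.

(** * Mean value inequalities and locally uniform first-order expansions *)

Section Calculus.
Context {R : realType}.

(** The mean value theorem for [phi] minus the primitive of the affine bound. The case [b = 0] is
    the usual mean value inequality; [b] carries a Lipschitz derivative. *)
Lemma taylor_le (phi dphi : R -> R) (a b : R) :
  (forall t : R, 0 <= t <= 1 -> is_derive t 1 phi (dphi t)) ->
  (forall t : R, 0 <= t <= 1 -> dphi t <= a + b * t) ->
  phi 1 - phi 0 <= a + b / 2.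
Proof.
move=> dphiP dphi_le.
pose psi t := phi t - (a * t + b / 2 * t ^+ 2).
have dpsi (t : R) : 0 <= t <= 1 -> is_derive t 1 psi (dphi t - (a + b * t)).
  by move=> /dphiP h; apply: is_derive_eq; rewrite /GRing.scale /=; lra.
have [||c] := MVT (f := psi) (df := fun t => dphi t - (a + b * t)) (@ltr01 R).
- by move=> t; rewrite in_itv /= => /andP[t0 t1]; apply: dpsi; rewrite !ltW.
- apply: derivable_within_continuous => t; rewrite in_itv /= => /dpsi h.
  exact: ex_derive.
rewrite in_itv /= => /andP[c0 c1].
have c01 : 0 <= c <= 1 by rewrite !ltW.
have := dphi_le c c01; rewrite /psi expr1n expr0n /=; lra.
Qed.

Lemma is_derive_line (Y V : normedModType R) (G : Y -> V) y h t :
  differentiable G (y + t *: h) ->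
  is_derive t 1 (fun s => G (y + s *: h)) ('d G (y + t *: h) h).
Proof.
move=> dG.
have dline : is_diff t (fun s : R => y + s *: h) (fun s : R => s *: h).
  by apply: is_diff_eq; rewrite add0r.
have dcomp := is_diff_comp dline (differentiableP dG).
apply: DeriveDef; first by apply: diff_derivable; apply: ex_diff.
by rewrite deriveE; [rewrite diff_val /= scale1r|apply: ex_diff].
Qed.

Lemma is_diff_dot (Y : normedModType R) (V : euclideanType R) (G : Y -> V) y w :
  differentiable G y ->
  is_diff y (fun z => '[w, G z]) (fun v => '[w, 'd G y v]).
Proof.
move=> /differentiableP dG.
have dw : is_diff (G y) (dotp w) (dotp w).
  have wc : continuous (dotp w) := @linear_continuous R V R^o (dotp w).
  by apply: DiffDef; [exact: linear_differentiable|exact: diff_lin].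
exact: is_diff_comp dG dw.
Qed.

(** Reduction to the scalar case by pairing with the error vector [w] itself. *)
Lemma mean_value (Y : normedModType R) (V : euclideanType R) (G : Y -> V) y h l (b : R) :
  (forall t : R, 0 <= t <= 1 -> differentiable G (y + t *: h)) ->
  (forall t : R, 0 <= t <= 1 -> `|'d G (y + t *: h) h - l| <= b) ->
  `|G (y + h) - G y - l| <= b.
Proof.
move=> dG bP.
have b0 : 0 <= b by apply: le_trans (bP 0 _); rewrite ?normr_ge0 // lexx ler01.
set w := G (y + h) - G y - l; apply: dot_norm_le => //.
pose phi t := '[w, G (y + t *: h)].
have dphi (t : R) : 0 <= t <= 1 -> is_derive t 1 phi '[w, 'd G (y + t *: h) h].
  move=> /dG /(is_diff_dot w) dw.
  have := @is_derive_line Y R^o (fun z => '[w, G z]) y h t; rewrite diff_val; apply.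
  exact: ex_diff.
have := @taylor_le phi _ ('[w, l] + `|w| * b) 0 dphi.
rewrite mul0r addr0 /phi scale1r scale0r addr0 => /(_ _) h1.
rewrite {2}/w !dotBr mulrC lerBlDl; apply: h1 => t /bP h2.
rewrite mul0r addr0 -lerBlDl -dotBr (le_trans (cauchy_schwarz _ _)) //.
by rewrite ler_wpM2l.
Qed.

Lemma gradE (X : euclideanType R) (f : X -> R) x v : 'd f x v = '[grad f x, v].
Proof.
rewrite /grad; case: xgetP => [g _ -> //|h].
by have [g /h] := riesz ('d f x).
Qed.

Lemma grad_eq (X : euclideanType R) (f : X -> R) x g :
  (forall v, 'd f x v = '[g, v]) -> grad f x = g.
Proof. by move=> h; apply: dot_inj => v; rewrite -gradE h. Qed.

Lemma near_pair (Y Y' : normedModType R) (Q : Y * Y' -> Prop) x x' :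
  nbhs (x, x') Q ->
  exists2 d : R, 0 < d & forall y y', `|y - x| < d -> `|y' - x'| < d -> Q (y, y').
Proof.
move=> /nbhs_ballP [d /= d0 h]; exists d => // y y' yx yx'; apply: h.
by split; rewrite /= -ball_normE /= -normrN opprB.
Qed.

Lemma near_norm (Y : normedModType R) (x : Y) (d : R) : 0 < d ->
  \forall y \near x, `|y - x| < d.
Proof.
move=> d0; near=> y; rewrite -normrN opprB; near: y.
exact: (@cvgr_dist_lt _ _ _ (nbhs x) _ id).
Unshelve. all: by end_near.
Qed.

(** One constant bounds the gradient and the remainder, and its inverse is the radius of validity.
    The property thus weakens as [c] grows, as [compact_uniform] requires. *)
Lemma C11_fun_local (X : euclideanType R) (f : X -> R) (x0 : X) : C11_fun f ->
  exists c, \forall x \near x0,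
    [/\ 0 < c, `|grad f x| <= c &
        forall y, c * `|y - x| <= 1 ->
          f y <= f x + '[grad f x, y - x] + c * `|y - x| ^+ 2].
Proof.
move=> [df /(_ (x0, x0))] /= /(_ (conj I I)) lip.
have {lip} [M [M0]] : exists M, 0 <= M /\
    within (setT `*` setT) (nbhs (x0, x0))
      [set z | `|grad f z.1 - grad f z.2| <= M * `|z.1 - z.2|].
  have := @filter_ex _ (pinfty_nbhs R) _ _ (filterI (nbhs_pinfty_ge (num_real 0)) lip).
  by move=> [M [M0 h]]; exists M; split.
rewrite /within => /near_pair /= [d d0 dP].
have {}dP y y' : `|y - x0| < d -> `|y' - x0| < d ->
  `|grad f y - grad f y'| <= M * `|y - y'| by move=> h h'; apply: dP.
(* The summand [2 / d] turns [c * |y - x| <= 1] into [|y - x| <= d / 2], which keeps the segment in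
   the ball where the gradient is Lipschitz. *)
pose c := M + 2 / d + (`|grad f x0| + M * d + 1).
have ? := normr_ge0 (grad f x0).
have ? : 0 < 2 / d by rewrite divr_gt0.
have ? : 0 <= M * d by rewrite mulr_ge0 // ltW.
have cd : 2 <= c * d by rewrite -ler_pdivrMr // /c; lra.
exists c; near=> x.
have xd : `|x - x0| < d / 2 by near: x; apply: near_norm; lra.
have xd' : `|x - x0| < d by lra.
split; first by rewrite /c; lra.
  rewrite -(subrK (grad f x0) (grad f x)) (le_trans (ler_normD _ _)) //.
  have := dP x x0 xd'; rewrite subrr normr0 => /(_ d0) h.
  have : M * `|x - x0| <= M * d by rewrite ler_wpM2l // ltW.
  rewrite /c; lra.
move=> y yx.
have yxd : `|y - x| <= d / 2.
  rewrite -(ler_pM2l (_ : 0 < c)); last by rewrite /c; lra.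
  by rewrite (le_trans yx) //; lra.
have seg (t : R) : 0 <= t <= 1 -> `|x + t *: (y - x) - x0| < d.
  move=> /andP[t0 t1]; rewrite addrAC (le_lt_trans (ler_normD _ _)) //.
  rewrite normrZ ger0_norm //.
  have : t * `|y - x| <= 1 * `|y - x| by rewrite ler_wpM2r.
  by rewrite mul1r; lra.
have := @taylor_le (fun t => f (x + t *: (y - x))) _
   ('[grad f x, y - x] + c * `|y - x| ^+ 2) 0
   (fun t _ => @is_derive_line X R^o f x (y - x) t (df _)).
rewrite scale1r scale0r addr0 [x + (y - x)]addrC subrK mul0r addr0 => h.
have {h} : f y - f x <= '[grad f x, y - x] + c * `|y - x| ^+ 2.
  apply: h => t t01; rewrite mul0r addr0 gradE -lerBlDl -dotBl.
  rewrite (le_trans (cauchy_schwarz _ _)) //.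
  have e : x + t *: (y - x) - x = t *: (y - x) by rewrite addrAC subrr add0r.
  have := dP _ _ (seg t t01) xd'; rewrite e normrZ.
  have /andP[t0 t1] := t01; rewrite (ger0_norm t0) => h.
  rewrite expr2 mulrA ler_wpM2r // (le_trans h) // mulrA ler_wpM2r //.
  have : M * t <= M * 1 by rewrite ler_wpM2l.
  rewrite /c; lra.
lra.
Unshelve. all: by end_near.
Qed.

Lemma C11_map_local (X Z : euclideanType R) (F : X -> Z) (x0 : X) : C11_map F ->
  exists c, \forall x \near x0,
    [/\ 0 < c, `|F x| <= c, forall v, `|'d F x v| <= c * `|v| &
        forall y, c * `|y - x| <= 1 ->
          `|F y - F x - 'd F x (y - x)| <= c * `|y - x| ^+ 2].
Proof.
move=> [dF /(_ x0) [L]].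
move=> /near_pair /= [d d0 dP].
pose M := `|L|.
have M0 : 0 <= M by exact: normr_ge0.
have {}dP y y' v : `|y - x0| < d -> `|y' - x0| < d ->
    `|'d F y v - 'd F y' v| <= M * `|y - y'| * `|v|.
  move=> h h'; have := opnorm_le ('d F y \- 'd F y') v => /= /le_trans; apply.
  rewrite ler_wpM2r //; have := dP _ _ h h' => /le_trans; apply.
  by rewrite ler_wpM2r // ler_norm.
pose c := M + 2 / d + (opnorm ('d F x0) + M * d + 1 + `|F x0|).
have ? := normr_ge0 (F x0).
have ? := opnorm_ge0 ('d F x0).
have ? : 0 < 2 / d by rewrite divr_gt0.
have ? : 0 <= M * d by rewrite mulr_ge0 // ltW.
have cd : 2 <= c * d by rewrite -ler_pdivrMr // /c; lra.
exists c; near=> x.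
have xd : `|x - x0| < d / 2 by near: x; apply: near_norm; lra.
have xd' : `|x - x0| < d by lra.
split; first by rewrite /c; lra.
- have : `|F x - F x0| < 1.
    rewrite -normrN opprB; near: x.
    by have /differentiable_continuous /cvgr_dist_lt := dF x0; apply.
  have := ler_normD (F x - F x0) (F x0); rewrite subrK /c; lra.
- move=> v; have := dP x x0 v xd'; rewrite subrr normr0 => /(_ d0) h.
  have := ler_normD ('d F x v - 'd F x0 v) ('d F x0 v); rewrite subrK => /le_trans; apply.
  have := opnorm_le ('d F x0) v.
  have : M * `|x - x0| * `|v| <= M * d * `|v|.
    by rewrite ler_wpM2r // ler_wpM2l // ltW.
  have : (opnorm ('d F x0) + M * d) * `|v| <= c * `|v|.
    by rewrite ler_wpM2r // /c; lra.
  lra.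
move=> y yx.
have yxd : `|y - x| <= d / 2.
  rewrite -(ler_pM2l (_ : 0 < c)); last by rewrite /c; lra.
  by rewrite (le_trans yx) //; lra.
have seg (t : R) : 0 <= t <= 1 -> `|x + t *: (y - x) - x0| < d.
  move=> /andP[t0 t1]; rewrite addrAC (le_lt_trans (ler_normD _ _)) //.
  rewrite normrZ ger0_norm //.
  have : t * `|y - x| <= 1 * `|y - x| by rewrite ler_wpM2r.
  by rewrite mul1r; lra.
have := @mean_value X Z F x (y - x) ('d F x (y - x)) (c * `|y - x| ^+ 2).
rewrite [x + (y - x)]addrC subrK; apply => [t _|t t01]; first exact: dF.
rewrite (le_trans (dP _ _ _ (seg t t01) xd')) // addrAC subrr add0r normrZ.
have /andP[t0 t1] := t01; rewrite (ger0_norm t0) expr2 !mulrA ler_wpM2r // ler_wpM2r //.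
have : M * t <= M * 1 by rewrite ler_wpM2l.
rewrite /c; lra.
Unshelve. all: by end_near.
Qed.

End Calculus.

(** * Second-order accuracy of a retraction, uniformly near a base point *)

Section Retraction.
Context {R : realType} {X : euclideanType R}.

Lemma pair_line (x v : X) (t : R) : (x, 0) + t *: (0, v) = (x, t *: v) :> X * X.
Proof. by congr pair; rewrite /= ?scaler0 ?addr0 ?add0r. Qed.

Lemma ler_norm_near (V : normedModType R) (a b : V) (c : R) :
  `|a - b| <= c -> `|b| <= `|a| + c.
Proof.
by move=> abc; rewrite -(subKr a b) (le_trans (ler_normB _ _)) // lerD2l.
Qed.

(** Continuity of a derivative is given direction by direction; this passes from the finitely many
    directions [(0, e)] to all [(0, v)]. *)
Lemma fst_pair_linear_bound (L : {linear (X * X)%type -> X}) (b : seq X) (k : X -> R) v :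
  v = \sum_(e <- b) '[v, e] *: e ->
  (forall e, e \in b -> `|L (0, e)| <= k e) -> (forall e, 0 <= k e) ->
  `|L (0, v)| <= (\sum_(e <- b) `|e| * k e) * `|v|.
Proof.
move=> vE kP k0.
have -> : (0, v) = \sum_(e <- b) '[v, e] *: (0, e) :> X * X.
  have -> : \sum_(e <- b) '[v, e] *: (0, e) = (0, \sum_(e <- b) '[v, e] *: e) :> X * X.
    elim/big_rec2 : _ => // e y1 y2 _ ->.
    by congr pair; rewrite /= scaler0 addr0.
  by rewrite -vE.
rewrite linear_sum mulr_suml (le_trans (ler_norm_sum _ _ _)) // !big_seq.
apply: ler_sum => e eb; rewrite linearZ normrZ mulrAC.
apply: ler_pM => //; last exact: kP.
by rewrite mulrC; exact: cauchy_schwarz_abs.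
Qed.

(** Near the base point the derivatives along the [(0, e)] exceed their values there by at most 1;
    the mean value inequality with [l = 0] concludes. *)
Lemma C1_fiber_lipschitz (W : set (X * X)) (H : X * X -> X) (x0 : X) :
  open W -> W (x0, 0) -> C1_on W H ->
  exists c d : R, [/\ 0 <= c, 0 < d &
    forall x v, `|x - x0| < d -> `|v| < d ->
      W (x, v) /\ `|H (x, v) - H (x, 0)| <= c * `|v|].
Proof.
move=> Wo W0 H1; have [b bP] := parseval_frame (X := X).
pose k (e : X) := `|'d H (x0, 0) (0, e)| + 1.
have k0 e : 0 <= k e by rewrite addr_ge0.
have kP (s : seq X) : \forall z \near (x0, 0 : X), W z /\
    (forall e, e \in s -> `|'d H z (0, e)| <= k e).
  elim: s => [|e s IH].
    by apply: filterS (open_nbhs_nbhs (conj Wo W0)) => z Wz; split.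
  have /(_ (0, e)) /cvgr_dist_lt /(_ _ ltr01) He := (H1 _ W0).2.
  near=> z; have [Wz zs] : W z /\ (forall e, e \in s -> `|'d H z (0, e)| <= k e).
    by near: z.
  split => // u; rewrite inE => /orP[/eqP ->|/zs //].
  have : `|'d H (x0, 0) (0, e) - 'd H z (0, e)| < 1 by near: z.
  by move=> h; exact: (ler_norm_near (ltW h)).
have [d d0 dP] := near_pair (kP b).
exists (\sum_(e <- b) `|e| * k e), d; split => // [|x v xd vd].
  by rewrite sumr_ge0 // => e _; rewrite mulr_ge0.
have vd' : `|v - 0| < d by rewrite subr0.
have [Wxv _] := dP _ _ xd vd'; split => //.
have seg (t : R) : 0 <= t <= 1 -> `|t *: v - 0| < d.
  move=> /andP[t0 t1]; rewrite subr0 normrZ ger0_norm // (le_lt_trans _ vd) //.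
  by rewrite ler_piMl.
have := @mean_value R _ X H (x, 0) (0, v) 0 ((\sum_(e <- b) `|e| * k e) * `|v|).
rewrite -[X in (x, 0) + X]scale1r pair_line scale1r subr0; apply => t /seg td.
  by rewrite pair_line; apply: (H1 _ (dP _ _ xd td).1).1.
rewrite subr0 pair_line; apply: fst_pair_linear_bound => // e eb.
exact: (dP _ _ xd td).2.
Unshelve. all: by end_near.
Qed.

(** [C1_fiber_lipschitz] is applied to each partial derivative along [(0, e)], then the mean value
    inequality with [l] the derivative at [(x, 0)]. *)
Lemma C2_fiber_taylor (W : set (X * X)) (G : X * X -> X) (x0 : X) :
  open W -> W (x0, 0) -> C2_on W G ->
  exists c d : R, [/\ 0 <= c, 0 < d &
    forall x v, `|x - x0| < d -> `|v| < d ->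
      W (x, v) /\ `|G (x, v) - G (x, 0) - 'd G (x, 0) (0, v)| <= c * `|v| ^+ 2].
Proof.
move=> Wo W0 [G1 G2]; have [b bP] := parseval_frame (X := X).
have loc (s : seq X) : exists c d : R, [/\ 0 <= c, 0 < d &
    forall e, e \in s -> forall x v, `|x - x0| < d -> `|v| < d ->
      `|'d G (x, v) (0, e) - 'd G (x, 0) (0, e)| <= c * `|v|].
  elim: s => [|e s [c [d [c0 d0 cd]]]]; first by exists 0, 1; split.
  have [c' [d' [c0' d0' cd']]] := C1_fiber_lipschitz Wo W0 (G2 (0, e)).
  exists (Num.max c c'), (Num.min d d'); split.
  - by rewrite le_max c0.
  - by rewrite lt_min d0.
  move=> u us x v; rewrite !lt_min => /andP[x1 x2] /andP[v1 v2].
  move: us; rewrite inE => /orP[/eqP ->|us].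
    by rewrite (le_trans (cd' _ _ x2 v2).2) // ler_wpM2r // le_max lexx orbT.
  by rewrite (le_trans (cd _ us _ _ x1 v1)) // ler_wpM2r // le_max lexx.
have [c1 [d1 [_ d10 W1]]] := C1_fiber_lipschitz Wo W0 G1.
have [c [d [c0 d0 cdP]]] := loc b.
exists (\sum_(e <- b) `|e| * c), (Num.min d d1); split.
- by rewrite sumr_ge0 // => e _; rewrite mulr_ge0.
- by rewrite lt_min d0.
move=> x v; rewrite !lt_min => /andP[x1 x2] /andP[v1 v2].
split; first exact: (W1 _ _ x2 v2).1.
have seg (d2 t : R) : 0 <= t <= 1 -> `|v| < d2 -> `|t *: v| < d2.
  move=> /andP[t0 t1] vd; rewrite normrZ ger0_norm // (le_lt_trans _ vd) //.
  by rewrite ler_piMl.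
have := @mean_value R _ X G (x, 0) (0, v) ('d G (x, 0) (0, v))
  ((\sum_(e <- b) `|e| * c) * `|v| ^+ 2).
rewrite -[X in (x, 0) + X]scale1r pair_line scale1r; apply => t t01.
  by rewrite pair_line; apply: (G1 _ (W1 _ _ x2 (seg _ _ t01 v2)).1).1.
rewrite pair_line expr2 mulrA.
have := @fst_pair_linear_bound ('d G (x, t *: v) \- 'd G (x, 0)) b (fun=> c * `|v|) v (bP v).
move=> /= h; apply: le_trans (h _ _) _ => [e eb|e|].
- rewrite (le_trans (cdP e eb x _ x1 (seg _ _ t01 v1))) // ler_wpM2l // normrZ.
  by have /andP[t0 t1] := t01; rewrite (ger0_norm t0) ler_piMl.
- by rewrite mulr_ge0.
rewrite ler_wpM2r // mulr_suml le_eqVlt; apply/orP; left; apply/eqP.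
by apply: eq_bigr => e _; rewrite mulrA.
Qed.

Definition subspace (T : set X) :=
  [/\ closed T, T 0, forall x y, T x -> T y -> T (x + y) & forall (a : R) x, T x -> T (a *: x)].

Lemma submanifold_tangent (M : set X) (T : X -> set X) x :
  C2_submanifold M T -> M x -> subspace (T x).
Proof.
move=> [m mP] Mx; have [U [h [_ Ux _ MU]]] := mP x Mx.
move=> /(_ x (conj Mx Ux)) [_ ->].
split => /=.
- have -> : [set v | 'd h x v = 0] = [set v | `|'d h x v| <= 0].
    by apply/seteqP; split => v /=; [move=> ->; rewrite normr0|rewrite normr_le0 => /eqP].
  apply: closed_sublevel => v; apply: (@continuous_comp _ _ _ ('d h x)).
    exact: linear_continuous.
  exact: norm_continuous.
- by rewrite linear0.
- by move=> u v u0 v0; rewrite linearD u0 v0 addr0.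
- by move=> a u u0; rewrite linearZ /= u0 scaler0.
Qed.

(** The local extension [G] has a uniform quadratic remainder around its own linear part; the
    first-order condition on the retraction identifies this linear part with the identity on tangent
    vectors. *)
Lemma retraction_local (M : set X) (T : X -> set X) (Rt : X -> X -> X) (x0 : X) :
  (forall x, M x -> subspace (T x)) -> retraction M T Rt -> M x0 ->
  exists c, \forall x \near x0, 0 < c /\
    (M x -> forall v, T x v -> c * `|v| <= 1 -> `|Rt x v - x - v| <= c * `|v| ^+ 2).
Proof.
move=> Tsub [RM Rsm R0 Rd] Mx0.
have [W [G [Wo W0 G2 GP]]] := Rsm x0 0 Mx0 (let: And4 _ h _ _ := Tsub x0 Mx0 in h).
have [c [d [c0 d0 cdP]]] := C2_fiber_taylor Wo W0 G2.
have dinv : 0 < d^-1 by rewrite invr_gt0.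
exists (c + 2 / d); near=> x; split=> [|Mx v Tv cv]; first by lra.
have xd : `|x - x0| < d by near: x; exact: near_norm.
have [_ T0 TD TZ] := Tsub x Mx.
have small u : T x u -> `|u| < d -> `|Rt x u - x - 'd G (x, 0) (0, u)| <= c * `|u| ^+ 2.
  move=> Tu ud; have [Wu h] := cdP _ _ xd ud.
  have n0 : `|0 : X| < d by rewrite normr0.
  have Gx0 : G (x, 0) = x by rewrite -GP ?R0 //; exact: (cdP _ _ xd n0).1.
  by rewrite (GP x u) // -[X in _ - X - _]Gx0.
have vd : `|v| < d.
  rewrite -(ltr_pM2l dinv) mulVf ?gt_eqF //.
  have [->|v0] := eqVneq `|v| 0; first by rewrite mulr0.
  have : 0 < `|v| by rewrite lt_neqAle eq_sym v0 normr_ge0.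
  nra.
have vE : 'd G (x, 0) (0, v) = v.
  apply/eqP; rewrite -subr_eq0 -normr_le0; apply/ler_addgt0Pr => e e0.
  pose e' := e / (1 + `|v|).
  have e'0 : 0 < e' by rewrite divr_gt0 // ltr_pwDl.
  have /near_pair : nbhs (0 : X, 0 : X) (fun z => T x z.1 -> `|Rt x z.1 - Rt x 0 - z.1| <= e' * `|z.1|).
    exists (fun u => T x u -> `|Rt x u - Rt x 0 - u| <= e' * `|u|, setT).
      by split; [exact: Rd|exact: filterT].
    by move=> [u w] [].
  move=> [r r0 rP].
  (* The two expansions are compared at [t *: v]: the three bounds on [t] keep it in the domain of
     [small], within [r] of 0, and make the quadratic error at most [t * e']. *)
  pose t := Num.min 1 (Num.min (r / (2 * (1 + `|v|))) (e' / (1 + c * `|v| ^+ 2))).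
  have nv := normr_ge0 v.
  have cv2 : 0 <= c * `|v| ^+ 2 by rewrite mulr_ge0 // sqr_ge0.
  have t0 : 0 < t by rewrite !lt_min ltr01 !divr_gt0 //; lra.
  have t1 : t <= 1 by rewrite ge_min lexx.
  have tr : t * (2 * (1 + `|v|)) <= r.
    by rewrite -ler_pdivlMr ?ge_min ?lexx ?orbT //; lra.
  have te : t * (1 + c * `|v| ^+ 2) <= e'.
    by rewrite -ler_pdivlMr ?ge_min ?lexx ?orbT //; lra.
  have ntv : `|t *: v| = t * `|v| by rewrite normrZ gtr0_norm.
  have tv : `|t *: v| < d by rewrite ntv (le_lt_trans _ vd) // ler_piMl.
  have tvr : `|t *: v - 0| < r by rewrite subr0 ntv; nra.
  have n0r : `|0 - 0 : X| < r by rewrite subrr normr0.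
  have := rP _ _ tvr n0r (TZ t v Tv); rewrite /= R0 // ntv => h1.
  have := small _ (TZ t v Tv) tv; rewrite ntv.
  have -> : (0, t *: v) = t *: (0, v) :> X * X by congr pair; rewrite /= scaler0.
  rewrite linearZ => h2.
  have h3 : t * `|'d G (x, 0) (0, v) - v| <= e' * (t * `|v|) + c * (t * `|v|) ^+ 2.
    rewrite -{1}(gtr0_norm t0) -normrZ scalerBr.
    have -> : t *: 'd G (x, 0) (0, v) - t *: v = (Rt x (t *: v) - x - t *: v)
         - (Rt x (t *: v) - x - t *: 'd G (x, 0) (0, v)).
      by rewrite opprB [RHS]addrC addrA subrK.
    by rewrite (le_trans (ler_normB _ _)) // lerD.
  rewrite add0r -(ler_pM2l t0) (le_trans h3) //.
  have -> : e = e' * (1 + `|v|) by rewrite /e' divfK // gt_eqF // ltr_pwDl.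
  nra.
have := small v Tv vd; rewrite vE => /le_trans; apply.
by rewrite ler_wpM2r ?sqr_ge0 // lerDl; lra.
Unshelve. all: by end_near.
Qed.

End Retraction.

(** * Attained minima and orthogonal projection onto a subspace *)

Section Argmin.
Context {R : realType}.

Lemma argminP (V : normedModType R) (D : set V) (h : V -> R) :
  (exists2 p, D p & forall y, D y -> h p <= h y) ->
  D (argmin D h) /\ forall y, D y -> h (argmin D h) <= h y.
Proof.
move=> [p Dp pmin]; rewrite /argmin.
by case: xgetP => [q _ //|/(_ p)]; case; split.
Qed.

Lemma argmin_value (V : normedModType R) (D : set V) (h : V -> R) p :
  D p -> (forall y, D y -> h p <= h y) -> h (argmin D h) = h p.
Proof.
move=> Dp pmin; have [Dq qmin] : D (argmin D h) /\ forall y, D y -> h (argmin D h) <= h y.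
  by apply: argminP; exists p.
by apply/eqP; rewrite eq_le qmin //= pmin.
Qed.

Context {X : euclideanType R}.

Lemma projP (T : set X) y : subspace T ->
  T (proj T y) /\ forall u, T u -> '[proj T y, u] = '[y, u].
Proof.
move=> [Tc T0 TD TZ].
have [] : T (proj T y) /\ forall u, T u -> `|y - proj T y| <= `|y - u|.
  apply: argminP; apply: (@coercive_min _ _ _ _ 0 (2 * `|y|)) => //.
    move=> u; apply: (@continuous_comp _ _ _ (fun u => y - u) (fun u => `|u|)).
      by apply: cvgB; [exact: cvg_cst|exact: cvg_id].
    exact: norm_continuous.
  move=> u _; rewrite subr0 => h; rewrite -[u](subKr y) (le_trans (ler_normB _ _)) //.
  by lra.
move: (proj T y) => p Tp pmin; split => // u Tu.
apply/eqP; rewrite -subr_eq0 -oppr_eq0 opprB -dotBl -sqrf_eq0.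
set s := '[y - p, u].
have [u0|u0] := eqVneq u 0; first by rewrite /s u0 dot0r expr0n.
have nu : 0 < `|u| ^+ 2 by rewrite exprn_gt0 // normr_gt0.
(* The optimal step along [u] would reduce the squared distance by [s ^+ 2 / |u| ^+ 2], so [s]
   vanishes. *)
have := pmin (p + (s / `|u| ^+ 2) *: u) (TD _ _ Tp (TZ _ _ Tu)).
rewrite -[leLHS]ger0_norm // -[leRHS]ger0_norm // -ler_sqr ?nnegrE //.
rewrite !normr_id opprD addrA [leRHS]normB2 normZ2 dotZr -/s => h.
rewrite eq_le sqr_ge0 andbT.
have e1 : s / `|u| ^+ 2 * s = s ^+ 2 / `|u| ^+ 2 by field; rewrite normr_eq0.
have e2 : (s / `|u| ^+ 2) ^+ 2 * `|u| ^+ 2 = s ^+ 2 / `|u| ^+ 2.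
  by field; rewrite normr_eq0.
rewrite e1 e2 in h.
have : s ^+ 2 / `|u| ^+ 2 <= 0 by lra.
by rewrite ler_pdivrMr // mul0r.
Qed.



End Argmin.

(** The limit as [t] tends to 0; if [d < q], the choice [t = (q - d) / (2 * q)] gives
    [(q + d) / 2 <= d]. It extracts quadratic growth from minimality. *)
Lemma le_of_shrink (R : realFieldType) (q d : R) :
  (forall t, 0 < t -> t <= 1 -> (1 - t) * q <= d) -> q <= d.
Proof.
move=> h; have d0 : 0 <= d by have := h 1 ltr01 (lexx _); rewrite subrr mul0r.
rewrite leNgt; apply/negP => dq.
have q0 : 0 < q by lra.
have e : (q - d) / (2 * q) * q = (q - d) / 2 by field; rewrite gt_eqF.
have t0 : 0 < (q - d) / (2 * q) by rewrite divr_gt0 //; lra.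
have t1 : (q - d) / (2 * q) <= 1 by rewrite ler_pdivrMr; lra.
by have := h _ t0 t1; rewrite mulrBl e; lra.
Qed.

Lemma quad_is_diff (R : realType) (Y : euclideanType R) (f : Y -> R) y g (C : R) :
  (forall v, `|f (y + v) - f y - '[g, v]| <= C * `|v| ^+ 2) ->
  differentiable f y /\ grad f y = g.
Proof.
move=> fP.
have dc : continuous (dotp g) := @linear_continuous R Y R^o (dotp g).
have expand : f \o shift y = cst (f y) + dotp g +o_ (nbhs (0 : Y)) id.
  apply/eqaddoP => e e0; near=> v.
  rewrite /= !fctE /= opprD addrA addrC [v + y]addrC.
  rewrite addrC (le_trans (fP v)) // expr2 mulrA ler_wpM2r //.
  have C0 : 0 <= `|C| by [].
  have : `|v - 0| < e / (`|C| + 1).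
    by near: v; apply: near_norm; rewrite divr_gt0 //; lra.
  rewrite subr0 ltr_pdivlMr; last lra.
  have : C * `|v| <= `|C| * `|v| by rewrite ler_wpM2r // ler_norm.
  have := normr_ge0 v; lra.
have dE : 'd f y = dotp g :> (Y -> R) by exact: (@diff_unique R Y R^o).
split; last by apply: grad_eq => v; rewrite dE.
by apply/diff_locallyP; rewrite dE.
Unshelve. all: by end_near.
Qed.

(** * Lagrangian duality for one subproblem, with the linearized data as parameters *)

Section Duality.
Context {R : realType} {X Z : euclideanType R}.
Variables (c : X) (A : {linear X -> Z}) (F0 : Z) (T : set X) (th : Z -> R).
Variables (f0 a b : R).
Hypothesis T_subspace : subspace T.
Hypothesis th_convex : forall (t : R) x y, 0 <= t -> t <= 1 ->
  th (t *: x + (1 - t) *: y) <= t * th x + (1 - t) * th y.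
Hypotheses (a_gt0 : 0 < a) (b_gt0 : 0 < b).
Implicit Types (u v : X) (z zeta : Z).

Definition lagr u z zeta : R :=
  '[c, u] + a / 2 * `|u| ^+ 2 + b / 2 * `|z - F0| ^+ 2 + th z
    + '[zeta, F0 + A u - z] + f0.

Definition dualf zeta : R :=
  inf [set r | exists u z, T u /\ r = lagr u z zeta].

Definition v_of zeta : X := - (a^-1 *: proj T (adjoint A zeta + c)).

(** Completing the square, this is the proximal point of [th] with parameter [b^-1] at
    [F0 + b^-1 *: zeta]. *)
Definition z_of zeta : Z :=
  argmin setT (fun z => b / 2 * `|z - F0| ^+ 2 + th z - '[zeta, z - F0]).

Definition residual zeta : Z := F0 + A (v_of zeta) - z_of zeta.

Definition primalf u : R :=
  '[c, u] + a / 2 * `|u| ^+ 2 + b / 2 * `|A u| ^+ 2 + th (F0 + A u) + f0.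

Lemma v_of_in zeta : T (v_of zeta).
Proof.
have [_ _ _ TZ] := T_subspace; rewrite /v_of -scaleN1r; do 2 apply: (TZ).
exact: (projP _ T_subspace).1.
Qed.

Lemma v_of_dot zeta u : T u -> '[adjoint A zeta + c, u] = - a * '[v_of zeta, u].
Proof.
move=> Tu; rewrite -(projP _ T_subspace).2 // /v_of dotNl dotZl; field.
exact: lt0r_neq0.
Qed.

(** The minimum is attained because [convex_slope] allows [th] to decrease at most linearly away
    from [F0], which the quadratic term dominates. *)
Lemma z_of_min zeta z :
  b / 2 * `|z_of zeta - F0| ^+ 2 + th (z_of zeta) - '[zeta, z_of zeta - F0]
    <= b / 2 * `|z - F0| ^+ 2 + th z - '[zeta, z - F0].
Proof.
case: (@argminP _ _ setT
  (fun z => b / 2 * `|z - F0| ^+ 2 + th z - '[zeta, z - F0])); last by move=> _; exact.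
have [L L0 LP] := convex_ball_lipschitz th_convex (`|F0| + 1).
apply: (@coercive_min _ _ _ _ F0 (`|F0| + 2 / b * (L + `|zeta|))) => //.
- have dc : continuous (dotp zeta) := @linear_continuous R Z R^o (dotp zeta).
  have sc : continuous (fun z => z - F0).
    by move=> w; apply: cvgB; [exact: cvg_id|exact: cvg_cst].
  have nc : continuous (fun z => `|z - F0|).
    by move=> w; apply: (@continuous_comp _ _ _ (fun z => z - F0) (fun z => `|z|)); [exact: sc|exact: norm_continuous].
  move=> w; apply: cvgB; last by apply: (@continuous_comp _ _ _ (fun z => z - F0) (dotp zeta)); [exact: sc|exact: dc].
  apply: cvgD; last exact: convex_continuous.
  by apply: cvgM; [exact: cvg_cst|rewrite expr2; apply: cvgM; exact: nc].
move=> w _; rewrite subrr normr0 dot0r expr0n /= mulr0 add0r subr0 => hw.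
have := convex_slope th_convex (z := F0) w LP L0 (lexx _).
have := cauchy_schwarz zeta (w - F0); move: hw; set n := `|w - F0| => hw h1 h2.
have nw : `|w| <= `|F0| + n by rewrite -[w](subrK F0) addrC (le_trans (ler_normD _ _)).
rewrite (le_trans nw) // lerD2l.
have [n0|n0] := leP n 0.
  by rewrite (le_trans n0) // mulr_ge0 ?addr_ge0 // divr_ge0 // ltW.
have h3 : n * (b / 2 * n) <= n * (L + `|zeta|) by lra.
move: h3; rewrite ler_pM2l // => h3.
by rewrite mulrAC ler_pdivlMr //; lra.
Qed.

(** Quadratic growth at the minimizer: it is compared with points of the segment towards [z], and
    the parameter tends to 0. *)
Lemma z_of_strong zeta z :
  b / 2 * `|z_of zeta - F0| ^+ 2 + th (z_of zeta) - '[zeta, z_of zeta - F0]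
    + b / 2 * `|z - z_of zeta| ^+ 2
  <= b / 2 * `|z - F0| ^+ 2 + th z - '[zeta, z - F0].
Proof.
have zmin := z_of_min zeta; move: (z_of zeta) zmin => w wmin.
rewrite -lerBrDl; apply: le_of_shrink => t t0 t1.
have := wmin (t *: z + (1 - t) *: w).
have := th_convex z w (ltW t0) t1.
have -> : t *: z + (1 - t) *: w - F0 = t *: (z - F0) + (1 - t) *: (w - F0).
  by rewrite !scalerBr addrACA -opprD -scalerDl [t + _]addrC subrK scale1r.
have -> : z - w = (z - F0) - (w - F0) by rewrite opprB addrA subrK.
move: (z - F0) (w - F0) => p q; rewrite normB2 normD2 !normZ2 !dotE.
by move=> h1 h2; rewrite -(ler_pM2l t0); lra.
Qed.

(** The growth term of [z_of_strong] cancels the square of [z - z_of zeta] exactly, leaving the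
    subgradient inequality. *)
Lemma z_of_subdiff zeta : subdiff th (z_of zeta) (zeta - b *: (z_of zeta - F0)).
Proof.
move=> z /=; have := z_of_strong zeta z; move: (z_of zeta) => w.
have -> : z - F0 = (z - w) + (w - F0) by rewrite addrA subrK.
move: (z - w) (w - F0) => p q; rewrite normD2 !dotE (dotC p q); lra.
Qed.

Lemma lagr_affine u z zeta zeta' :
  lagr u z zeta' = lagr u z zeta + '[zeta' - zeta, F0 + A u - z].
Proof. rewrite /lagr dotBl; ring. Qed.

Lemma lagr_strong u z zeta : T u ->
  lagr (v_of zeta) (z_of zeta) zeta + a / 2 * `|u - v_of zeta| ^+ 2
    + b / 2 * `|z - z_of zeta| ^+ 2 <= lagr u z zeta.
Proof.
move=> Tu; have := z_of_strong zeta z.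
have := v_of_dot zeta Tu; have := v_of_dot zeta (v_of_in zeta).
rewrite /lagr; move: (v_of zeta) (z_of zeta) => v w.
rewrite (normB2 u v) !dotE !adjointP dotp_norm (dotC v u) => h1 h2 h3.
lra.
Qed.

Lemma dual_value zeta : dualf zeta = lagr (v_of zeta) (z_of zeta) zeta.
Proof.
have lb : lbound [set r | exists u z, T u /\ r = lagr u z zeta]
                 (lagr (v_of zeta) (z_of zeta) zeta).
  move=> _ [u [z [Tu ->]]]; apply: le_trans (lagr_strong z zeta Tu).
  by rewrite -addrA lerDl addr_ge0 // mulr_ge0 ?sqr_ge0 // divr_ge0 // ltW.
have mem : [set r | exists u z, T u /\ r = lagr u z zeta]
               (lagr (v_of zeta) (z_of zeta) zeta).
  by exists (v_of zeta), (z_of zeta); split => //; exact: v_of_in.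
apply/eqP; rewrite eq_le; apply/andP; split.
  by apply: ge_inf => //; eexists; exact: lb.
by apply: lb_le_inf => //; eexists; exact: mem.
Qed.

(** The Lagrangian at [zeta] is tested at the minimizers for [zeta']. Keeping the squares yields the
    Lipschitz bound on the dual gradient. *)
Lemma dual_strong zeta zeta' :
  dualf zeta + a / 2 * `|v_of zeta' - v_of zeta| ^+ 2
    + b / 2 * `|z_of zeta' - z_of zeta| ^+ 2
  <= dualf zeta' + '[zeta - zeta', residual zeta'].
Proof. by rewrite !dual_value -lagr_affine; apply: lagr_strong; exact: v_of_in. Qed.

Lemma dual_supergrad zeta zeta' :
  dualf zeta <= dualf zeta' + '[zeta - zeta', residual zeta'].
Proof.
apply: le_trans (dual_strong zeta zeta').
by rewrite -addrA lerDl addr_ge0 // mulr_ge0 ?sqr_ge0 // divr_ge0 // ltW.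
Qed.

Definition lip_bound : R := opnorm A ^+ 2 / a + b^-1.

Lemma lip_bound_ge0 : 0 <= lip_bound.
Proof. by rewrite addr_ge0 ?divr_ge0 ?invr_ge0 ?sqr_ge0 // ltW. Qed.

(** Adding [dual_strong] in both orders bounds the weighted squares of the primal differences by the
    residual difference times [|zeta - zeta'|]. *)
Lemma residual_lipschitz zeta zeta' :
  `|residual zeta - residual zeta'| <= lip_bound * `|zeta - zeta'|.
Proof.
have s1 := dual_strong zeta zeta'; have s2 := dual_strong zeta' zeta.
have e : '[zeta' - zeta, residual zeta] = - '[zeta - zeta', residual zeta].
  by rewrite -dotNl opprB.
have cs := cauchy_schwarz (zeta - zeta') (residual zeta' - residual zeta).
rewrite dotBr in cs.
have rA : residual zeta - residual zeta' =
    A (v_of zeta - v_of zeta') - (z_of zeta - z_of zeta').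
  rewrite /residual [A (_ - _)]linearB [- (F0 + _ - _)]opprD addrACA; congr (_ + _).
    by rewrite opprD addrACA subrr add0r.
  by rewrite opprD opprK.
have tri : `|residual zeta - residual zeta'| <=
    opnorm A * `|v_of zeta - v_of zeta'| + `|z_of zeta - z_of zeta'|.
  by rewrite rA (le_trans (ler_normB _ _)) // lerD2r opnorm_le.
have al0 := opnorm_ge0 A.
rewrite distrC in tri *; rewrite (distrC (v_of zeta')) (distrC (z_of zeta')) in s1.
set G := `|residual zeta' - _| in cs tri *.
set d := `|zeta - zeta'| in cs *.
set p := `|v_of zeta - _| in tri s1 s2; set q := `|z_of zeta - _| in tri s1 s2.
have p0 : 0 <= p := normr_ge0 _; have q0 : 0 <= q := normr_ge0 _.
have G0 : 0 <= G := normr_ge0 _.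
have h1 : a * p ^+ 2 + b * q ^+ 2 <= G * d by lra.
set al := opnorm A in tri al0 *.
(* Weighted Cauchy-Schwarz, with its defect written as an explicit square. *)
have h2 : (al * p + q) ^+ 2 <= lip_bound * (a * p ^+ 2 + b * q ^+ 2).
  have -> : lip_bound * (a * p ^+ 2 + b * q ^+ 2) =
      (al * p + q) ^+ 2 + (al * b * q - a * p) ^+ 2 / (a * b).
    by rewrite /lip_bound -/al; field; rewrite !gt_eqF.
  by rewrite lerDl divr_ge0 ?sqr_ge0 // mulr_ge0 // ltW.
have h3 : G ^+ 2 <= lip_bound * (G * d).
  apply: le_trans (ler_wpM2l lip_bound_ge0 h1); apply: le_trans h2.
  by rewrite ler_sqr ?nnegrE // addr_ge0 // mulr_ge0.
have [->|Gn] := eqVneq G 0; first by apply: mulr_ge0; [exact: lip_bound_ge0|exact: normr_ge0].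
have Gp : 0 < G by rewrite lt_neqAle eq_sym Gn.
by rewrite -(ler_pM2l Gp); lra.
Qed.

(** The supergradient inequalities at [zeta] and [zeta + v] squeeze the increment between two linear
    terms whose difference is quadratic in [v]. *)
Lemma dual_diff zeta : differentiable dualf zeta /\ grad dualf zeta = residual zeta.
Proof.
apply: (@quad_is_diff _ _ _ _ _ lip_bound) => v.
have s1 := dual_supergrad (zeta + v) zeta; have s2 := dual_supergrad zeta (zeta + v).
have l := residual_lipschitz (zeta + v) zeta.
have e : zeta + v - zeta = v by rewrite addrC addKr.
have e' : zeta - (zeta + v) = - v by rewrite -opprB e.
rewrite e in s1 l; rewrite e' dotNl in s2.
have cs := cauchy_schwarz v (residual zeta - residual (zeta + v)).
rewrite dotBr distrC in cs.
have h : `|v| * `|residual (zeta + v) - residual zeta| <= lip_bound * `|v| ^+ 2.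
  by rewrite expr2 mulrA mulrC ler_wpM2r.
rewrite (dotC _ v) ler_norml; apply/andP; split; first by lra.
by have := sqr_ge0 `|v|; have := mulr_ge0 lip_bound_ge0 (sqr_ge0 `|v|); lra.
Qed.

Lemma grad_dual : grad dualf = residual.
Proof. by apply/funext => zeta; exact: (dual_diff zeta).2. Qed.

Definition dual_lip : R := inf [set L | 0 <= L /\ L.-lipschitz (grad dualf)].

Lemma dual_lip_le : dual_lip <= lip_bound.
Proof.
apply: ge_inf; first by exists 0 => L [].
by split; [exact: lip_bound_ge0|move=> [x y] _ /=; rewrite grad_dual residual_lipschitz].
Qed.

Lemma dual_lip_ge0 : 0 <= dual_lip.
Proof.
apply: lb_le_inf; last by move=> L [].
exists lip_bound; split; first exact: lip_bound_ge0.
by move=> [x y] _ /=; rewrite grad_dual residual_lipschitz.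
Qed.

(** The infimum defining [dual_lip] is itself a Lipschitz constant: each difference quotient is a
    lower bound of the set. *)
Lemma residual_dual_lip zeta zeta' :
  `|residual zeta - residual zeta'| <= dual_lip * `|zeta - zeta'|.
Proof.
have [->|ne] := eqVneq zeta zeta'; first by rewrite !subrr normr0 mulr0.
have n0 : 0 < `|zeta - zeta'| by rewrite normr_gt0 subr_eq0.
rewrite -ler_pdivrMr //; apply: lb_le_inf.
  exists lip_bound; split; first exact: lip_bound_ge0.
  by move=> [x y] _ /=; rewrite grad_dual residual_lipschitz.
move=> L [L0] /(_ (zeta, zeta') (conj I I)) /=; rewrite grad_dual => h.
by rewrite ler_pdivrMr.
Qed.

Lemma dual_ascent zeta (v : Z) :
  dualf zeta + '[residual zeta, v] - dual_lip / 2 * `|v| ^+ 2 <= dualf (zeta + v).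
Proof.
have := @taylor_le R (fun t => - dualf (zeta + t *: v))
  (fun t => - '[residual (zeta + t *: v), v]) (- '[residual zeta, v]) (dual_lip * `|v| ^+ 2).
rewrite scale1r scale0r addr0 => h.
have {h} : - dualf (zeta + v) - - dualf zeta <=
    - '[residual zeta, v] + dual_lip * `|v| ^+ 2 / 2; last lra.
apply: h => [t _|t /andP[t0 t1]].
  have [d1 d2] := dual_diff (zeta + t *: v).
  have := @is_derive_line R Z R^o dualf zeta v t d1.
  by rewrite gradE d2 => ?; apply: is_deriveN.
have := residual_dual_lip zeta (zeta + t *: v).
have -> : zeta - (zeta + t *: v) = - (t *: v) by rewrite opprD addrA subrr add0r.
rewrite normrN normrZ (ger0_norm t0) => h.
have := cauchy_schwarz (residual zeta - residual (zeta + t *: v)) v; rewrite dotBl.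
have : `|residual zeta - residual (zeta + t *: v)| * `|v| <= dual_lip * `|v| ^+ 2 * t.
  by rewrite (le_trans (ler_wpM2r _ h)) // le_eqVlt; apply/orP; left; apply/eqP; ring.
lra.
Qed.

(* The bound on [dualf zeta] obtained from u = 0 and z = F0 + zeta / |zeta| makes
   the dual coercive. *)
Lemma dual_max : exists zs, forall zeta, dualf zeta <= dualf zs.
Proof.
have [B BP] := convex_ball_bound th_convex (`|F0| + 1).
have cont : continuous (fun zeta => - dualf zeta).
  move=> zeta; apply: (@cvgN R R^o); apply: (@differentiable_continuous _ Z R^o).
  exact: (dual_diff zeta).1.
have [|zs _ zsP] := @coercive_min R Z setT (fun zeta => - dualf zeta) 0
    (`|b / 2 + B + f0 - dualf 0|) closedT cont I; last first.
  by exists zs => zeta; rewrite -lerN2 zsP.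
move=> zeta _; rewrite lerN2 => h.
have [->|z0] := eqVneq zeta 0; first by rewrite normr0.
apply: le_trans (ler_norm _).
have nz : 0 < `|zeta| by rewrite normr_gt0.
pose w := `|zeta|^-1 *: zeta.
have nw : `|w| = 1 by rewrite normrZ normfV normr_id mulVf // gt_eqF.
have [_ T0 _ _] := T_subspace.
have l1 := lagr_strong (F0 + w) zeta T0.
rewrite -dual_value in l1.
have q1 : 0 <= a / 2 * `|0 - v_of zeta| ^+ 2.
  by rewrite mulr_ge0 ?sqr_ge0 // divr_ge0 // ltW.
have q2 : 0 <= b / 2 * `|F0 + w - z_of zeta| ^+ 2.
  by rewrite mulr_ge0 ?sqr_ge0 // divr_ge0 // ltW.
have l2 : lagr 0 (F0 + w) zeta = b / 2 + th (F0 + w) - `|zeta| + f0.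
  rewrite /lagr dot0r (linear0 A) normr0 expr0n addr0 opprD addrA subrr.
  rewrite [F0 + w]addrC addrK nw expr1n sub0r dotNr dotZr dotp_norm /=.
  by rewrite expr2 mulKf ?gt_eqF //; ring.
have := BP (F0 + w); rewrite (le_trans (ler_normD _ _)) ?nw // => /(_ isT).
rewrite ler_norml => /andP[_ bb].
rewrite l2 in l1; lra.
Qed.

Lemma dual_max_residual zs : (forall zeta, dualf zeta <= dualf zs) -> residual zs = 0.
Proof.
move=> zsP; apply/eqP; rewrite -normr_eq0 -sqrf_eq0 eq_le sqr_ge0 andbT.
(* A gradient step of length [t] would improve on the maximum unless [g = 0]. The shift by 1 keeps
   [t] meaningful when [dual_lip] is 0. *)
set g := residual zs; pose t := (dual_lip + 1)^-1.
have L0 := dual_lip_ge0; have L1 : 0 < dual_lip + 1 by lra.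
have t0 : 0 < t by rewrite invr_gt0.
have := dual_ascent zs (t *: g); have := zsP (zs + t *: g).
rewrite dotZr -/g dotp_norm normZ2 => h1 h2.
have tL : t * (dual_lip + 1) = 1 by rewrite mulVf // gt_eqF.
have h3 : t * (`|g| ^+ 2 * (1 - t * dual_lip / 2)) <= 0 by lra.
move: h3; rewrite pmulr_rle0 // => h3.
have : 0 <= t * dual_lip by rewrite mulr_ge0 // ltW.
have := sqr_ge0 `|g|; nra.
Qed.

Lemma primal_lagr u zeta : primalf u = lagr u (F0 + A u) zeta.
Proof. by rewrite /primalf /lagr subrr dot0r addr0 [F0 + A u]addrC addrK. Qed.

(** The retained square converts a duality gap into a distance from [u] to [v_of zeta]. *)
Lemma weak_duality u zeta : T u ->
  dualf zeta + a / 2 * `|u - v_of zeta| ^+ 2 <= primalf u.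
Proof.
move=> Tu; rewrite (primal_lagr u zeta) dual_value.
apply: le_trans (lagr_strong (F0 + A u) zeta Tu).
by rewrite lerDl mulr_ge0 ?sqr_ge0 // divr_ge0 // ltW.
Qed.

Lemma strong_duality zs : residual zs = 0 ->
  z_of zs = F0 + A (v_of zs) /\ primalf (v_of zs) = dualf zs.
Proof.
move=> /eqP; rewrite subr_eq0 => /eqP zE; split; first by rewrite zE.
by rewrite (primal_lagr _ zs) dual_value zE.
Qed.

End Duality.

(** * The accelerated gradient method for a smooth concave function *)

Section FastGradient.
Context {R : realType} {Z : euclideanType R}.
Variables (Psi : Z -> R) (g : Z -> Z) (L : R).
Hypothesis supergrad : forall zeta zeta', Psi zeta <= Psi zeta' + '[zeta - zeta', g zeta'].
Hypothesis ascent : forall zeta v : Z,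
  Psi zeta + '[g zeta, v] - L / 2 * `|v| ^+ 2 <= Psi (zeta + v).
Variables (ze y : nat -> Z) (t : nat -> R).
Hypothesis t0 : t 0 = 1.
(* Shifted indices: [y n] and [t n] are y^(n+1) and theta_(n+1). The step is not
   divided by [L], so as to cover [L = 0], where the gradient vanishes. *)
Hypothesis ze_step : forall n, L *: (ze n.+1 - y n) = g (y n).
Hypothesis y_step : forall n,
  y n.+1 = ze n.+1 + ((t n - 1) / t n.+1) *: (ze n.+1 - ze n).
Hypothesis t_step : forall n, t n.+1 = (1 + Num.sqrt (1 + 4 * t n ^+ 2)) / 2.

Lemma theta_sqr n : t n.+1 ^+ 2 - t n.+1 = t n ^+ 2.
Proof.
rewrite t_step; have : 0 <= 1 + 4 * t n ^+ 2 by rewrite addr_ge0 // mulr_ge0 ?sqr_ge0.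
move=> /sqr_sqrtr; move: (Num.sqrt _) => s h.
have : t n ^+ 2 = (s ^+ 2 - 1) / 4 by rewrite h; lra.
by move=> ->; field.
Qed.

Lemma theta_ge n : n.+2%:R / 2 <= t n.
Proof.
elim: n => [|n IH]; first by rewrite t0 divff.
have tn0 : 0 <= t n by apply: le_trans IH; rewrite divr_ge0.
have : t n + 2^-1 <= t n.+1.
  rewrite t_step; suff : 2 * t n <= Num.sqrt (1 + 4 * t n ^+ 2) by lra.
  have t2 : 0 <= 2 * t n by rewrite mulr_ge0.
  rewrite -[leLHS](ger0_norm t2) -sqrtr_sqr ler_wsqrtr //.
  by rewrite exprMn; lra.
by rewrite -[n.+3%:R]natr1; lra.
Qed.

Lemma theta_ge1 n : 1 <= t n.
Proof.
apply: le_trans (theta_ge n); rewrite ler_pdivlMr // mul1r.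
by rewrite ler_nat.
Qed.

Lemma theta_sum n : \sum_(0 <= i < n.+1) t i = t n ^+ 2.
Proof.
elim: n => [|n IH]; first by rewrite big_nat1 t0 expr1n.
by rewrite big_nat_recr //= IH -theta_sqr subrK.
Qed.

Let w n := t n *: y n - (t n - 1) *: ze n.

(** The extrapolation coefficient is exactly the one that makes the increment of [w] a multiple of
    the gradient step. *)
Lemma w_step n : w n.+1 = w n + t n *: (ze n.+1 - y n).
Proof.
have tn : t n.+1 != 0 by rewrite gt_eqF // (lt_le_trans ltr01) // theta_ge1.
have -> : w n.+1 = t n *: ze n.+1 - (t n - 1) *: ze n.
  rewrite /w y_step scalerDr scalerA mulrC divfK // addrAC.
  have -> : t n.+1 *: ze n.+1 - (t n.+1 - 1) *: ze n.+1 = ze n.+1.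
    by rewrite scalerBl scale1r opprB addrCA subrr addr0.
  rewrite scalerBr addrA; congr (_ - _).
  by rewrite scalerBl scale1r addrCA subrr addr0.
rewrite /w scalerBr; move: (t n *: y n) ((t n - 1) *: ze n) (t n *: ze n.+1) => p q r.
by rewrite addrAC addrCA subrr addr0.
Qed.

(* [w n] is the auxiliary sequence theta_l zeta^l - (theta_l - 1) zeta^(l-1) of
   FISTA, expressed through the extrapolated point. Keeping the linear models on
   the left, instead of bounding them by [Psi zeta], is what makes the estimate
   usable for the averaged primal iterate. *)
Lemma estimate_sequence n zeta :
  \sum_(0 <= i < n) t i * (Psi (y i) + '[zeta - y i, g (y i)])
     + L / 2 * `|w n - zeta| ^+ 2 - L / 2 * `|y 0 - zeta| ^+ 2
  <= (t n ^+ 2 - t n) * Psi (ze n).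
Proof.
elim: n => [|n IH].
  by rewrite big_nil /w t0 subrr scale0r subr0 scale1r expr1n subrr mul0r; lra.
rewrite theta_sqr big_nat_recr //=.
set S := \sum_(0 <= i < n) _ in IH *.
rewrite w_step.
have tn := theta_ge1 n.
pose d := ze n.+1 - y n.
have yd : y n + d = ze n.+1 by rewrite /d addrC subrK.
have asc := ascent (y n) d; rewrite yd -ze_step -/d in asc.
have sup := supergrad (ze n) (y n).
rewrite -ze_step -/d in sup *; rewrite dotZl dotp_norm in asc; rewrite dotZr in sup.
rewrite dotZr -/d.
have -> : w n + t n *: d - zeta = (w n - zeta) + t n *: d by rewrite addrAC.
rewrite (normD2 _ (t n *: d)) normZ2 dotZr.
have wE : w n - zeta = - ((t n - 1) *: (ze n - y n) + (zeta - y n)).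
  have ty : t n *: y n = (t n - 1) *: y n + y n by rewrite scalerBl scale1r subrK.
  by rewrite /w ty scalerBr opprD !opprB addrA; congr (_ - _); rewrite addrAC.
have wd : '[w n - zeta, d] = - ((t n - 1) * '[ze n - y n, d] + '[zeta - y n, d]).
  by rewrite wE dotNl (dotDl ((t n - 1) *: (ze n - y n))) dotZl.
rewrite wd.
have s2 : 0 <= t n ^+ 2 by rewrite sqr_ge0.
have tt : 0 <= t n ^+ 2 - t n by move: tn; move: (t n) => r r1; nra.
(* With weight [t n ^+ 2] on the ascent and [t n ^+ 2 - t n] on the supergradient inequality at the
   previous iterate, all inner products cancel. *)
have h1 := ler_wpM2l s2 asc; have h2 := ler_wpM2l tt sup.
move: IH h1 h2; move: (`|w n - zeta| ^+ 2) (`|d| ^+ 2) (`|y 0 - zeta| ^+ 2).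
move: '[ze n - y n, d] '[zeta - y n, d] (Psi (ze n.+1)) (Psi (ze n)) (Psi (y n)) => p q Pn' Pn Py.
move: (t n) => s W Dd Y0 IH h1 h2; lra.
Qed.

Lemma fast_gradient n zeta : 0 <= L ->
  \sum_(0 <= i < n.+1) t i * (Psi (y i) + '[zeta - y i, g (y i)])
    <= t n ^+ 2 * Psi (ze n.+1) + L / 2 * `|y 0 - zeta| ^+ 2.
Proof.
move=> L0; have := estimate_sequence n.+1 zeta; rewrite theta_sqr.
have : 0 <= L / 2 * `|w n.+1 - zeta| ^+ 2.
  by rewrite mulr_ge0 ?sqr_ge0 // divr_ge0.
lra.
Qed.

End FastGradient.

Lemma jensen (R : realFieldType) (V W : lmodType R) (phi : V -> W -> R) (t : nat -> R)
    (v : nat -> V) (w : nat -> W) n :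
  (forall (s : R) x y x' y', 0 <= s -> s <= 1 ->
     phi (s *: x + (1 - s) *: x') (s *: y + (1 - s) *: y')
       <= s * phi x y + (1 - s) * phi x' y') ->
  (forall i, 0 < t i) ->
  let S := \sum_(0 <= i < n.+1) t i in
  S * phi (S^-1 *: \sum_(0 <= i < n.+1) t i *: v i)
          (S^-1 *: \sum_(0 <= i < n.+1) t i *: w i)
    <= \sum_(0 <= i < n.+1) t i * phi (v i) (w i).
Proof.
move=> phi_cvx t_gt0; elim: n => [|n IH] /=.
  by rewrite !big_nat1 !scalerA mulVf ?gt_eqF // !scale1r.
rewrite !(big_nat_recr n.+1) //=; move: IH => /=.
have : 0 < \sum_(0 <= i < n.+1) t i.
  by rewrite big_nat_recr //= ltr_wpDl // sumr_ge0 // => i _; rewrite ltW.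
move: (\sum_(0 <= i < n.+1) t i) (\sum_(0 <= i < n.+1) t i *: v i)
  (\sum_(0 <= i < n.+1) t i *: w i) (\sum_(0 <= i < n.+1) t i * _) => S sv sw sp S0 IH.
have T0 : 0 < S + t n.+1 by rewrite addr_gt0 ?t_gt0.
pose s := S / (S + t n.+1).
have s0 : 0 <= s by rewrite divr_ge0 // ltW.
have s1 : s <= 1 by rewrite ler_pdivrMr // mul1r lerDl ltW // t_gt0.
have comb (U : lmodType R) (x x' : U) :
    (S + t n.+1)^-1 *: (x + t n.+1 *: x') = s *: (S^-1 *: x) + (1 - s) *: x'.
  have e1 : 1 - s = (S + t n.+1)^-1 * t n.+1.
    by rewrite /s; field; rewrite gt_eqF.
  have e2 : s / S = (S + t n.+1)^-1 by rewrite /s; field; rewrite !gt_eqF.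
  by rewrite scalerDr !scalerA e1 e2.
have e1 : (S + t n.+1) * s = S by rewrite mulrC divfK // gt_eqF.
clearbody s; rewrite !comb.
apply: le_trans (ler_wpM2l (ltW T0) (phi_cvx _ _ _ _ _ s0 s1)) _.
rewrite mulrDr !mulrA e1 mulrBr mulr1 e1 [S + _]addrC addrK.
by rewrite lerD2r.
Qed.

(** * A priori size of a step that does not increase the model *)

Section StepBound.
Context {R : realType} {X Z : euclideanType R}.

(** The linear terms can decrease the model at most linearly in [|u|], against a quadratic increase.
    It serves for exact minimizers and for trial steps. *)
Lemma step_le (c : X) (A : {linear X -> Z}) (F0 : Z) (th : Z -> R) (a l q : R) (u : X) :
  0 < a -> 0 <= l -> (forall w, th F0 - th w <= l * `|w - F0|) ->
  a * `|u| ^+ 2 <= q -> '[c, u] + 2^-1 * q + th (F0 + A u) <= th F0 ->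
  a * `|u| <= 2 * (`|c| + l * opnorm A).
Proof.
move=> a0 l0 slope aq dec.
have := slope (F0 + A u); rewrite addrAC subrr add0r => h1.
have h2 := ler_wpM2l l0 (opnorm_le A u).
have := cauchy_schwarz (- c) u; rewrite dotNl normrN => h3.
have [u0|u0] := eqVneq `|u| 0.
  by rewrite u0 mulr0 mulr_ge0 // addr_ge0 // mulr_ge0 // opnorm_ge0.
have up : 0 < `|u| by rewrite lt_neqAle eq_sym u0 normr_ge0.
by rewrite -(ler_pM2r up); lra.
Qed.

End StepBound.

(** * Convergence rates of the dual method on a fixed subproblem *)

Section DualGap.
Context {R : realType} {X Z : euclideanType R}.
Variables (c : X) (A : {linear X -> Z}) (F0 : Z) (T : set X) (th : Z -> R).
Variables (f0 a b : R).
Hypothesis T_subspace : subspace T.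
Hypothesis th_convex : forall (t : R) x y, 0 <= t -> t <= 1 ->
  th (t *: x + (1 - t) *: y) <= t * th x + (1 - t) * th y.
Hypotheses (a_gt0 : 0 < a) (b_gt0 : 0 < b).

Local Notation Psi := (dualf c A F0 T th f0 a b).
Local Notation g := (residual c A F0 T th a b).
Local Notation vof := (v_of c A T a).
Local Notation zof := (z_of F0 th b).
Local Notation primal := (primalf c A F0 th f0 a b).
Local Notation lagrange := (lagr c A F0 th f0 a b).
Local Notation L := (dual_lip c A F0 T th f0 a b).

Variables (ze y : nat -> Z) (t : nat -> R).
Hypothesis t0 : t 0 = 1.
Hypothesis ze_step : forall n, L *: (ze n.+1 - y n) = g (y n).
Hypothesis y_step : forall n,
  y n.+1 = ze n.+1 + ((t n - 1) / t n.+1) *: (ze n.+1 - ze n).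
Hypothesis t_step : forall n, t n.+1 = (1 + Num.sqrt (1 + 4 * t n ^+ 2)) / 2.

Definition v_avg n : X :=
  (\sum_(0 <= i < n.+1) t i)^-1 *: \sum_(0 <= i < n.+1) t i *: vof (y i).
(** An object of the analysis: paired with [v_avg] it lets joint convexity of the Lagrangian be
    applied. *)
Definition z_avg n : Z :=
  (\sum_(0 <= i < n.+1) t i)^-1 *: \sum_(0 <= i < n.+1) t i *: zof (y i).

Let t_gt0 n : 0 < t n.
Proof. by rewrite (lt_le_trans ltr01) //; apply: theta_ge1. Qed.

Lemma sqr_convex (V : euclideanType R) (s : R) (x x' : V) : 0 <= s -> s <= 1 ->
  `|s *: x + (1 - s) *: x'| ^+ 2 <= s * `|x| ^+ 2 + (1 - s) * `|x'| ^+ 2.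
Proof.
move=> s0 s1; rewrite normD2 !normZ2 dotZl dotZr.
have : 0 <= s * (1 - s) * `|x - x'| ^+ 2 by rewrite !mulr_ge0 // subr_ge0.
by rewrite normB2; lra.
Qed.

Lemma lagr_convex zeta (s : R) u z u' z' : 0 <= s -> s <= 1 ->
  lagrange (s *: u + (1 - s) *: u') (s *: z + (1 - s) *: z') zeta
    <= s * lagrange u z zeta + (1 - s) * lagrange u' z' zeta.
Proof.
move=> s0 s1; have h1 := th_convex z z' s0 s1; have h2 := sqr_convex u u' s0 s1.
have := sqr_convex (z - F0) (z' - F0) s0 s1.
have -> : s *: (z - F0) + (1 - s) *: (z' - F0) = s *: z + (1 - s) *: z' - F0.
  by rewrite !scalerBr addrACA -opprD -scalerDl [s + _]addrC subrK scale1r.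
have Ae : A (s *: u + (1 - s) *: u') = s *: A u + (1 - s) *: A u'.
  by rewrite linearD !linearZ.
move=> h3; rewrite /lagr Ae.
have a2 : 0 <= a / 2 by rewrite divr_ge0 // ltW.
have b2 : 0 <= b / 2 by rewrite divr_ge0 // ltW.
have := ler_wpM2l a2 h2; have := ler_wpM2l b2 h3; move: h1.
rewrite !dotE.
lra.
Qed.

Lemma v_avg_in n : T (v_avg n).
Proof.
have [_ T0 TD TZ] := T_subspace.
apply: (TZ); elim/big_ind : _ => // i _; apply: TZ; exact: v_of_in.
Qed.

Lemma averaged_lagr n zeta :
  lagrange (v_avg n) (z_avg n) zeta
    <= Psi (ze n.+1) + L / (2 * t n ^+ 2) * `|y 0 - zeta| ^+ 2.
Proof.
have := @fast_gradient R Z Psi g L (dual_supergrad _ _ _ _ T_subspace th_convex a_gt0 b_gt0)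
  (dual_ascent _ _ _ _ T_subspace th_convex a_gt0 b_gt0) ze y t t0 ze_step y_step t_step n zeta
  (dual_lip_ge0 _ _ _ _ T_subspace th_convex a_gt0 b_gt0).
under eq_bigr => i _ do rewrite dual_value // -lagr_affine.
have := @jensen R X Z (fun u z => lagrange u z zeta) t (vof \o y) (zof \o y) n.
move=> /(_ (fun s u z u' z' => @lagr_convex zeta s u z u' z')) /(_ t_gt0) /= h1 h2.
have := le_trans h1 h2; rewrite -/(v_avg n) -/(z_avg n) theta_sum //.
have tn := t_gt0 n; have t2 : 0 < t n ^+ 2 by rewrite exprn_gt0.
move=> h; rewrite -(ler_pM2l t2) (le_trans h) // mulrDr lerD2l le_eqVlt.
by apply/orP; left; apply/eqP; field; rewrite gt_eqF.
Qed.

Variable zs : Z.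
Hypothesis zs_max : forall zeta, Psi zeta <= Psi zs.
Local Notation vs := (vof zs).

Lemma vs_primal : primal vs = Psi zs.
Proof. by apply: (strong_duality _ _ _ _ _ _).2 => //; exact: dual_max_residual zs_max. Qed.

Lemma vs_min u : T u -> primal vs + a / 2 * `|u - vs| ^+ 2 <= primal u.
Proof. by move=> Tu; rewrite vs_primal; exact: weak_duality. Qed.

(** At the multiplier [zs] the averaged Lagrangian is at least its minimum [Psi zs]. *)
Lemma dual_gap n :
  Psi zs - Psi (ze n.+1) <= L / (2 * t n ^+ 2) * `|y 0 - zs| ^+ 2.
Proof.
have := averaged_lagr n zs.
have := lagr_strong c A F0 f0 T_subspace th_convex a_gt0 b_gt0 (z_avg n) zs (v_avg_in n).
rewrite -dual_value //.
have : 0 <= a / 2 * `|v_avg n - vs| ^+ 2 by rewrite mulr_ge0 ?sqr_ge0 // divr_ge0 // ltW.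
have : 0 <= b / 2 * `|z_avg n - zof zs| ^+ 2 by rewrite mulr_ge0 ?sqr_ge0 // divr_ge0 // ltW.
lra.
Qed.

Lemma v_avg_dist n :
  a * `|v_avg n - vs| ^+ 2 <= L / t n ^+ 2 * `|y 0 - zs| ^+ 2.
Proof.
have := averaged_lagr n zs; have := zs_max (ze n.+1).
have := lagr_strong c A F0 f0 T_subspace th_convex a_gt0 b_gt0 (z_avg n) zs (v_avg_in n).
rewrite -dual_value //.
have : 0 <= b / 2 * `|z_avg n - zof zs| ^+ 2 by rewrite mulr_ge0 ?sqr_ge0 // divr_ge0 // ltW.
have -> : L / t n ^+ 2 = 2 * (L / (2 * t n ^+ 2)) by field; rewrite gt_eqF.
lra.
Qed.

(** Weak duality at the last multiplier, tested at the exact minimizer: the dual gap bounds the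
    squared distance. *)
Lemma v_last_dist n :
  a * `|vof (ze n.+1) - vs| ^+ 2 <= L / t n ^+ 2 * `|y 0 - zs| ^+ 2.
Proof.
have := dual_gap n; have vsT : T vs by exact: v_of_in.
have := weak_duality c A F0 f0 T_subspace th_convex a_gt0 b_gt0 (ze n.+1) vsT.
rewrite vs_primal distrC.
have -> : L / t n ^+ 2 = 2 * (L / (2 * t n ^+ 2)) by field; rewrite gt_eqF.
lra.
Qed.

Let quad_th z := b / 2 * `|z - F0| ^+ 2 + th z.

(* Exact penalization: the multiplier of norm [lz] along the violation of the
   constraint compensates the replacement of [z_avg n] by [F0 + A (v_avg n)]. *)
Lemma primal_gap_avg n lz : 0 <= lz ->
  (forall w, quad_th (F0 + A (v_avg n)) - quad_th w <= lz * `|w - (F0 + A (v_avg n))|) ->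
  primal (v_avg n) - Psi (ze n.+1) <= L / (2 * t n ^+ 2) * (`|y 0| + lz) ^+ 2.
Proof.
move=> lz0 /(_ (z_avg n)).
set r := z_avg n - _.
have [zeta [zl ze_r]] : exists zeta, `|zeta| <= lz /\ '[zeta, - r] = lz * `|r|.
  have [r0|r0] := eqVneq r 0.
    by exists 0; rewrite r0 !normr0 oppr0 dot0r mulr0.
  have nr : 0 < `|r| by rewrite normr_gt0.
  exists (- (lz * `|r|^-1) *: r); rewrite normrZ normrN ger0_norm; last first.
    by rewrite mulr_ge0 // invr_ge0 ltW.
  rewrite divfK ?gt_eqF // lexx; split => //.
  by rewrite dotNr dotZl dotp_norm; field; rewrite gt_eqF.
have := averaged_lagr n zeta.
rewrite /primalf /lagr /quad_th -[X in '[zeta, X]]opprB -/r ze_r.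
rewrite [F0 + A _ - F0]addrAC subrr add0r => h1 h2.
have L0 : 0 <= L / (2 * t n ^+ 2).
  apply: divr_ge0; last by rewrite mulr_ge0 ?sqr_ge0.
  exact: (dual_lip_ge0 _ _ _ _ T_subspace th_convex a_gt0 b_gt0).
have h3 : `|y 0 - zeta| ^+ 2 <= (`|y 0| + lz) ^+ 2.
  have s0 : 0 <= `|y 0| + lz by rewrite addr_ge0.
  by rewrite ler_sqr ?nnegrE // (le_trans (ler_normB _ _)) // lerD2l.
have := ler_wpM2l L0 h3; lra.
Qed.

(** It converts the distance of the last iterate to the exact minimizer into a gap in primal
    value. *)
Lemma primal_lipschitz u v lz :
  (forall w, quad_th (F0 + A u) - quad_th w <= lz * `|w - (F0 + A u)|) ->
  0 <= lz ->
  primal u - primal v <= (`|c| + a / 2 * (`|u| + `|v|) + lz * opnorm A) * `|u - v|.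
Proof.
move=> /(_ (F0 + A v)) h lz0.
have rE : F0 + A v - (F0 + A u) = A (v - u).
  by rewrite [A (v - u)]linearB opprD addrACA subrr add0r.
rewrite rE in h; have := opnorm_le A (v - u) => /(ler_wpM2l lz0).
rewrite (distrC v) => h1.
have := cauchy_schwarz c (u - v); rewrite dotBr => h2.
have nu : `|u| - `|v| <= `|u - v| by rewrite lerBlDr -{1}(subrK v u) ler_normD.
have h3 : a / 2 * (`|u| ^+ 2 - `|v| ^+ 2) <= a / 2 * (`|u| + `|v|) * `|u - v|.
  rewrite -[leRHS]mulrA; apply: ler_wpM2l; first by rewrite divr_ge0 // ltW.
  by rewrite subr_sqr mulrC ler_wpM2l // addr_ge0.
rewrite /quad_th in h; rewrite /primalf.
have fE w : F0 + A w - F0 = A w by rewrite addrAC subrr add0r.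
rewrite !fE in h; lra.
Qed.

End DualGap.

(** * Rates with one constant for all subproblems with bounded data *)

Section UniformGap.
Context {R : realType} {X Z : euclideanType R}.
Variable th : Z -> R.
Hypothesis th_convex : forall (t : R) x y, 0 <= t -> t <= 1 ->
  th (t *: x + (1 - t) *: y) <= t * th x + (1 - t) * th y.

(** The subgradient inequality is tested at a unit step from [z] in the direction of [xi]. *)
Lemma subdiff_norm_le (z xi : Z) (r l : R) : subdiff th z xi -> 0 <= l -> `|z| <= r ->
  (forall x y, `|x| <= r + 1 -> `|y| <= r + 1 -> th y - th x <= l * `|y - x|) ->
  `|xi| <= l.
Proof.
move=> sub l0 zr lip; have [->|xi0] := eqVneq xi 0; first by rewrite normr0.
have nx : 0 < `|xi| by rewrite normr_gt0.
pose e := `|xi|^-1 *: xi.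
have ne : `|e| = 1 by rewrite normrZ normfV normr_id mulVf // gt_eqF.
have := sub (z + e); rewrite addrAC subrr add0r.
have -> : '[xi, e] = `|xi| by rewrite dotZr dotp_norm expr2 mulKf // gt_eqF.
have zr1 : `|z| <= r + 1 by lra.
have zer : `|z + e| <= r + 1 by rewrite (le_trans (ler_normD _ _)) // ne lerD2r.
have := lip z (z + e) zr1 zer; rewrite addrAC subrr add0r ne mulr1; lra.
Qed.

Lemma quad_slope (F0 z : Z) (b r l k : R) : 0 <= b -> 0 <= l -> `|z| <= r ->
  (forall x y, `|x| <= r + 1 -> `|y| <= r + 1 -> th y - th x <= l * `|y - x|) ->
  b * `|z - F0| <= k ->
  forall w, (b / 2 * `|z - F0| ^+ 2 + th z) - (b / 2 * `|w - F0| ^+ 2 + th w)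
     <= (k + l) * `|w - z|.
Proof.
move=> b0 l0 zr lip zk w; have := convex_slope th_convex w lip l0 zr.
have -> : w - F0 = (z - F0) + (w - z) by rewrite [RHS]addrC addrA subrK.
move: zk; move: (z - F0) (w - z) => p d pk; rewrite [`|p + d| ^+ 2]normD2.
have := ler_wpM2l b0 (cauchy_schwarz (- p) d); rewrite dotNl normrN.
have := ler_wpM2r (normr_ge0 d) pk.
have : 0 <= b / 2 * `|d| ^+ 2 by rewrite mulr_ge0 ?sqr_ge0 // divr_ge0.
lra.
Qed.

Definition dfg_sequence (L : R) (g : Z -> Z) (ze y : nat -> Z) (t : nat -> R) :=
  [/\ t 0 = 1, forall n, L *: (ze n.+1 - y n) = g (y n),
      forall n, y n.+1 = ze n.+1 + ((t n - 1) / t n.+1) *: (ze n.+1 - ze n) &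
      forall n, t n.+1 = (1 + Num.sqrt (1 + 4 * t n ^+ 2)) / 2].

Lemma uniform_gap (cb al Fb alo ahi blo bhi Yb : R) :
  0 < alo -> 0 < blo ->
  exists2 K, 0 < K & forall (c : X) (A : {linear X -> Z}) F0 (T : set X) f0 a b ze y t,
  subspace T -> `|c| <= cb -> opnorm A <= al -> `|F0| <= Fb ->
  alo <= a <= ahi -> blo <= b <= bhi ->
  dfg_sequence (dual_lip c A F0 T th f0 a b) (residual c A F0 T th a b) ze y t ->
  `|y 0| <= Yb ->
  exists zs, (forall zeta, dualf c A F0 T th f0 a b zeta <= dualf c A F0 T th f0 a b zs) /\
  forall n (psi := dualf c A F0 T th f0 a b (ze n.+1)) (vs := v_of c A T a zs)
     (vl := v_of c A T a (ze n.+1)) (va := v_avg c A T a y t n),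
  [/\ `|vl - vs| <= K / n.+1%:R, primalf c A F0 th f0 a b vl - psi <= K / n.+1%:R,
      `|va - vs| <= K / n.+1%:R & primalf c A F0 th f0 a b va - psi <= K / n.+1%:R ^+ 2].
Proof.
move=> alo0 blo0.
have [L1 L10 L1P] := convex_ball_lipschitz th_convex (Fb + 1).
(* [V] bounds the exact minimizer, through [step_le], and [r2] its linearized image. *)
pose V := 2 * (cb + L1 * al) / alo; pose r2 := Fb + al * V.
have [L2 L20 L2P] := convex_ball_lipschitz th_convex (r2 + 1).
(* [Zb] bounds the dual maximizer, which is a subgradient plus [b *: A vs]; [D] bounds its distance
   to the starting point and [Lb] the dual Lipschitz constant. *)
pose Zb := L2 + bhi * (al * V); pose D := Yb + Zb; pose Lb := al ^+ 2 / alo + blo^-1.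
(* [E] bounds [t n] times the distance of an iterate to the minimizer. As [1 <= E], bounding the
   square by [E] suffices. [W] then bounds the iterates. *)
pose E := Lb * D ^+ 2 / alo + 1; pose W := V + E; pose r3 := Fb + al * W.
have [L3 L30 L3P] := convex_ball_lipschitz th_convex (r3 + 1).
(* A slope of the quadratic plus [th] at the images of points of norm at most [W]; it is also the
   multiplier norm in the exact penalization. *)
pose lz := bhi * (al * W) + L3.
pose C := cb + ahi / 2 * (W + V) + lz * al.
pose K0 := 2 * E + (Lb * D ^+ 2 + 2 * (`|C| * E)) + 2 * (Lb * (Yb + lz) ^+ 2).
have Lb0 : 0 <= Lb by rewrite addr_ge0 ?divr_ge0 ?invr_ge0 ?sqr_ge0 // ltW.
have LD0 : 0 <= Lb * D ^+ 2 by rewrite mulr_ge0 ?sqr_ge0.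
have E1 : 1 <= E by rewrite lerDr divr_ge0 // ltW.
have CE0 : 0 <= `|C| * E by rewrite mulr_ge0 //; lra.
have LY0 : 0 <= Lb * (Yb + lz) ^+ 2 by rewrite mulr_ge0 ?sqr_ge0.
exists (K0 + 1); first by rewrite /K0; lra.
have [KE KC KY] : [/\ 2 * E <= K0 + 1, Lb * D ^+ 2 + 2 * (`|C| * E) <= K0 + 1 &
    2 * (Lb * (Yb + lz) ^+ 2) <= K0 + 1] by rewrite /K0; split; lra.
move=> c A F0 T f0 a b ze y t Tsub cc Aal FF /andP[a1 a2] /andP[b1 b2].
move=> [t0 zstep ystep tstep] yY.
have a0 : 0 < a by lra. have b0 : 0 < b by lra.
have cb0 : 0 <= cb by apply: le_trans cc. have al0 := opnorm_ge0 A.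
have al1 : 0 <= al by apply: le_trans Aal.
have Yb0 : 0 <= Yb by apply: le_trans yY.
have V0 : 0 <= V.
  by apply: divr_ge0; [rewrite mulr_ge0 // addr_ge0 // mulr_ge0|exact: ltW].
have [zs zsP] := dual_max c A F0 f0 Tsub th_convex a0 b0.
exists zs; split => // n psi vs vl va.
have T0 : T 0 by have [] := Tsub.
have vsV : `|vs| <= V.
  have := vs_min (c := c) (A := A) Tsub th_convex a0 b0 zsP T0; rewrite -/vs => h.
  have q0 : 0 <= a / 2 * `|0 - vs| ^+ 2 by rewrite mulr_ge0 ?sqr_ge0 // divr_ge0 // ltW.
  have := @step_le _ _ _ c A F0 th a L1 (a * `|vs| ^+ 2 + b * `|A vs| ^+ 2) vs a0 L10.
  have slope w : th F0 - th w <= L1 * `|w - F0| := convex_slope th_convex w L1P L10 FF.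
  have q1 : a * `|vs| ^+ 2 <= a * `|vs| ^+ 2 + b * `|A vs| ^+ 2.
    by rewrite lerDl; apply: mulr_ge0; [exact: ltW|exact: sqr_ge0].
  move=> /(_ slope q1) h2.
  have {}h2 : a * `|vs| <= 2 * (`|c| + L1 * opnorm A).
    apply: h2; move: h; rewrite /primalf dot0r (linear0 A) !normr0 expr0n addr0 /=; lra.
  rewrite ler_pdivlMr //.
  have h3 : L1 * opnorm A <= L1 * al by rewrite ler_wpM2l.
  have h4 : alo * `|vs| <= a * `|vs| by rewrite ler_wpM2r.
  lra.
have AvV u w : `|u| <= w -> `|A u| <= al * w.
  by move=> uw; rewrite (le_trans (opnorm_le A u)) // ler_pM // opnorm_ge0.
have zsZ : `|zs| <= Zb.
  have res0 := dual_max_residual Tsub th_convex a0 b0 zsP.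
  have [zE _] := strong_duality f0 Tsub th_convex a0 b0 res0.
  have := z_of_subdiff F0 th_convex b0 zs; rewrite zE -/vs addrAC subrr add0r => sub.
  have zr2 : `|F0 + A vs| <= r2 by rewrite (le_trans (ler_normD _ _)) // lerD // AvV.
  have := subdiff_norm_le sub L20 zr2 L2P.
  rewrite -{2}(subrK (b *: A vs) zs) => h; rewrite (le_trans (ler_normD _ _)) // lerD //.
  by rewrite normrZ (ger0_norm (ltW b0)) ler_pM // ?AvV // ltW.
have Ll : dual_lip c A F0 T th f0 a b <= Lb.
  apply: le_trans (dual_lip_le c A F0 f0 Tsub th_convex a0 b0) _.
  rewrite lerD //; last by rewrite lef_pV2 // posrE.
  have e1 : opnorm A ^+ 2 <= al ^+ 2 by rewrite ler_sqr ?nnegrE.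
  have e2 : a^-1 <= alo^-1 by rewrite lef_pV2 // posrE.
  by apply: ler_pM => //; [exact: sqr_ge0|rewrite invr_ge0 ltW].
have Ll0 := dual_lip_ge0 c A F0 f0 Tsub th_convex a0 b0.
have gap := dual_gap Tsub th_convex a0 b0 t0 zstep ystep tstep zs n.
have dl := v_last_dist Tsub th_convex a0 b0 t0 zstep ystep tstep zsP n.
have da := v_avg_dist Tsub th_convex a0 b0 t0 zstep ystep tstep zsP n.
rewrite -/vs -/vl -/va -/psi in gap dl da.
have ga := primal_gap_avg (n := n) Tsub th_convex a0 b0 t0 zstep ystep tstep.
have s1 := theta_ge1 t0 tstep n; have sN := theta_ge t0 tstep n.
have vsE := vs_primal Tsub th_convex a0 b0 zsP; rewrite -/vs in vsE.
have lipP := @primal_lipschitz _ _ _ c A F0 th f0 a b a0.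
move: (dual_lip _ _ _ _ _ _ _ _) Ll Ll0 gap dl da ga => L Ll Ll0 gap dl da ga.
set s := t n in s1 sN gap dl da ga; clearbody s.
rewrite -[n.+2%:R]natr1 in sN.
have N1 : 1 <= n.+1%:R :> R by rewrite ler1n.
move: (n.+1%:R : R) N1 sN => N N1 sN.
have s0 : 0 < s := lt_le_trans ltr01 s1; have N0 : 0 < N := lt_le_trans ltr01 N1.
have sN2 : N <= 2 * s by rewrite mulrC -ler_pdivrMr // (le_trans _ sN) // ler_pM2r // lerDl.
have D2 : `|y 0 - zs| ^+ 2 <= D ^+ 2.
  have D0 : `|y 0 - zs| <= D by rewrite (le_trans (ler_normB _ _)) // lerD.
  by rewrite ler_sqr // nnegrE // (le_trans _ D0).
have LDle : L * `|y 0 - zs| ^+ 2 <= Lb * D ^+ 2 by rewrite ler_pM // sqr_ge0.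
have dist u : a * `|u - vs| ^+ 2 <= L / s ^+ 2 * `|y 0 - zs| ^+ 2 -> s * `|u - vs| <= E.
  move=> h.
  have h1 : alo * (s * `|u - vs|) ^+ 2 <= Lb * D ^+ 2.
    apply: le_trans LDle; move: h; rewrite mulrAC ler_pdivlMr ?exprn_gt0 //.
    apply: le_trans; rewrite exprMn mulrCA mulrC.
    by apply: ler_wpM2r; [exact: sqr_ge0|apply: ler_wpM2r; [exact: sqr_ge0|]].
  have h2 : (s * `|u - vs|) ^+ 2 <= E.
    by rewrite /E; move: h1; rewrite mulrC -ler_pdivlMr //; lra.
  have p0 : 0 <= s * `|u - vs| by rewrite mulr_ge0 // ltW.
  by move: h2 p0 E1; clear; nra.
have bound u : s * `|u - vs| <= E -> `|u| <= W.
  move=> h; have := ler_normD (u - vs) vs; rewrite subrK /W.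
  have := normr_ge0 (u - vs); move: h vsV s1; move: (`|u - vs|) (`|vs|) (`|u|) => p q r.
  by clear; nra.
have slopeW u : `|u| <= W -> forall w,
    b / 2 * `|F0 + A u - F0| ^+ 2 + th (F0 + A u) - (b / 2 * `|w - F0| ^+ 2 + th w) <=
    lz * `|w - (F0 + A u)|.
  move=> uW; apply: (quad_slope (r := r3)) => //; first exact: ltW.
    by rewrite (le_trans (ler_normD _ _)) // lerD // AvV.
  by rewrite addrAC subrr add0r ler_pM // ?AvV // ltW.
have E0 : 0 <= E := le_trans ler01 E1; have W0 : 0 <= W := addr_ge0 V0 E0.
have bhi0 : 0 <= bhi by exact: le_trans (ltW b0) b2.
have ahi0 : 0 <= ahi by exact: le_trans (ltW a0) a2.
have lz0 : 0 <= lz by rewrite addr_ge0 // !mulr_ge0.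
have C0 : 0 <= C.
  have h2 : 0 <= ahi / 2 * (W + V).
    by apply: mulr_ge0; [exact: divr_ge0|exact: addr_ge0].
  have h3 : 0 <= lz * al by exact: mulr_ge0.
  by apply: addr_ge0 => //; exact: addr_ge0.
have CC : `|C| = C by rewrite ger0_norm.
have distN u : s * `|u - vs| <= E -> `|u - vs| * N <= 2 * E.
  by move=> h; have := ler_wpM2l (normr_ge0 (u - vs)) sN2; move: h; clear; lra.
have ssN : s <= s ^+ 2 by rewrite expr2 ler_peMl // ltW.
have inv2 : 0 < 2 * s ^+ 2 by rewrite mulr_gt0 // exprn_gt0.
have [el ea] := (dist _ dl, dist _ da).
have [Wl Wa] := (bound _ el, bound _ ea).
split.
- by rewrite ler_pdivlMr // (le_trans (distN _ el)).
- have := lipP vl vs lz (slopeW _ Wl) lz0; rewrite vsE => pl.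
  have C1 : `|c| + a / 2 * (`|vl| + `|vs|) + lz * opnorm A <= C.
    have e1 : a / 2 <= ahi / 2 by rewrite ler_pM2r // invr_gt0.
    have e2 : `|vl| + `|vs| <= W + V by exact: lerD.
    have e3 : lz * opnorm A <= lz * al by rewrite ler_wpM2l.
    apply: lerD => //; apply: lerD => //; apply: ler_pM => //.
    by apply: divr_ge0 => //; exact: ltW.
  have := ler_wpM2r (normr_ge0 (vl - vs)) C1 => pl'.
  rewrite mulrAC ler_pdivlMr // in gap.
  have e1 := ler_wpM2l C0 (distN _ el).
  rewrite ler_pdivlMr //; apply: le_trans KC; rewrite CC.
  (* The gap of the last iterate is the dual gap [G], of order [s ^- 2], plus a primal difference of
     order [s ^- 1], which dominates. *)
  set G := dualf _ _ _ _ _ _ _ _ zs - psi in gap *.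
  have G0 : 0 <= G by rewrite subr_ge0 zsP.
  have e2 : G * N <= Lb * D ^+ 2.
    apply: le_trans LDle; apply: le_trans gap; rewrite ler_wpM2l //.
    by rewrite (le_trans sN2) // ler_pM2l.
  have e3 : (primalf c A F0 th f0 a b vl - psi) * N <= (G + C * `|vl - vs|) * N.
    have e4 := le_trans pl pl'.
    by apply: ler_wpM2r; [exact: ltW|move: e4; rewrite /G; clear; lra].
  by apply: (le_trans e3); rewrite mulrDl lerD // -mulrA [leRHS]mulrCA.
- by rewrite ler_pdivlMr // (le_trans (distN _ ea)).
- have {}ga := ga lz lz0 (slopeW _ Wa); rewrite -/va -/psi in ga.
  rewrite mulrAC ler_pdivlMr // in ga.
  rewrite ler_pdivlMr ?exprn_gt0 //.
  have [G0|/ltW G0] := leP (primalf c A F0 th f0 a b va - psi) 0.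
    have K00 : 0 <= K0 + 1 by apply: le_trans KY; exact: mulr_ge0.
    by apply: le_trans K00; rewrite mulr_le0_ge0 ?sqr_ge0.
  have N2 : N ^+ 2 <= 2 * (2 * s ^+ 2).
    have -> : 2 * (2 * s ^+ 2) = (2 * s) ^+ 2 by ring.
    by rewrite ler_sqr // nnegrE ?(ltW N0) // mulr_ge0 // ltW.
  have y2 : (`|y 0| + lz) ^+ 2 <= (Yb + lz) ^+ 2.
    have p1 : 0 <= `|y 0| + lz by exact: addr_ge0.
    have p2 : `|y 0| + lz <= Yb + lz by rewrite lerD2r.
    by rewrite ler_sqr // nnegrE (le_trans p1).
  have Ly : L * (`|y 0| + lz) ^+ 2 <= Lb * (Yb + lz) ^+ 2 by rewrite ler_pM ?sqr_ge0.
  apply: le_trans KY; apply: (le_trans (ler_wpM2l G0 N2)).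
  by rewrite mulrCA ler_pM2l // (le_trans ga).
Qed.

End UniformGap.

(** * Number of dual steps before the inexactness test succeeds *)

Section Subproblem.
Context {R : realType} {X Z : euclideanType R}.
Variable P : problem X Z.
Hypothesis th_convex : forall (t : R) x y, 0 <= t -> t <= 1 ->
  vartheta P (t *: x + (1 - t) *: y) <= t * vartheta P x + (1 - t) * vartheta P y.

Section Fixed.
Variables (x : X) (a b : R).
Hypothesis T_subspace : subspace (tangent P x).
Hypotheses (a_gt0 : 0 < a) (b_gt0 : 0 < b).

Local Notation c := (grad (pb_f P) x).
Local Notation A := ('d (pb_F P) x).
Local Notation F0 := (pb_F P x).
Local Notation T := (tangent P x).
Local Notation th := (vartheta P).
Local Notation f0 := (pb_f P x).

Lemma linF_add u : linF P (x + u) x = F0 + A u.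
Proof. by rewrite /linF addrAC subrr add0r. Qed.

Lemma dual_dualf : dual P x a b = dualf c A F0 T th f0 a b.
Proof.
apply/funext => zeta; rewrite /dual /dualf; congr inf.
by apply/seteqP; split => r /= [u [z [Tu ->]]]; exists u, z; rewrite /lagrangian linF_add.
Qed.

Lemma grad_dual_residual : grad (dual P x a b) = residual c A F0 T th a b.
Proof. by rewrite dual_dualf grad_dual. Qed.

Lemma dual_lipschitz_lip : dual_lipschitz P x a b = dual_lip c A F0 T th f0 a b.
Proof. by rewrite /dual_lipschitz dual_dualf. Qed.

Lemma model_primalf (q : X -> X) u :
  (forall u, q u = a *: u + b *: adj_dF P x (dF P x u)) ->
  model P x q u = primalf c A F0 th f0 a b u.
Proof.
move=> qE; rewrite /model /primalf linF_add qE dotDr !dotZr dotp_norm.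
rewrite [in '[u, _]]dotC [in '[adj_dF _ _ _, u]]/adj_dF adjointP dotp_norm.
lra.
Qed.

(** If the Lipschitz constant is 0, its inverse is 0 and the step is null; the gradient is then
    constant and zero at a maximizer, so the step equation still holds. *)
Lemma dfg_is_sequence zeta0 :
  dfg_sequence (dual_lip c A F0 T th f0 a b) (residual c A F0 T th a b)
    (fun n => (dfg P x a b zeta0 n).1.1) (fun n => (dfg P x a b zeta0 n).1.2)
    (fun n => (dfg P x a b zeta0 n).2).
Proof.
split => // n; rewrite /=; case: (dfg P x a b zeta0 n) => [[z y] t] //=.
rewrite addrAC subrr add0r grad_dual_residual dual_lipschitz_lip scalerA.
have [L0|L0] := eqVneq (dual_lip c A F0 T th f0 a b) 0; last by rewrite divff // scale1r.
have [zs zsP] := dual_max c A F0 f0 T_subspace th_convex a_gt0 b_gt0.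
have := residual_dual_lip c A F0 f0 T_subspace th_convex a_gt0 b_gt0 y zs.
rewrite L0 !mul0r scale0r (dual_max_residual _ _ _ _ zsP) // subr0 normr_le0.
by move=> /eqP.
Qed.

Lemma average_v_avg zeta0 n :
  average_v P x a b zeta0 n.+1 =
  v_avg c A T a (fun n => (dfg P x a b zeta0 n).1.2) (fun n => (dfg P x a b zeta0 n).2) n.
Proof. by rewrite /average_v /v_avg !big_add1. Qed.

End Fixed.

(** The test failed one step before the end. This forces the previous iterate or the exact minimizer
    to be small relative to the gap; the returned [v] is close to both, so [|v|] is bounded in terms
    of [N]. *)
Lemma dual_steps_bound (cb al Fb alo ahi blo bhi Yb mlo : R) :
  0 < alo -> 0 < blo -> 0 < mlo ->
  exists2 K, 0 < K & forall out x (q : X -> X) a b mu zeta0 N,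
  subspace (tangent P x) -> `|grad (pb_f P) x| <= cb -> opnorm (dF P x) <= al ->
  `|pb_F P x| <= Fb -> alo <= a <= ahi -> blo <= b <= bhi -> `|zeta0| <= Yb -> mlo <= mu ->
  (forall u, q u = a *: u + b *: adj_dF P x (dF P x u)) -> (0 < N)%N ->
  (forall l, (0 < l < N)%N ->
     ~ inexact_solution P x q mu (dfg_primal P out x a b zeta0 l)
         (dual P x a b (dfg_zeta P x a b zeta0 l))) ->
  let v := dfg_primal P out x a b zeta0 N in v != 0 ->
  N%:R <= K * (1 + if out is Last then `|v| ^- 2 else `|v| ^- 1).
Proof.
move=> alo0 blo0 mlo0.
have [K K0 KP] := @uniform_gap R X Z _ th_convex cb al Fb alo ahi blo bhi Yb alo0 blo0.
pose ka := Num.min alo mlo.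
have ka0 : 0 < ka by rewrite lt_min alo0.
pose B := 4 * K / ka + 8 * K ^+ 2.
have B0 : 0 < B by rewrite addr_gt0 ?divr_gt0 ?mulr_gt0 // exprn_gt0.
exists (1 + B); first by rewrite addr_gt0.
move=> out x q a b mu zeta0 [//|n] Tsub cc Aal FF ab bb zz mm qE _ fail v v0.
have /andP[a1 a2] := ab; have /andP[b1 b2] := bb.
have a0 : 0 < a := lt_le_trans alo0 a1; have b0 : 0 < b := lt_le_trans blo0 b1.
have := dfg_is_sequence Tsub a0 b0 zeta0.
have := KP (grad (pb_f P) x) ('d (pb_F P) x) (pb_F P x) (tangent P x) (pb_f P x) a b
   (fun n => (dfg P x a b zeta0 n).1.1) (fun n => (dfg P x a b zeta0 n).1.2)
   (fun n => (dfg P x a b zeta0 n).2) Tsub cc Aal FF ab bb.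
move=> /[apply] /(_ zz) [zs [zsP gap]].
have nv : 0 < `|v| by rewrite normr_gt0.
have pos : 0 <= if out is Last then `|v| ^- 2 else `|v| ^- 1.
  by case: (out); rewrite invr_ge0 // exprn_ge0.
(* After a single step there is no failed test to exploit; the summand 1 of the bound covers this
   case. *)
case: n fail @v v0 nv pos => [|n] fail v v0 nv pos.
  have := mulr_ge0 (ltW B0) pos; set r := (X in B * X).
  by rewrite -/r in pos *; move: pos B0; clear; lra.
set vs := v_of (grad (pb_f P) x) ('d (pb_F P) x) (tangent P x) a zs in gap.
pose vl := dfg_primal P out x a b zeta0 n.+1.
pose e : nat := if out is Last then 1%N else 2%N.
pose psi := dual P x a b (dfg_zeta P x a b zeta0 n.+1).
have Tvl : tangent P x vl.
  by rewrite /vl; case: (out); rewrite /= ?average_v_avg; [exact: v_of_in|exact: v_avg_in].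
have lN : 0 < n.+1%:R :> R by rewrite ltr0n.
have mE u := model_primalf u qE.
have [d1 d2 d3] : [/\ `|vl - vs| <= K / n.+1%:R, model P x q vl - psi <= K / n.+1%:R ^+ e &
    `|v - vs| <= K / n.+1%:R].
  have [g1 g2 g3 g4] := gap n; have [h1 _ h3 _] := gap n.+1.
  have KN : K / n.+2%:R <= K / n.+1%:R.
    by rewrite ler_pM2l // lef_pV2 ?posrE ?ltr0n // ler_nat.
  rewrite mE /psi dual_dualf /vl /v /e; case: (out) => /=.
    by split => //; rewrite ?expr1 //; exact: le_trans KN.
  by rewrite !average_v_avg; split => //; exact: le_trans KN.
have vsT : tangent P x vs by exact: v_of_in.
have T0 : tangent P x 0 by have [] := Tsub.
have vsmin u : tangent P x u -> model P x q vs + a / 2 * `|u - vs| ^+ 2 <= model P x q u.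
  by rewrite !mE => Tu; exact: (vs_min Tsub th_convex a0 b0 zsP Tu).
have psile : psi <= model P x q vs.
  by rewrite mE (vs_primal Tsub th_convex a0 b0 zsP) /psi dual_dualf.
have mmin : model_min P x q = model P x q vs.
  rewrite /model_min; apply: argmin_value => // u Tu; apply: le_trans (vsmin u Tu).
  by rewrite lerDl mulr_ge0 ?sqr_ge0 // divr_ge0 // ltW.
pose G := K / n.+1%:R ^+ e.
have G0 : 0 < G by rewrite divr_gt0 // exprn_gt0.
(* Either the gap test fails at [vl], or [vl] is worse than 0; then strong convexity at 0 bounds the
   minimizer [vs]. *)
have small : ka * `|vl| ^+ 2 <= 2 * G \/ ka * `|vs| ^+ 2 <= 2 * G.
  have [h1|h1] := leP (model P x q vl) (model P x q 0).
    left; have [h2|h2] := leP (model P x q vl - psi) (mu / 2 * `|vl| ^+ 2).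
      by case: (fail n.+1); rewrite ?ltnS ?leqnn //; split; rewrite // mmin.
    have : ka * `|vl| ^+ 2 <= mu * `|vl| ^+ 2.
      by rewrite ler_wpM2r ?sqr_ge0 // (le_trans _ mm) // ge_min lexx orbT.
    by move: d2 h2; rewrite -/G; lra.
  right; have := vsmin 0 T0; rewrite sub0r normrN => h2.
  have : ka * `|vs| ^+ 2 <= a * `|vs| ^+ 2.
    by rewrite ler_wpM2r ?sqr_ge0 // (le_trans _ a1) // ge_min lexx.
  by move: d2; rewrite -/G; lra.
have [w [kw vw]] : exists w : R, ka * w ^+ 2 <= 2 * G /\ `|v| <= `|w| + 2 * (K / n.+1%:R).
  have t1 : `|v| <= `|v - vs| + `|vs| by rewrite -{1}(subrK vs v) ler_normD.
  have Kn : 0 <= K / n.+1%:R by rewrite ltW // divr_gt0.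
  have t2 : `|vs| <= `|vl| + `|vl - vs| by rewrite -{1}(subKr vl vs) ler_normB.
  move: (K / _) Kn d1 d3 => k k0 d1 d3.
  case: small => h; [exists (`|vl|) | exists (`|vs|)]; split; rewrite ?normr_id //.
    by move: t1 t2 d1 d3 k0; clear; lra.
  by move: t1 d3 k0; clear; lra.
have v2 : `|v| ^+ 2 <= 2 * w ^+ 2 + 8 * (K / n.+1%:R) ^+ 2.
  have h : `|v| ^+ 2 <= (`|w| + 2 * (K / n.+1%:R)) ^+ 2.
    by rewrite ler_sqr ?nnegrE // (le_trans _ vw).
  rewrite -[w ^+ 2]real_normK ?num_real //.
  move: h; move: (`|w|) (K / _) => p r h.
  have := sqr_ge0 (p - 2 * r); move: h; clear; nra.
have w2 : w ^+ 2 <= 2 * G / ka by rewrite ler_pdivlMr // mulrC.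
have key : n.+1%:R ^+ e * `|v| ^+ 2 <= B.
  have Ne0 : 0 < n.+1%:R ^+ e :> R by rewrite exprn_gt0.
  have NG : n.+1%:R ^+ e * G = K by rewrite mulrC divfK // gt_eqF.
  have NK : n.+1%:R ^+ e * (K / n.+1%:R) ^+ 2 <= K ^+ 2.
    rewrite expr_div_n mulrCA ler_piMr ?sqr_ge0 // ler_pdivrMr ?exprn_gt0 // mul1r.
    by apply: ler_weXn2l; rewrite ?ler1n // /e; case: (out).
  have h1 := ler_wpM2l (ltW Ne0) v2.
  have h2 : n.+1%:R ^+ e * w ^+ 2 <= 2 * (K / ka).
    rewrite -NG; apply: le_trans (ler_wpM2l (ltW Ne0) w2) _.
    by rewrite le_eqVlt; apply/orP; left; apply/eqP; ring.
  rewrite /B -mulrA; move: NK h1 h2; move: (n.+1%:R ^+ e) ((K / _) ^+ 2) (K ^+ 2) (K / ka).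
  by move: (w ^+ 2) (`|v| ^+ 2) => p r s1 s2 s3 s4; clear; lra.
clearbody B; rewrite -[n.+2%:R]natr1 addrC mulrDr mulr1.
rewrite -addrA lerD2l.
have -> : `|v| ^- 1 = `|v|^-1 by rewrite expr1.
move: key; rewrite /e; case: (out) pos => pos.
  rewrite expr1 -ler_pdivlMr ?exprn_gt0 // => /le_trans; apply.
  by rewrite mulrDl mul1r addrA lerDr addr_ge0 // ltW.
rewrite -exprMn => h.
(* Square roots are avoided through [B <= (1 + B) ^+ 2]. *)
have h2 : n.+1%:R * `|v| <= 1 + B.
  have h3 : B <= (1 + B) ^+ 2 by have := sqr_ge0 B; rewrite sqrrD expr1n mul1r; lra.
  have := le_trans h h3; rewrite ler_sqr // nnegrE; first by rewrite mulr_ge0 // ltW.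
  by rewrite addr_ge0 // ltW.
by rewrite -ler_pdivlMr // in h2; rewrite (le_trans h2) // lerDr ltW.
Qed.

End Subproblem.

(** * Approximate stationarity from a short step *)

Section Model.
Context {R : realType} {X Z : euclideanType R}.

Lemma convex_functionE (th : Z -> R) : convex_function setT th ->
  forall (t : R) x y, 0 <= t -> t <= 1 ->
    th (t *: x + (1 - t) *: y) <= t * th x + (1 - t) * th y.
Proof.
by move=> h t x y t0 t1; have := h (Itv01 t0 t1) x y (in_setT _) (in_setT _).
Qed.

Variable P : problem X Z.
Hypothesis th_convex : forall (t : R) x y, 0 <= t -> t <= 1 ->
  vartheta P (t *: x + (1 - t) *: y) <= t * vartheta P x + (1 - t) * vartheta P y.

(** Strong convexity and the gap test bound [v - vs], so the exact minimizer [vs] is also short. Its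
    optimality condition makes the stationarity residual the tangential part of [- q vs]. *)
Lemma small_step_stationary x (q : X -> X) (a b mu amin mumax abar M eps l : R) (v : X) :
  feas P x -> subspace (tangent P x) -> 0 < amin -> amin <= a -> 0 < b ->
  0 <= abar -> mu <= mumax ->
  (forall u, q u = a *: u + b *: adj_dF P x (dF P x u)) ->
  (forall u, '[u, q u] <= (abar + a) * `|u| ^+ 2) ->
  inexact_solution P x q mu v l ->
  0 < M -> abar + a <= M -> opnorm (dF P x) <= M ->
  `|v| <= M^-1 / (Num.sqrt (amin^-1 * mumax) + 1) * eps ->
  eps_stationary P eps x.
Proof.
move=> Mx Tsub amin0 aamin b0 abar0 mumu qE qub [Tv lbv _ gapv] M0 aM AM vsmall.
have a0 : 0 < a := lt_le_trans amin0 aamin.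
set c := grad (pb_f P) x; set A := 'd (pb_F P) x; set F0 := pb_F P x.
have [zs zsP] := dual_max c A F0 (pb_f P x) Tsub th_convex a0 b0.
have res0 := dual_max_residual Tsub th_convex a0 b0 zsP.
have [zE _] := strong_duality (pb_f P x) Tsub th_convex a0 b0 res0.
pose vs := v_of c A (tangent P x) a zs.
have mE u := model_primalf u qE.
have vsT : tangent P x vs by exact: v_of_in.
have vsmin u : tangent P x u -> model P x q vs + a / 2 * `|u - vs| ^+ 2 <= model P x q u.
  by rewrite !mE => Tu; exact: (vs_min Tsub th_convex a0 b0 zsP Tu).
have mmin : model_min P x q = model P x q vs.
  rewrite /model_min; apply: argmin_value => // u Tu; apply: le_trans (vsmin u Tu).
  by rewrite lerDl mulr_ge0 ?sqr_ge0 // divr_ge0 // ltW.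
set s := Num.sqrt _ in vsmall.
have s0 : 0 <= s by exact: sqrtr_ge0.
have near_v : `|v - vs| <= s * `|v|.
  have h : a * `|v - vs| ^+ 2 <= mumax * `|v| ^+ 2.
    have h1 := vsmin v Tv; rewrite mmin in lbv.
    have h2 : mu * `|v| ^+ 2 <= mumax * `|v| ^+ 2 by rewrite ler_wpM2r ?sqr_ge0.
    lra.
  have sv0 : 0 <= s * `|v| by rewrite mulr_ge0.
  rewrite -[leLHS]ger0_norm // -ler_sqr ?nnegrE // real_normK ?num_real // exprMn.
  (* For negative [mumax] the square root is 0, but then [v] and [vs] coincide. *)
  have [m0|m0] := ltP mumax 0.
    have : mumax * `|v| ^+ 2 <= 0 by rewrite mulr_le0_ge0 ?sqr_ge0 // ltW.
    move=> /(le_trans h); rewrite pmulr_rle0 // => /le_trans; apply.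
    by rewrite mulr_ge0 ?sqr_ge0.
  rewrite sqr_sqrtr; last by rewrite mulr_ge0 // invr_ge0 ltW.
  rewrite -mulrA ler_pdivlMl // (le_trans _ h) // ler_wpM2r ?sqr_ge0 //.
have vsM : M * `|vs| <= eps.
  have : `|vs| <= (s + 1) * `|v|.
    have := ler_normB v (v - vs); rewrite subKr; lra.
  have s1 : 0 < s + 1 by rewrite ltr_wpDl.
  have -> : eps = M * ((s + 1) * (M^-1 / (s + 1) * eps)).
    by field; rewrite !gt_eqF.
  rewrite ler_pM2l // => /le_trans; apply; rewrite ler_pM2l //.
have zF : z_of F0 (vartheta P) b zs - F0 = A vs by rewrite zE addrAC subrr add0r.
split => //; exists (F0 + A vs), (zs - b *: A vs); split.
  by have := z_of_subdiff F0 th_convex b0 zs; rewrite zF zE.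
rewrite ge_max; apply/andP; split; last first.
  rewrite opprD addrA subrr add0r normrN (le_trans _ vsM) //.
  by rewrite (le_trans (opnorm_le A vs)) // ler_wpM2r.
set y := _ + adj_dF P x _.
have [Tp pE] := projP y Tsub.
move: (proj _ y) Tp pE => p Tp pE.
apply: le_trans vsM; apply: dot_norm_le; first by rewrite mulr_ge0 // ltW.
(* The upper bound on [q] controls its Gauss-Newton part by [abar]; Cauchy-Schwarz then gives [bA]
   with the same constant, so that only [abar + a <= M] enters. *)
have Aq u : b * `|A u| ^+ 2 <= abar * `|u| ^+ 2.
  have := qub u; rewrite qE dotDr !dotZr dotp_norm dotC adjointP dotp_norm; lra.
have bA : b * (`|A vs| * `|A p|) <= abar * (`|vs| * `|p|).
  have p1 : 0 <= b * (`|A vs| * `|A p|) by rewrite !mulr_ge0 // ltW.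
  have p2 : 0 <= abar * (`|vs| * `|p|) by rewrite !mulr_ge0.
  rewrite -ler_sqr ?nnegrE //.
  have -> : (b * (`|A vs| * `|A p|)) ^+ 2 = (b * `|A vs| ^+ 2) * (b * `|A p| ^+ 2) by ring.
  have -> : (abar * (`|vs| * `|p|)) ^+ 2 = (abar * `|vs| ^+ 2) * (abar * `|p| ^+ 2) by ring.
  by apply: ler_pM; rewrite ?Aq // mulr_ge0 ?sqr_ge0 // ltW.
have yp : '[y, p] = - a * '[vs, p] - b * '[A vs, A p].
  have := v_of_dot c A Tsub a0 zs Tp; rewrite -/vs => <-.
  rewrite /y !dotDl /adj_dF !adjointP dotBl dotZl /A /dF; ring.
rewrite pE // yp.
have c1 := cauchy_schwarz (- vs) p; rewrite dotNl normrN in c1.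
have c2 := cauchy_schwarz (- A vs) (A p); rewrite dotNl normrN in c2.
have h1 := ler_wpM2l (ltW a0) c1; have h2 := ler_wpM2l (ltW b0) c2.
have h3 : (abar + a) * (`|vs| * `|p|) <= M * (`|vs| * `|p|).
  by rewrite ler_wpM2r // mulr_ge0.
rewrite -mulrA; lra.
Qed.

End Model.

(** * Uniform expansions on bounded feasible sets and the decrease test *)

Section Uniform.
Context {R : realType} {X Z : euclideanType R}.
Variables (P : problem X Z) (p : algo_input X) (rho : R).

Definition local_bounds (k : R) (x : X) :=
  [/\ 0 < k, `|grad (pb_f P) x| <= k, `|pb_F P x| <= k &
      [/\ opnorm (dF P x) <= k,
       forall y, k * `|y - x| <= 1 ->
          pb_f P y <= pb_f P x + '[grad (pb_f P) x, y - x] + k * `|y - x| ^+ 2,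
       forall y, k * `|y - x| <= 1 ->
          `|pb_F P y - pb_F P x - 'd (pb_F P) x (y - x)| <= k * `|y - x| ^+ 2 &
       forall v, tangent P x v -> k * `|v| <= 1 ->
          `|retr p x v - x - v| <= k * `|v| ^+ 2]].

Hypothesis P_std : standing_assumptions P.
Hypothesis p_valid : valid_input P p.

Lemma tangent_subspace x : feas P x -> subspace (tangent P x).
Proof. by case: P_std => [[_ sub] _ _ _ _]; exact: submanifold_tangent. Qed.

Lemma uniform_local_bounds :
  exists2 k, 0 < k & forall x, feas P x -> `|x| <= rho -> local_bounds k x.
Proof.
case: P_std => [[Mc sub] fC _ FC _]; case: p_valid => [Rt _ _ _ _].
have le1 (k k' : R) (y : X) : k <= k' -> k' * `|y| <= 1 -> k * `|y| <= 1.
  by move=> kk; apply: le_trans; rewrite ler_wpM2r.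
have le2 (k k' : R) (y : X) : k <= k' -> k * `|y| ^+ 2 <= k' * `|y| ^+ 2.
  by move=> kk; rewrite ler_wpM2r ?sqr_ge0.
have [] := @compact_uniform R X (feas P `&` [set x | `|x| <= rho])
   (fun k x => feas P x -> local_bounds k x).
- by rewrite setIC; apply: compact_closedI => //; exact: euclidean_ball_compact.
- move=> k k' x kk' + Mx => /(_ Mx) [k0 h1 h2 [h3 h4 h5 h6]].
  split; [exact: lt_le_trans kk'|exact: le_trans kk'|exact: le_trans kk'|].
  split; first exact: le_trans kk'.
  + by move=> y /(le1 _ _ _ kk')/h4/le_trans; apply; rewrite lerD2l le2.
  + by move=> y /(le1 _ _ _ kk')/h5/le_trans; apply; rewrite le2.
  + by move=> v Tv /(le1 _ _ _ kk')/(h6 _ Tv)/le_trans; apply; rewrite le2.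
- move=> x0 [Mx0 _].
  have [k1 K1] := C11_fun_local x0 fC.
  have [k2 K2] := C11_map_local x0 FC.
  have [k3 K3] := retraction_local tangent_subspace Rt Mx0.
  exists (k1 + k2 + k3); near=> x => Mx.
  have [p1 g1 g2] : [/\ 0 < k1, `|grad (pb_f P) x| <= k1 &
        forall y, k1 * `|y - x| <= 1 -> pb_f P y <= pb_f P x +
          '[grad (pb_f P) x, y - x] + k1 * `|y - x| ^+ 2] by near: x.
  have [p2 l1 l2 l3] : [/\ 0 < k2, `|pb_F P x| <= k2,
        forall v, `|'d (pb_F P) x v| <= k2 * `|v| &
        forall y, k2 * `|y - x| <= 1 ->
          `|pb_F P y - pb_F P x - 'd (pb_F P) x (y - x)| <= k2 * `|y - x| ^+ 2] by near: x.
  have [p3 r1] : 0 < k3 /\ (feas P x -> forall v, tangent P x v -> k3 * `|v| <= 1 ->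
      `|retr p x v - x - v| <= k3 * `|v| ^+ 2) by near: x.
  have q1 : k1 <= k1 + k2 + k3 by lra.
  have q2 : k2 <= k1 + k2 + k3 by lra.
  have q3 : k3 <= k1 + k2 + k3 by lra.
  split; [exact: lt_le_trans q1|exact: le_trans q1|exact: le_trans q2|].
  split; first by apply: opnorm_ub => [|v]; [lra|rewrite (le_trans (l2 v)) // ler_wpM2r].
  + by move=> y /(le1 _ _ _ q1)/g2/le_trans; apply; rewrite lerD2l le2.
  + by move=> y /(le1 _ _ _ q2)/l3/le_trans; apply; rewrite le2.
  + by move=> v Tv /(le1 _ _ _ q3)/(r1 Mx _ Tv)/le_trans; apply; rewrite le2.
(* The maximum ensures positivity even if no feasible point lies in the ball. *)
move=> k kP; exists (Num.max k 1) => [|x Mx xr]; first by rewrite lt_max ltr01 orbT.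
have kk' : k <= Num.max k 1 by rewrite le_max lexx.
have [k0 h1 h2 [h3 h4 h5 h6]] := kP x (conj Mx xr) Mx.
split; [exact: lt_le_trans kk'|exact: le_trans kk'|exact: le_trans kk'|].
split; first exact: le_trans kk'.
- by move=> y /(le1 _ _ _ kk')/h4/le_trans; apply; rewrite lerD2l le2.
- by move=> y /(le1 _ _ _ kk')/h5/le_trans; apply; rewrite le2.
- by move=> v Tv /(le1 _ _ _ kk')/(h6 _ Tv)/le_trans; apply; rewrite le2.
Unshelve. all: by end_near.
Qed.

(** A large [a] shortens the step enough for the local expansions to apply, and half of it absorbs
    the quadratic error. *)
Lemma decrease_threshold : exists2 thr, 0 < thr &
  forall x (q : X -> X) a v, feas P x -> `|x| <= rho -> tangent P x v ->
    (forall u, a * `|u| ^+ 2 <= '[u, q u]) -> model P x q v <= model P x q 0 ->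
    thr <= a ->
    Theta P (retr p x v) <= model P x q v - gamma_bar p / 2 * `|v| ^+ 2.
Proof.
have [k k0 kP] := uniform_local_bounds.
have th_convex : forall (t : R) x y, 0 <= t -> t <= 1 ->
    vartheta P (t *: x + (1 - t) *: y) <= t * vartheta P x + (1 - t) * vartheta P y.
  by apply: convex_functionE; case: P_std.
case: p_valid => [_ _ [_ _ g0] _ _].
have [L L0 LP] := convex_ball_lipschitz th_convex (k + 4 + 1).
pose s := 2 * (k + L * k).
have s0 : 0 < s by rewrite mulr_gt0 // ltr_pwDl // mulr_ge0 // ltW.
(* [4 * k] comes from the remainders, as [|y - x| <= 2 * |v|], and [k ^+ 2] from the derivative of
   [f] or [F] on the retraction error; the [F] part is multiplied by [L]. *)
pose D := (1 + L) * (4 * k + k ^+ 2).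
have k2 := sqr_ge0 k.
have D0 : 0 <= D by rewrite mulr_ge0 //; lra.
(* The first summand yields [(2 * k + 1) * |v| <= 1]; the others pay for the model error and for the
   required decrease. *)
exists (s * (2 * k + 1) + 2 * D + gamma_bar p); first by nra.
move=> x q a v Mx xr Tv qa dec thra.
have [_ gk Fk [Ak fq Fq Rq]] := kP x Mx xr.
have sk : 0 < s * (2 * k + 1) by rewrite mulr_gt0 //; lra.
have a0 : 0 < a by lra.
have mE u : model P x q u = '[grad (pb_f P) x, u] + 2^-1 * '[u, q u] +
    vartheta P (pb_F P x + 'd (pb_F P) x u) + pb_f P x by rewrite /model linF_add.
have av : a * `|v| <= s.
  have slope w : vartheta P (pb_F P x) - vartheta P w <= L * `|w - pb_F P x|.
    by apply: (convex_slope th_convex w LP L0); lra.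
  have := @step_le _ _ _ (grad (pb_f P) x) ('d (pb_F P) x) (pb_F P x) (vartheta P) a L
    '[v, q v] v a0 L0 slope (qa v).
  move: dec; rewrite !mE dot0r dot0l (linear0 ('d (pb_F P) x)) addr0 mulr0 !add0r => dec.
  rewrite lerD2r in dec => /(_ dec) /le_trans; apply.
  by rewrite ler_pM2l // lerD // ler_wpM2l.
have v1 : (2 * k + 1) * `|v| <= 1.
  rewrite -(ler_pM2l s0) mulr1 mulrA (le_trans _ av) // ler_wpM2r //; lra.
have nv := normr_ge0 v.
have kv : k * `|v| <= 2^-1 by nra.
have vle1 : `|v| <= 1 by nra.
set y := retr p x v.
have kv1 : k * `|v| <= 1 by lra.
have Ry := Rq v Tv kv1; rewrite -/y in Ry.
have yx : `|y - x| <= 2 * `|v|.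
  have := ler_normD (y - x - v) v; rewrite subrK => h.
  have : k * `|v| ^+ 2 <= `|v| by rewrite expr2 mulrA ler_piMl.
  lra.
have kyx : k * `|y - x| <= 1.
  by have := ler_wpM2l (ltW k0) yx; lra.
have yx2 : `|y - x| ^+ 2 <= 4 * `|v| ^+ 2.
  have -> : 4 * `|v| ^+ 2 = (2 * `|v|) ^+ 2 by ring.
  by rewrite ler_sqr ?nnegrE // mulr_ge0.
have kyx2 := ler_wpM2l (ltW k0) yx2.
have fy := fq y kyx.
have yE : y - x = v + (y - x - v) by rewrite [RHS]addrC subrK.
have gy : '[grad (pb_f P) x, y - x] <= '[grad (pb_f P) x, v] + k * (k * `|v| ^+ 2).
  rewrite {1}yE dotDr lerD2l (le_trans (cauchy_schwarz _ _)) // ler_pM //.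
have Fy : `|pb_F P y - (pb_F P x + 'd (pb_F P) x v)| <= (4 * k + k ^+ 2) * `|v| ^+ 2.
  have -> : pb_F P y - (pb_F P x + 'd (pb_F P) x v) =
      (pb_F P y - pb_F P x - 'd (pb_F P) x (y - x)) + 'd (pb_F P) x (y - x - v).
    by rewrite ['d (pb_F P) x (y - x - v)]linearB addrA subrK opprD addrA.
  rewrite (le_trans (ler_normD _ _)) //.
  have h1 := le_trans (Fq y kyx) kyx2.
  have h2 : `|'d (pb_F P) x (y - x - v)| <= k * (k * `|v| ^+ 2).
    rewrite (le_trans (opnorm_le ('d (pb_F P) x) _)) // ler_pM //.
    exact: opnorm_ge0.
  have -> : (4 * k + k ^+ 2) * `|v| ^+ 2 = k * (4 * `|v| ^+ 2) + k * (k * `|v| ^+ 2) by ring.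
  exact: lerD.
have n1 : `|pb_F P x + 'd (pb_F P) x v| <= k + 1.
  rewrite (le_trans (ler_normD _ _)) // lerD // (le_trans (opnorm_le ('d (pb_F P) x) v)) //.
  by rewrite (le_trans (ler_wpM2r nv Ak)).
have small : (4 * k + k ^+ 2) * `|v| ^+ 2 <= 3.
  have -> : (4 * k + k ^+ 2) * `|v| ^+ 2 = 4 * (k * `|v|) * `|v| + (k * `|v|) ^+ 2 by ring.
  have kv0 : 0 <= k * `|v| by rewrite mulr_ge0 // ltW.
  move: kv kv0 nv vle1; move: (k * `|v|) (`|v|) => r n; nra.
have n2 : `|pb_F P y| <= k + 4 + 1.
  rewrite -(subrK (pb_F P x + 'd (pb_F P) x v) (pb_F P y)).
  by rewrite (le_trans (ler_normD _ _)) //; lra.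
have n3 : `|pb_F P x + 'd (pb_F P) x v| <= k + 4 + 1 by lra.
have := LP _ _ n3 n2 => thy.
have thy2 := ler_wpM2l L0 Fy.
have qv := qa v.
have Dv : (2 * D + gamma_bar p) * `|v| ^+ 2 <= a * `|v| ^+ 2.
  by rewrite ler_wpM2r ?sqr_ge0 //; lra.
have DE : D * `|v| ^+ 2 = (4 * k + k ^+ 2) * `|v| ^+ 2 + L * ((4 * k + k ^+ 2) * `|v| ^+ 2).
  by rewrite /D; ring.
rewrite /Theta mE.
move: fy gy kyx2 thy thy2 qv Dv DE.
move: (pb_f P y) (pb_f P x) (vartheta P (pb_F P y)) (vartheta P _) => fy fx ty tv.
move: '[_, y - x] '[_, v] '[v, q v] (`|pb_F P y - _|) => gy gv qv n.
move: (`|y - x| ^+ 2) (`|v| ^+ 2) => y2 vv.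
lra.
Qed.

End Uniform.

(** * Length of a run and number of its oracle calls *)

Section Run.
Context {R : realType} {X Z : euclideanType R}.
Variables (P : problem X Z) (p : algo_input X) (tol : R) (t : trace X).
Hypothesis P_std : standing_assumptions P.
Hypothesis p_valid : valid_input P p.
Hypothesis tol_ge0 : 0 <= tol.
Hypothesis run : RiVMPL_run P p tol t.

Local Notation vis := (visited P p tol t).

Lemma visited_history k j : vis k j ->
  [/\ forall k' j', (k' < k)%N -> (j' <= j_last t k')%N ->
        vis k' j' /\ tol < `|iter_v t k' j'|,
      forall j', (j' <= j)%N -> vis k j' &
      forall j', (j' < j)%N -> tol < `|iter_v t k j'|].
Proof.
case: run => _ _ _ _ last_j.
elim=> [|{}k {}j vkj [h1 h2 h3] tv nd|{}k {}j vkj [h1 h2 h3] tv sd].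
- by split => // j'; rewrite leqn0 => /eqP ->; exact: visited_init.
- split => // j'; rewrite leq_eqVlt => /orP[/eqP ej|].
  + by rewrite ej; exact: visited_inner.
  + by rewrite ltnS; exact: h2.
  + by move: ej => [->].
  + by rewrite -ltnS; exact: h3.
have [jl _] := last_j _ _ vkj tv sd.
split=> [k' j'|j'|//].
  rewrite ltnS leq_eqVlt => /orP[/eqP ->|]; last exact: h1.
  rewrite jl => jj; split; first exact: h2.
  by move: jj; rewrite leq_eqVlt => /orP[/eqP -> //|]; exact: h3.
by rewrite leqn0 => /eqP ->; exact: visited_outer sd.
Qed.

Lemma visited0 k j : vis k j -> vis k 0.
Proof. by move=> /visited_history[_ h _]; exact: h. Qed.

Lemma visited_feas k j : vis k j -> feas P (iter_x t k).
Proof.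
case: run => x0 _ sol _ next; case: p_valid => [[RM _ _ _] _ _ _ Mx0].
elim=> [|//|{}k {}j vkj Mx tv sd]; first by rewrite x0.
have [_ ->] := next _ _ vkj tv sd; apply: RM => //.
by have [_ _ []] := sol _ _ vkj.
Qed.

Lemma visited_alpha k j : vis k j -> iter_alpha t k j = sigma p ^+ j * iter_alpha t k 0.
Proof.
case: run => _ _ _ grow _.
elim=> [|{}k {}j vkj IH tv nd|*]; rewrite ?expr0 ?mul1r //.
by rewrite (grow _ _ vkj tv nd) IH mulrA exprS.
Qed.

Lemma visited_alpha_min k j : vis k j -> alpha_min p <= iter_alpha t k j.
Proof.
move=> vkj; case: run => _ init _ _ _; case: p_valid => [_ /andP[am _] _ s1 _].
have [/andP[a1 _] _] := init _ (visited0 vkj).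
rewrite visited_alpha // (le_trans a1) // ler_peMl ?exprn_ege1 ?ltW //.
exact: lt_le_trans a1.
Qed.

(** The stepsizes grow geometrically; Bernoulli's inequality replaces the logarithm, a constant
    bound being enough. *)
Lemma visited_inner_bound b k j : stepsizes_bounded P p b tol t -> vis k j ->
  j%:R <= b / (alpha_min p * (sigma p - 1)).
Proof.
move=> bP vkj; have := bP _ _ vkj; rewrite visited_alpha //.
case: run => _ init _ _ _; case: p_valid => [_ /andP[am _] _ s1 _].
have [/andP[a1 _] _] := init _ (visited0 vkj).
have s0 : 0 < sigma p - 1 by rewrite subr_gt0.
rewrite ler_pdivlMr ?mulr_gt0 //; apply: le_trans.
have bern : j%:R * (sigma p - 1) <= sigma p ^+ j.
  elim: (j) => [|i IH]; first by rewrite mul0r.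
  have si : 1 <= sigma p ^+ i by rewrite exprn_ege1 // ltW.
  rewrite -natr1 exprS; have := ler_wpM2l (ltW s0) si; lra.
have sj : 0 <= sigma p ^+ j by rewrite exprn_ge0 //; lra.
have h1 := ler_wpM2l (ltW am) bern; have h2 := ler_wpM2l sj a1; lra.
Qed.

Lemma Theta_decrease k j : vis k j ->
  Theta P (iter_x t k) + k%:R * (gamma_bar p / 2 * tol ^+ 2) <= Theta P (x_init p).
Proof.
case: run => x0 _ sol _ next; case: p_valid => [_ _ [_ _ g0] _ _].
elim=> [|//|{}k {}j vkj IH tv sd]; first by rewrite x0 mul0r addr0.
have [_ ->] := next _ _ vkj tv sd.
have [_ _ [_ _ dec _]] := sol _ _ vkj.
have m0 q : model P (iter_x t k) q 0 = Theta P (iter_x t k).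
  by rewrite /model /Theta linF_add dot0r dot0l linear0 mulr0 !add0r addr0 addrC.
rewrite m0 in dec.
have h : gamma_bar p / 2 * tol ^+ 2 <= gamma_bar p / 2 * `|iter_v t k j| ^+ 2.
  by rewrite ler_pM2l ?divr_gt0 // ler_sqr ?nnegrE // ltW.
by rewrite -natr1 mulrDl mul1r; move: sd; rewrite /sufficient_decrease; lra.
Qed.

(** Without a stop, bounded stepsizes end every inner loop, so all outer indices are reached and
    [Theta] decreases below its lower bound. *)
Lemma run_stops b : stepsizes_bounded P p b tol t -> 0 < tol ->
  exists k j, stops_at P p tol t k j.
Proof.
move=> bP tol0; apply: contrapT => nostop.
have unbounded (c : R) : exists n : nat, c < n%:R.
  by exists (Num.bound `|c|); rewrite (le_lt_trans (ler_norm c)) // archi_boundP.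
have big k j : vis k j -> tol < `|iter_v t k j|.
  by move=> vkj; rewrite ltNge; apply/negP => h; apply: nostop; exists k, j.
have all k : vis k 0.
  elim: k => [|k vk]; first exact: visited_init.
  have [[j [vkj sd]]|no] := pselect (exists j, vis k j /\ sufficient_decrease P p t k j).
    exact: visited_outer (big _ _ vkj) sd.
  have allj j : vis k j.
    elim: j => // j vkj; apply: visited_inner (big _ _ vkj) _ => //.
    by move=> sd; apply: no; exists j.
  have [n] := unbounded (b / (alpha_min p * (sigma p - 1))).
  by rewrite ltNge (visited_inner_bound bP (allj n)).
case: P_std p_valid => [_ _ _ _ [B BP]] [_ _ [_ _ g0] _ _].
have d0 : 0 < gamma_bar p / 2 * tol ^+ 2 by rewrite mulr_gt0 ?divr_gt0 ?exprn_gt0.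
have [n] := unbounded ((Theta P (x_init p) - B) / (gamma_bar p / 2 * tol ^+ 2)).
rewrite ltNge ler_pdivlMr // => /negP; apply.
have := Theta_decrease (all n).
have : B <= Theta P (iter_x t n) by apply: BP; exists (iter_x t n) => //; exact: visited_feas (all n).
lra.
Qed.

Lemma size_flatten_le (T : Type) (f : nat -> seq T) (s : seq nat) (B : R) :
  (forall i, i \in s -> (size (f i))%:R <= B) ->
  (size (flatten [seq f i | i <- s]))%:R <= (size s)%:R * B.
Proof.
elim: s => [|i s IH] h /=; first by rewrite mul0r.
rewrite size_cat natrD -natr1 mulrDl mul1r addrC lerD ?h ?mem_head //.
by apply: IH => l ls; rewrite h // inE ls orbT.
Qed.

(** A dual step costs at most 9 calls: 4 at each of the two multipliers and 1 for the average. The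
    last 2 evaluate [f] and [F] at the trial point. *)
Lemma size_subproblem_queries out (d : dfg_data Z) k j :
  (size (subproblem_queries P p out d t k j))%:R <= (dfg_steps d k j)%:R * 9 + 2 :> R.
Proof.
rewrite size_cat natrD lerD2r /dfg_queries -{2}(size_iota 1 (dfg_steps d k j)).
by apply: size_flatten_le => l _; rewrite /dfg_step_queries !size_cat ler_nat; case: out.
Qed.

Lemma queries_before_le out (d : dfg_data Z) k j (S J : R) : 0 <= S ->
  (forall k' j', vis k' j' -> tol < `|iter_v t k' j'| ->
     (size (subproblem_queries P p out d t k' j'))%:R <= S) ->
  (forall k' j', vis k' j' -> j'%:R <= J) -> vis k j ->
  (size (queries_before P p out d t k j))%:R <= (k%:R + 1) * (3 + (J + 1) * S).
Proof.
move=> S0 SP JP vkj; have [h1 h2 h3] := visited_history vkj.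
rewrite /queries_before !size_cat !natrD mulrDl mul1r addrA -addrA.
have inner : (size (flatten [seq subproblem_queries P p out d t k j' | j' <- iota 0 j]))%:R
    <= (J + 1) * S.
  have := @size_flatten_le _ (subproblem_queries P p out d t k) (iota 0 j) S.
  rewrite size_iota => h; apply: (le_trans (h _)).
    by move=> i; rewrite mem_iota add0n => /andP[_ ij]; apply: SP; [apply: h2; exact: ltnW|exact: h3].
  by rewrite ler_wpM2r // (le_trans (JP _ _ vkj)) // lerDl.
rewrite lerD // ?lerD //.
rewrite -{2}(size_iota 0 k); apply: size_flatten_le => k'; rewrite mem_iota add0n => /andP[_ kk].
rewrite size_cat natrD lerD //.
have := @size_flatten_le _ (subproblem_queries P p out d t k') (iota 0 (j_last t k').+1) S.
rewrite size_iota => h; apply: (le_trans (h _)).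
  move=> i; rewrite mem_iota add0n ltnS => /andP[_ ij].
  by have [] := h1 _ _ kk ij; exact: SP.
rewrite ler_wpM2r // -natr1 lerD2r; apply: (JP k').
by have [] := h1 _ _ kk (leqnn _).
Qed.

End Run.

(** * Uniform stepsize bound, tolerance and total complexity *)

Section Assembly.
Context {R : realType} {X Z : euclideanType R}.
Variables (P : problem X Z) (p : algo_input X) (rho : R).
Hypothesis P_std : standing_assumptions P.
Hypothesis p_valid : valid_input P p.

Lemma stepsizes_uniformly_bounded : exists b : R, 0 < b /\
  forall (tol : R) (t : trace X), 0 <= tol -> RiVMPL_run P p tol t ->
    iterates_bounded P p rho tol t -> stepsizes_bounded P p b tol t.
Proof.
have [thr thr0 thrP] := decrease_threshold rho P_std p_valid.
have s1 : 1 < sigma p by case: p_valid.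
have s0 : 0 < sigma p := lt_trans ltr01 s1.
(* A stepsize is multiplied by [sigma p] only after a rejection, which happens only below the
   threshold [thr]. *)
exists (Num.max (alpha_max p) (sigma p * thr)); split.
  by rewrite lt_max mulr_gt0 ?orbT.
move=> tol t tol0 run bnd k j vkj.
case: (run) => _ init sol grow _.
have vis_init i : visited P p tol t i 0 ->
    iter_alpha t i 0 <= Num.max (alpha_max p) (sigma p * thr).
  by move=> /init[/andP[_ a1] _]; rewrite le_max a1.
elim: vkj => [|{}k {}j vkj _ tv nd|{}k {}j vkj _ tv sd].
- exact: vis_init (visited_init _ _ _ _).
- rewrite (grow _ _ vkj tv nd) le_max; apply/orP; right; rewrite ler_pM2l //.
  rewrite leNgt; apply/negP => /ltW thra; apply: nd.
  have [_ Q2 [Tv _ dec _]] := sol _ _ vkj.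
  apply: thrP Tv _ dec thra; first exact: visited_feas vkj.
    exact: bnd vkj.
  by move=> u; have /andP[] := Q2 u.
- exact: vis_init (visited_outer vkj tv sd).
Qed.

Lemma inv_pow (out : primal_output) (r : R) :
  (if out is Last then r ^- 2 else r ^- 1) = r^-1 ^+ (if out is Last then 2 else 1).
Proof. by case: out; rewrite exprVn. Qed.

(** [chi] depends on the run through [c_dF]; its lower bound in terms of [k] does not, which keeps
    the complexity constants independent of [eps]. *)
Lemma chi_bounds (b k tol : R) (t : trace X) : 0 < b ->
  (forall i j, visited P p tol t i j -> opnorm (dF P (iter_x t i)) <= k) ->
  let M := Num.max (b + alpha_bar p) (c_dF P p tol t) in
  let s := Num.sqrt ((alpha_min p)^-1 * mu_max p) in
  [/\ 0 < M, chi P p b tol t = M^-1 / (s + 1),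
      forall i j, visited P p tol t i j -> opnorm (dF P (iter_x t i)) <= M &
      (Num.max (b + alpha_bar p) k)^-1 / (s + 1) <= chi P p b tol t].
Proof.
move=> b0 kP M s.
case: p_valid => [_ _ [_ ab0 _] _ _].
have M0 : 0 < M by rewrite lt_max addr_gt0.
have v00 : visited P p tol t 0 0 by exact: visited_init.
have s0 : 0 < s + 1 by rewrite ltr_wpDl // sqrtr_ge0.
split => //.
  move=> i j vij; rewrite le_max; apply/orP; right.
  apply: ub_le_sup; last by exists i => //; exists j.
  by exists k => _ [i' [j' vij'] <-]; exact: kP vij'.
rewrite /chi ler_pM2r ?invr_gt0 // lef_pV2 ?posrE // ?lt_max ?addr_gt0 //.
rewrite ge_max le_max lexx /= le_max; apply/orP; right.
apply: ge_sup; first by exists (opnorm (dF P (iter_x t 0))), 0 => //; exists 0.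
by move=> _ [i' [j' vij'] <-]; exact: kP vij'.
Qed.

End Assembly.

(** Steps before the final subproblem are longer than [tol], hence the bound in [eps] alone for the
    calls made so far. The final step is at most [tol], so the cost of computing it is expressed
    through its own norm when it is nonzero. *)
Theorem theorem4p2 (R : realType) (X Z : euclideanType R)
    (P : problem X Z) (p : algo_input X)
    (mu_min beta_min beta_max rho : R) (Z0 : set Z) :
  standing_assumptions P -> valid_input P p ->
  0 < mu_min -> 0 < beta_min -> bounded_set Z0 ->
  (exists b_alpha : R, 0 < b_alpha /\
     forall (tol : R) (t : trace X), 0 <= tol ->
       RiVMPL_run P p tol t -> iterates_bounded P p rho tol t ->
       stepsizes_bounded P p b_alpha tol t) /\
  forall (out : primal_output) (b_alpha : R), 0 < b_alpha ->
    exists C : R, 0 < C /\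
    forall (eps tol : R) (t : trace X) (d : dfg_data Z),
      0 < eps ->
      tol = chi P p b_alpha tol t * eps ->
      RiVMPL_run P p tol t ->
      iterates_bounded P p rho tol t ->
      stepsizes_bounded P p b_alpha tol t ->
      (forall k, visited P p tol t k 0 -> mu_min <= iter_mu t k) ->
      (forall k, visited P p tol t k 0 -> beta_min <= beta d k <= beta_max) ->
      solved_by_DFG P p out Z0 d tol t ->
      exists k j : nat,
        [/\ stops_at P p tol t k j,
            eps_stationary P eps (iter_x t k),
            eps <= 1 ->
            (size (queries_before P p out d t k j))%:R
              <= C * (if out is Last then eps ^- 4 else eps ^- 3) &
            eps <= 1 -> iter_v t k j != 0 ->
            (size (queries_upto P p out d t k j))%:R
              <= C * (if out is Last
                      then eps ^- 4 + `|iter_v t k j| ^- 2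
                      else eps ^- 3 + `|iter_v t k j| ^- 1)].
Proof.
move=> P_std p_valid mu0 beta0 Z0_bounded; split.
  exact: stepsizes_uniformly_bounded.
move=> out b b0.
have th_convex : forall (t : R) x y, 0 <= t -> t <= 1 ->
    vartheta P (t *: x + (1 - t) *: y) <= t * vartheta P x + (1 - t) * vartheta P y.
  by apply: convex_functionE; case: P_std.
have [k k0 kP] := uniform_local_bounds rho P_std p_valid.
have [Yb YbP] : exists Yb, forall z, Z0 z -> `|z| <= Yb.
  have := @filter_ex _ (pinfty_nbhs R) _ _ Z0_bounded.
  by move=> [Yb YbP]; exists Yb.
case: (p_valid) => [_ /andP[am0 _] [mm0 ab0 gb0] s1 Mx0].
have [K K0 KP] :=
  @dual_steps_bound R X Z P th_convex k k k (alpha_min p) b beta_min beta_max Yb mu_min am0 beta0 mu0.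
have [B BP] : exists B, forall x, feas P x -> B <= Theta P x.
  by case: P_std => [_ _ _ _ [B BP]]; exists B => x Mx; apply: BP; exists x.
pose s := Num.sqrt ((alpha_min p)^-1 * mu_max p).
pose chi0 := (Num.max (b + alpha_bar p) k)^-1 / (s + 1).
have chi0_gt0 : 0 < chi0.
  by rewrite divr_gt0 ?invr_gt0 ?lt_max ?k0 ?orbT // ltr_wpDl // sqrtr_ge0.
pose J := b / (alpha_min p * (sigma p - 1)).
have J0 : 0 <= J by rewrite divr_ge0 ?mulr_ge0 ?subr_ge0 // ltW.
(* [De / tol ^+ 2] will bound the index of the final outer iteration. *)
pose De := (Theta P (x_init p) - B) / (gamma_bar p / 2).
have De0 : 0 <= De by rewrite divr_ge0 ?subr_ge0 ?BP // divr_ge0 // ltW.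
pose h := chi0^-1; have h0 : 0 < h by rewrite invr_gt0.
(* The number of dual steps is of order [|v| ^- q]. *)
pose q : nat := if out is Last then 2%N else 1%N.
have hq0 : 0 <= h ^+ q by rewrite exprn_ge0 // ltW.
pose C0 := (De * h ^+ 2 + 1) * (3 + (J + 1) * (K * (1 + h ^+ q) * 9 + 2)).
have c1 : 0 <= De * h ^+ 2 by rewrite mulr_ge0 // sqr_ge0.
have c2 : 0 <= K * (1 + h ^+ q) * 9 by rewrite !mulr_ge0 ?addr_ge0 // ltW.
have C00 : 0 <= C0.
  by rewrite mulr_ge0 ?addr_ge0 // mulr_ge0 ?addr_ge0.
exists (C0 + K * 9 + 2); split; first by lra.
move=> eps tol t d eps0 tolE run bnd bP muP betaP solved.
have loc i j : visited P p tol t i j -> local_bounds P p k (iter_x t i).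
  by move=> vij; apply: kP; [exact: visited_feas vij|exact: bnd vij].
have opk i j : visited P p tol t i j -> opnorm (dF P (iter_x t i)) <= k.
  by move=> /loc[_ _ _ []].
have [M0 chiE opM chi_ge] := chi_bounds p_valid b0 opk.
have tol_ge : chi0 * eps <= tol by rewrite tolE ler_pM2r.
have tol0 : 0 < tol by apply: lt_le_trans tol_ge; rewrite mulr_gt0.
have Tsub i j : visited P p tol t i j -> subspace (tangent P (iter_x t i)).
  by move=> vij; apply: tangent_subspace => //; exact: visited_feas vij.
have alpha_itv i j : visited P p tol t i j -> alpha_min p <= iter_alpha t i j <= b.
  by move=> vij; rewrite (visited_alpha_min p_valid run vij) (bP _ _ vij).
have steps i j : visited P p tol t i j -> iter_v t i j != 0 ->
    (dfg_steps d i j)%:R <= K * (1 + `|iter_v t i j|^-1 ^+ q).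
  move=> vij; have [qE [zZ N0] vE _ fail] := solved _ _ vij.
  have v0 := visited0 run vij; have [_ g1 f1 [Ak _ _ _]] := loc _ _ vij.
  rewrite /q -inv_pow vE => vn0.
  exact: (KP out (iter_x t i) (iter_Q t i j) (iter_alpha t i j) (beta d i) (iter_mu t i)
    _ _ (Tsub _ _ vij) g1 Ak f1 (alpha_itv _ _ vij) (betaP _ v0) (YbP _ zZ) (muP _ v0) qE N0 fail vn0).
have [i [j ij]] := run_stops P_std p_valid (ltW tol0) run bP tol0.
have [vij vsmall] := ij.
(* The exponent 2 counts the outer iterations and [q] the dual steps of one subproblem; [eps <= 1]
   absorbs the additive constants. *)
have before_le : eps <= 1 ->
    (size (queries_before P p out d t i j))%:R <= C0 * eps^-1 ^+ (2 + q).
  move=> eps1; set e := eps^-1.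
  have e1 : 1 <= e by rewrite invf_ge1.
  have e0 : 0 < e := lt_le_trans ltr01 e1.
  have tinv : tol^-1 <= h * e.
    by rewrite /h /e -invfM lef_pV2 ?posrE // mulr_gt0.
  have eq1 : 1 <= e ^+ q by rewrite exprn_ege1.
  pose S := K * (1 + (h * e) ^+ q) * 9 + 2.
  have S0 : 0 <= S.
    by rewrite addr_ge0 // !mulr_ge0 ?addr_ge0 // ?exprn_ge0 ?mulr_ge0 // ltW.
  have := @queries_before_le R X Z P p tol t run out d i j S J S0.
  move=> /(_ _ _ vij) => main.
  have {}main := main _ (fun i' j' v' => visited_inner_bound p_valid run bP v').
  apply: le_trans (main _) _.
    move=> i' j' v' tv; apply: le_trans (size_subproblem_queries _ _ _ _ _ _ _) _.
    have vpos : 0 < `|iter_v t i' j'| := lt_trans tol0 tv.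
    rewrite lerD2r ler_wpM2r // (le_trans (steps _ _ v' _)) ?normr_gt0 -?normr_gt0 //.
    rewrite ler_pM2l // lerD2l lerXn2r ?nnegrE ?invr_ge0 ?mulr_ge0 // ?ltW //.
    apply: lt_le_trans tinv; by rewrite ltf_pV2 ?posrE.
  have ki : i%:R <= De * (h * e) ^+ 2.
    have := Theta_decrease p_valid (ltW tol0) run vij.
    have := BP _ (visited_feas p_valid run vij) => h1 h2.
    have tol2 : 0 < tol ^+ 2 by rewrite exprn_gt0.
    have : i%:R * tol ^+ 2 <= De.
      by rewrite ler_pdivlMr ?divr_gt0 //; lra.
    rewrite -ler_pdivlMr // => /le_trans; apply.
    rewrite ler_wpM2l // -exprVn lerXn2r ?nnegrE ?invr_ge0 ?mulr_ge0 // ltW //.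
  have f1 : i%:R + 1 <= (De * h ^+ 2 + 1) * e ^+ 2.
    have : 1 <= e ^+ 2 by rewrite exprn_ege1.
    by rewrite exprMn in ki; lra.
  have f2 : 3 + (J + 1) * S <= (3 + (J + 1) * (K * (1 + h ^+ q) * 9 + 2)) * e ^+ q.
    have g1 : S <= (K * (1 + h ^+ q) * 9 + 2) * e ^+ q.
      rewrite /S exprMn; have := ler_wpM2l (ltW K0) eq1.
      by move: (h ^+ q) (e ^+ q) eq1 => u w; lra.
    have J1 : 0 <= J + 1 by rewrite addr_ge0.
    by have := ler_wpM2l J1 g1; lra.
  have g3 : 0 <= i%:R + 1 :> R by rewrite addr_ge0.
  have g4 : 0 <= 3 + (J + 1) * S.
    by apply: addr_ge0 => //; apply: mulr_ge0 => //; exact: addr_ge0.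
  by rewrite exprD /C0 mulrACA; exact: ler_pM.
have upto : eps <= 1 -> iter_v t i j != 0 ->
    (size (queries_upto P p out d t i j))%:R
      <= (C0 + K * 9 + 2) * (eps^-1 ^+ (2 + q) + `|iter_v t i j|^-1 ^+ q).
  move=> eps1 vn0; rewrite size_cat natrD.
  have := before_le eps1; have := steps _ _ vij vn0.
  have := @size_subproblem_queries R X Z P p t out d i j.
  have : 1 <= eps^-1 ^+ (2 + q) by rewrite exprn_ege1 // invf_ge1.
  have : 0 <= `|iter_v t i j|^-1 ^+ q by rewrite exprn_ge0 // invr_ge0.
  move: (_ ^+ (2 + q)) (_ ^+ q) => u w w0 u1 n1 n2 n3.
  have h1 : 0 <= C0 * w by rewrite mulr_ge0.
  have h2 : 0 <= K * (u - 1) by rewrite mulr_ge0 ?subr_ge0 // ltW.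
  lra.
exists i, j; split => //.
- have [qE _ _ _ _] := solved _ _ vij.
  case: (run) => _ /(_ _ (visited0 run vij)) [_ /andP[_ mule]] /(_ _ _ vij) [_ Q2 sol] _ _.
  have /andP[b1 _] := betaP _ (visited0 run vij).
  have /andP[al1 al2] := alpha_itv _ _ vij.
  apply: (small_step_stationary th_convex (visited_feas p_valid run vij) (Tsub _ _ vij)
    am0 al1 (lt_le_trans beta0 b1) (ltW ab0) mule qE _ sol M0 _ (opM _ _ vij)).
  + by move=> u; have /andP[] := Q2 u.
  + by rewrite le_max addrC lerD2r al2.
  + by rewrite -/s -chiE -tolE.
- move=> eps1; apply: le_trans (before_le eps1) _.
  have -> : (if out is Last then eps ^- 4 else eps ^- 3) = eps^-1 ^+ (2 + q).
    by rewrite /q; case: (out); rewrite exprVn.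
  apply: ler_wpM2r; first by rewrite exprn_ge0 // invr_ge0 ltW.
  by rewrite -addrA lerDl addr_ge0 // mulr_ge0 // ltW.
- move=> eps1 vn0; apply: le_trans (upto eps1 vn0) _.
  by rewrite /q; case: (out); rewrite !exprVn.
Qed.
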